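(* Let $E$ be a de Branges function, written as $$E(z)=\gamma\,G(z)\,e^{-i\sigma z}\prod_{n=1}^\infty\Big(1-\frac{z}{\overline{z_n}}\Big)e^{\frac12(p_n(z)+p_n^*(z))},$$ where $(\overline{z_n})$ are the zeros of $E$ in the open lower half-plane (so $z_n$ lies in the open upper half-plane), ordered with $|z_n|\le|z_{n+1}|$ and satisfying $\sum_n|\mathrm{Im}(1/z_n)|<\infty$, $\sigma\ge 0$, $|\gamma|=1$, $p_n(z)=\sum_{k=1}^n\frac{z^k}{k\,\overline{z_n}^k}$, and $G$ is an entire function with $G=G^*$ whose zeros are real. Then multiplication by $z$ in $\mathcal{H}(E)$ is densely defined if and only if at least one of the following holds: (i) $\sigma>0$; (ii) $\sum_n\mathrm{Im}(z_n)=\infty$.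
   Context: A de Branges function is an entire function $E$ with $|E(z)|>|E(\overline z)|$ for all $z$ in the open upper half-plane $\mathbb{U}$; $f^*(z)=\overline{f(\overline z)}$. The de Branges space $\mathcal{H}(E)$ is the Hilbert space of entire functions $f$ with $f/E,f^*/E\in H^2(\mathbb{U})$, with inner product $\langle f,g\rangle=\int_{\mathbb{R}}f\overline g\,|E|^{-2}dx$. Multiplication by $z$ in $\mathcal{H}(E)$ is $f\mapsto zf$ on the maximal domain $\{f\in\mathcal{H}(E): zf\in\mathcal{H}(E)\}$. *)

(* Defs.v *)
From HB Require Import structures.
From mathcomp Require Import all_boot all_order all_algebra.
From mathcomp Require Import all_classical all_reals all_analysis.
From mathcomp Require Import complex Rstruct Rstruct_topology.
Import Order.TTheory GRing.Theory Num.Theory.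
Import numFieldNormedType.Exports.

Set Implicit Arguments.
Unset Strict Implicit.
Unset Printing Implicit Defensive.

Local Open Scope ring_scope.
Local Open Scope classical_set_scope.

Notation R := Rdefinitions.R.
Notation C := (R[i]).

Definition iC : C := Complex 0 1.
Definition cconj (z : C) : C := Complex (complex.Re z) (- complex.Im z).
Definition absC (z : C) : R := Num.sqrt (complex.Re z ^+ 2 + complex.Im z ^+ 2).
Definition RtoC (x : R) : C := Complex x 0.

Definition expC (z : C) : C :=
  RtoC (expR (complex.Re z)) * Complex (cos (complex.Im z)) (sin (complex.Im z)).

Definition fstar (f : C -> C) : C -> C := fun z => cconj (f (cconj z)).

Definition holo_at (f : C -> C) (z : C) : Prop :=
  exists l : C, forall e : R, 0 < e -> exists d : R, 0 < d /\
    forall h : C, h != 0 -> absC h < d ->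
      absC ((f (z + h) - f z) / h - l) < e.

Definition entire (f : C -> C) : Prop := forall z, holo_at f z.

Definition deBranges (E : C -> C) : Prop :=
  entire E /\ forall z, 0 < complex.Im z -> absC (E (cconj z)) < absC (E z).

Definition H2U (F : C -> C) : Prop :=
  (forall z, 0 < complex.Im z -> holo_at F z) /\
  exists M : R, forall y : R, 0 < y ->
    (\int[lebesgue_measure]_x ((absC (F (Complex x y))) ^+ 2)%:E <= M%:E)%E.

Definition in_HE (E f : C -> C) : Prop :=
  entire f /\ H2U (fun z => f z / E z) /\ H2U (fun z => fstar f z / E z).

Definition HE_norm2 (E f : C -> C) : \bar R :=
  (\int[lebesgue_measure]_x ((absC (f (RtoC x)) / absC (E (RtoC x))) ^+ 2)%:E)%E.

Definition mulz_dom (E : C -> C) (f : C -> C) : Prop :=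
  in_HE E f /\ in_HE E (fun z => z * f z).

Definition mulz_densely_defined (E : C -> C) : Prop :=
  forall f, in_HE E f -> forall e : R, 0 < e ->
    exists g, mulz_dom E g /\ (HE_norm2 E (fun z => (f z - g z)%R) < e%:E)%E.

(* index set of the zeros: n = 1, 2, ..., K (K = None means infinitely many) *)
Definition inZ (K : option nat) (n : nat) : bool :=
  (1 <= n)%N && (if K is Some k then (n <= k)%N else true).

Definition pn (n : nat) (w z : C) : C :=
  \sum_(1 <= k < n.+1) z ^+ k / (k%:R * (cconj w) ^+ k).

Definition dB_factor (n : nat) (w z : C) : C :=
  (1 - z / cconj w) * expC ((pn n w z + cconj (pn n w (cconj z))) / 2%:R).

Definition dB_partial (K : option nat) (zs : nat -> C) (N : nat) (z : C) : C :=
  \prod_(1 <= n < N.+1 | inZ K n) dB_factor n (zs n) z.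

Definition cvgC (u : nat -> C) (l : C) : Prop :=
  (fun N => absC (u N - l)) @ \oo --> (0 : R).

(* Main.v *)
Require Import Defs.
From HB Require Import structures.
From mathcomp Require Import all_boot all_order all_algebra.
From mathcomp Require Import all_classical all_reals all_analysis.
From mathcomp Require Import measurable_realfun complex Rstruct Rstruct_topology.
From mathcomp Require Import ring lra.
Import Order.TTheory GRing.Theory Num.Theory.
Import numFieldNormedType.Exports Normc.
Set Implicit Arguments.
Unset Strict Implicit.
Unset Printing Implicit Defensive.
Local Open Scope ring_scope.
Local Open Scope classical_set_scope.

(* Put Theta = E^*/E. By the product formula, on the imaginary axis |Theta|^2 is
   exp(-4 sigma y) times a product of factors 1 - x_n with x_n close to 4 Im(z_n)/y for
   large y. Hence y (1 - |Theta(iy)|^2) tends to infinity if sigma > 0 or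
   sum Im(z_n) = oo; otherwise |Theta(iy) - u| = O(1/y) for a unimodular constant u.

   In the second case the Poisson formula shows that E - u^-1 E^* belongs to H(E), and
   Cauchy's theorem, applied to (z + i) g / E and (z + i) g^* / E, shows that it is
   orthogonal to the domain of multiplication by z.

   In the first case let w = iy, let Q be the reproducing kernel at w and
   c = f(w)/Q(w). Then g = -w (f - c Q)/(z - w) is in the domain and
   f - g = (z f - w c Q)/(z - w). The norm of the first term tends to 0 by dominated
   convergence. The squared norm of the second is at most a constant times
   |f(w)/E(w)|^2 y/(1 - |Theta(w)|^2), which tends to 0: the integral of
   (f/E) (1 - conj(Theta) Theta(w))/(t - w) over the line equals 2 pi i f(w)/E(w), the
   kernel has square norm at most pi (1 - |Theta(w)|^2)/y, and after normalisation it
   tends to 0 pointwise. *)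

(** Up to a constant, |f(w)/E(w)|^2 y/(1 - |Theta(w)|^2) is the squared pairing of f with the
    normalised reproducing kernel at w. So the first case says that these unit vectors tend weakly
    to 0 as w goes to i oo along the axis. In the second case w Q tends pointwise to E - u^-1 E^*, a
    kernel at infinity, which every element of the domain annihilates.

    The obstacle is the real line itself: E may vanish there, so f/E and Theta are continuous up to
    the line only almost everywhere, and the convention x/0 = 0 gives them the value 0 at real zeros
    of E. These zeros are isolated, hence a null set, and boundary values are the actual values,
    reached as limits from the lines Im z = 1/(n + 1). No common integrable bound is at hand for
    such limits; it is replaced by a domination of Cauchy-Schwarz type in which one factor is fixed
    and the other is only bounded in L^1. *)

(** * Algebra of the modulus, of conjugation and of the embedding of the reals *)

Lemma absCE (z : C) : absC z = normc z.
Proof. by case: z. Qed.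

Lemma RtoCI : injective RtoC.
Proof. by move=> x y []. Qed.

Lemma RtoC0 : RtoC 0 = 0. Proof. by []. Qed.

Lemma RtoC1 : RtoC 1 = 1. Proof. by []. Qed.

Lemma RtoCD (x y : R) : RtoC (x + y) = RtoC x + RtoC y.
Proof. exact: (rmorphD (real_complex R)). Qed.

Lemma RtoCN (x : R) : RtoC (- x) = - RtoC x.
Proof. exact: (rmorphN (real_complex R)). Qed.

Lemma RtoCB (x y : R) : RtoC (x - y) = RtoC x - RtoC y.
Proof. exact: (rmorphB (real_complex R)). Qed.

Lemma RtoCM (x y : R) : RtoC (x * y) = RtoC x * RtoC y.
Proof. exact: (rmorphM (real_complex R)). Qed.

Lemma RtoCV (x : R) : RtoC x^-1 = (RtoC x)^-1.
Proof. exact: (fmorphV (real_complex R)). Qed.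

Lemma RtoC_nat n : RtoC n%:R = n%:R.
Proof. exact: (rmorph_nat (real_complex R)). Qed.

Lemma absC_ge0 (z : C) : 0 <= absC z.
Proof. exact: sqrtr_ge0. Qed.

Lemma absC0 : absC 0 = 0.
Proof. by rewrite absCE normc0. Qed.

Lemma absC1 : absC 1 = 1.
Proof. by rewrite absCE normc1. Qed.

Lemma absCM (x y : C) : absC (x * y) = absC x * absC y.
Proof. by rewrite !absCE normcM. Qed.

Lemma absCV (x : C) : absC x^-1 = (absC x)^-1.
Proof. by rewrite !absCE normcV. Qed.

Lemma absCN (x : C) : absC (- x) = absC x.
Proof. by rewrite !absCE normcN. Qed.

Lemma absC_eq0 (x : C) : (absC x == 0) = (x == 0).
Proof.
by apply/eqP/eqP=> [|->]; [rewrite absCE; exact: eq0_normc | exact: absC0].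
Qed.

Lemma absC_gt0 (x : C) : (0 < absC x) = (x != 0).
Proof. by rewrite lt_def absC_ge0 andbT absC_eq0. Qed.

Lemma absCD (x y : C) : absC (x + y) <= absC x + absC y.
Proof. by rewrite !absCE le_normcD. Qed.

Lemma absCC (x y : C) : absC (x - y) = absC (y - x).
Proof. by rewrite -absCN opprB. Qed.

Lemma absCB (x y : C) : absC (x - y) <= absC x + absC y.
Proof. by rewrite -(absCN y) absCD. Qed.

Lemma absC_tri (y x z : C) : absC (x - z) <= absC (x - y) + absC (y - z).
Proof. by apply: le_trans (absCD _ _); rewrite addrA subrK. Qed.

Lemma absC_rtri (x y : C) : absC x - absC y <= absC (x - y).
Proof. by rewrite lerBlDr; apply: le_trans (absCD _ _); rewrite subrK. Qed.

Lemma absCX (x : C) n : absC (x ^+ n) = absC x ^+ n.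
Proof. by elim: n => [|n IH]; rewrite ?expr0 ?absC1// !exprS absCM IH. Qed.

Lemma absC_R (x : R) : absC (RtoC x) = `|x|.
Proof. by rewrite /absC /= expr0n addr0 sqrtr_sqr. Qed.

Lemma absC_conj (z : C) : absC (cconj z) = absC z.
Proof. by rewrite /absC /= sqrrN. Qed.

Lemma absC_sqr (z : C) : absC z ^+ 2 = complex.Re z ^+ 2 + complex.Im z ^+ 2.
Proof. by rewrite sqr_sqrtr // addr_ge0 ?sqr_ge0. Qed.

Lemma Re_abs (z : C) : `|complex.Re z| <= absC z.
Proof. by rewrite -sqrtr_sqr ler_wsqrtr // lerDl sqr_ge0. Qed.

Lemma Im_abs (z : C) : `|complex.Im z| <= absC z.
Proof. by rewrite -sqrtr_sqr ler_wsqrtr // lerDr sqr_ge0. Qed.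

Lemma absC_le (z : C) : absC z <= `|complex.Re z| + `|complex.Im z|.
Proof.
have h0 : 0 <= `|complex.Re z| + `|complex.Im z| by rewrite addr_ge0.
rewrite -(@ler_pXn2r _ 2) ?nnegrE ?absC_ge0 // absC_sqr sqrrD !real_normK ?num_real //.
by rewrite lerD2r lerDl mulrn_wge0 // mulr_ge0.
Qed.

Lemma ReD (x y : C) : complex.Re (x + y) = complex.Re x + complex.Re y.
Proof. by case: x; case: y. Qed.
Lemma ImD (x y : C) : complex.Im (x + y) = complex.Im x + complex.Im y.
Proof. by case: x; case: y. Qed.
Lemma ReN (x : C) : complex.Re (- x) = - complex.Re x.
Proof. by case: x. Qed.
Lemma ImN (x : C) : complex.Im (- x) = - complex.Im x.
Proof. by case: x. Qed.
Lemma ReB (x y : C) : complex.Re (x - y) = complex.Re x - complex.Re y.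
Proof. by case: x; case: y. Qed.
Lemma ImB (x y : C) : complex.Im (x - y) = complex.Im x - complex.Im y.
Proof. by case: x; case: y. Qed.
Lemma ReM (x y : C) : complex.Re (x * y) =
  complex.Re x * complex.Re y - complex.Im x * complex.Im y.
Proof. by case: x; case: y. Qed.
Lemma ImM (x y : C) : complex.Im (x * y) =
  complex.Re x * complex.Im y + complex.Im x * complex.Re y.
Proof. by case: x; case: y. Qed.

Lemma eqC (x y : C) :
  complex.Re x = complex.Re y -> complex.Im x = complex.Im y -> x = y.
Proof. by case: x; case: y => /= ? ? ? ? -> ->. Qed.

Lemma complexE' (x : C) : x = Complex (complex.Re x) (complex.Im x).
Proof. by case: x. Qed.

Lemma ComplexE (a b : R) : Complex a b = RtoC a + iC * RtoC b.
Proof. by apply: eqC; rewrite ?ReD ?ImD ?ReM ?ImM /=; ring. Qed.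

Lemma iC_sqr : iC * iC = -1.
Proof. by apply: eqC; rewrite ?ReM ?ImM /=; ring. Qed.

Lemma absC_i : absC iC = 1.
Proof. by rewrite /absC /= expr0n add0r expr1n sqrtr1. Qed.

Lemma cconjE (z : C) : cconj z = (z^*)%C.
Proof. by case: z. Qed.
Lemma cconjD (x y : C) : cconj (x + y) = cconj x + cconj y.
Proof. by rewrite !cconjE rmorphD. Qed.
Lemma cconjB (x y : C) : cconj (x - y) = cconj x - cconj y.
Proof. by rewrite !cconjE rmorphB. Qed.
Lemma cconjN (x : C) : cconj (- x) = - cconj x.
Proof. by rewrite !cconjE rmorphN. Qed.
Lemma cconjM (x y : C) : cconj (x * y) = cconj x * cconj y.
Proof. by rewrite !cconjE rmorphM. Qed.
Lemma cconjV (x : C) : cconj x^-1 = (cconj x)^-1.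
Proof. by rewrite !cconjE fmorphV. Qed.
Lemma cconj_div (x y : C) : cconj (x / y) = cconj x / cconj y.
Proof. by rewrite cconjM cconjV. Qed.
Lemma cconjK (x : C) : cconj (cconj x) = x.
Proof. by rewrite !cconjE conjcK. Qed.
Lemma cconj_R (x : R) : cconj (RtoC x) = RtoC x.
Proof. by apply: eqC; rewrite /= ?oppr0. Qed.
Lemma cconj0 : cconj 0 = 0. Proof. by rewrite -RtoC0 cconj_R. Qed.
Lemma cconj_eq0 (x : C) : (cconj x == 0) = (x == 0).
Proof. by rewrite -absC_eq0 absC_conj absC_eq0. Qed.
Lemma mulC_conj (z : C) : z * cconj z = RtoC (absC z ^+ 2).
Proof. by rewrite absC_sqr; apply: eqC; rewrite ?ReM ?ImM /=; ring. Qed.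

(** * Continuity and complex differentiability *)

(* In epsilon-delta form, to match [holo_at]: [C] carries no topology here. *)
Definition ccont (f : C -> C) (z : C) := forall e : R, 0 < e ->
  exists2 d : R, 0 < d & forall x, absC (x - z) < d -> absC (f x - f z) < e.

Lemma ccont_local (f g : C -> C) z (r : R) : 0 < r ->
  (forall x, absC (x - z) < r -> f x = g x) -> ccont g z -> ccont f z.
Proof.
move=> r0 fg cg e e0; have [d d0 hd] := cg e e0.
exists (Num.min d r); first by rewrite lt_min d0.
move=> x; rewrite lt_min => /andP[xd xr].
by rewrite !fg ?hd // subrr absC0.
Qed.

Lemma ccont_cst (c : C) z : ccont (fun=> c) z.
Proof. by move=> e e0; exists 1 => // x _; rewrite subrr absC0. Qed.

Lemma ccont_id z : ccont id z.
Proof. by move=> e e0; exists e. Qed.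

Lemma ccontN f z : ccont f z -> ccont (fun x => - f x) z.
Proof.
move=> cf e e0; have [d d0 hd] := cf e e0; exists d => // x /hd.
by rewrite -opprD absCN.
Qed.

Lemma ccontD f g z : ccont f z -> ccont g z -> ccont (fun x => f x + g x) z.
Proof.
move=> cf cg e e0; have e2 : 0 < e / 2 by rewrite divr_gt0.
have [d d0 hd] := cf _ e2; have [d' d'0 hd'] := cg _ e2.
exists (Num.min d d'); first by rewrite lt_min d0.
move=> x; rewrite lt_min => /andP[/hd h1 /hd' h2].
rewrite (_ : _ - _ = (f x - f z) + (g x - g z)); last by ring.
by rewrite (le_lt_trans (absCD _ _)) // [e]splitr ltrD.
Qed.

Lemma ccontB f g z : ccont f z -> ccont g z -> ccont (fun x => f x - g x) z.
Proof. by move=> cf cg; apply: ccontD => //; apply: ccontN. Qed.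

Lemma ccontM f g z : ccont f z -> ccont g z -> ccont (fun x => f x * g x) z.
Proof.
move=> cf cg e e0.
(* With both increments below m <= 1, the three terms of the expansion below add up to at most m * k
   <= e / 3. *)
pose k := absC (f z) + absC (g z) + 1.
have k1 : 1 <= k by rewrite lerDr addr_ge0 ?absC_ge0.
have k0 : 0 < k by apply: lt_le_trans k1.
pose m := Num.min 1 (e / (3 * k)).
have m0 : 0 < m by rewrite lt_min ltr01 divr_gt0 // mulr_gt0.
have [d d0 hd] := cf _ m0; have [d' d'0 hd'] := cg _ m0.
exists (Num.min d d'); first by rewrite lt_min d0.
move=> x; rewrite lt_min => /andP[/hd h1 /hd' h2].
rewrite (_ : _ - _ = (f x - f z) * (g x - g z) + (f x - f z) * g z + f z * (g x - g z)); last by ring.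
have m1 : m <= 1 by rewrite ge_min lexx.
have mk : m * k <= e / 3.
  rewrite -ler_pdivlMr // (_ : e / 3 / k = e / (3 * k)); last by field; rewrite gt_eqF.
  by rewrite ge_min lexx orbT.
have A := absCD ((f x - f z) * (g x - g z) + (f x - f z) * g z) (f z * (g x - g z)).
have B := absCD ((f x - f z) * (g x - g z)) ((f x - f z) * g z).
rewrite !absCM in A B.
have a0 := absC_ge0 (f x - f z); have b0 := absC_ge0 (g x - g z).
have u0 := absC_ge0 (f z); have v0 := absC_ge0 (g z).
have : absC (f x - f z) * absC (g x - g z) <= m * 1 by apply: ler_pM => //; lra.
have : absC (f x - f z) * absC (g z) <= m * absC (g z) by rewrite ler_wpM2r // ltW.
have : absC (f z) * absC (g x - g z) <= absC (f z) * m by rewrite ler_wpM2l // ltW.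
have : m * k = m * absC (f z) + m * absC (g z) + m by rewrite /k; ring.
lra.
Qed.

Lemma ccontX f n z : ccont f z -> ccont (fun x => f x ^+ n) z.
Proof.
move=> cf; elim: n => [|n IH]; first exact: ccont_cst.
apply: (@ccont_local _ (fun x => f x * f x ^+ n) z 1) => //; last exact: ccontM.
by move=> x _; rewrite exprS.
Qed.

Lemma ccont_neq0 f z : ccont f z -> f z != 0 ->
  exists2 d : R, 0 < d & forall x, absC (x - z) < d -> absC (f z) / 2 < absC (f x).
Proof.
move=> cf f0; have e0 : 0 < absC (f z) / 2 by rewrite divr_gt0 // absC_gt0.
have [d d0 hd] := cf _ e0; exists d => // x /hd.
by rewrite absCC; have := absC_rtri (f z) (f x); lra.
Qed.

Lemma ccontV f z : ccont f z -> f z != 0 -> ccont (fun x => (f x)^-1) z.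
Proof.
move=> cf f0 e e0; have [d1 d10 h1] := ccont_neq0 cf f0.
have fz : 0 < absC (f z) by rewrite absC_gt0.
(* Near z the modulus of f exceeds |f z| / 2, so the denominator |f x * f z| exceeds |f z|^2 / 2. *)
have e'0 : 0 < e * (absC (f z) ^+ 2 / 2) by rewrite mulr_gt0 ?divr_gt0 // exprn_gt0.
have [d2 d20 h2] := cf _ e'0.
exists (Num.min d1 d2); first by rewrite lt_min d10.
move=> x; rewrite lt_min => /andP[/h1 A /h2 B].
have fx0 : f x != 0 by rewrite -absC_gt0; apply: lt_trans A; rewrite divr_gt0.
rewrite (_ : _ - _ = - (f x - f z) / (f x * f z)); last by field; rewrite fx0 f0.
rewrite absCM absCN absCV ltr_pdivrMr ?absC_gt0 ?mulf_neq0 //.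
apply: lt_trans B _; rewrite ltr_pM2l // absCM expr2.
by rewrite mulrAC ltr_pM2r.
Qed.

Lemma ccont_div f g z : ccont f z -> ccont g z -> g z != 0 ->
  ccont (fun x => f x / g x) z.
Proof. by move=> cf cg g0; apply: ccontM => //; apply: ccontV. Qed.

Lemma ccont_comp f g z : ccont g z -> ccont f (g z) -> ccont (fun x => f (g x)) z.
Proof.
move=> cg cf e e0; have [d d0 hd] := cf _ e0; have [d' d'0 hd'] := cg _ d0.
by exists d' => // x /hd' /hd.
Qed.

Lemma ccont_conj z : ccont cconj z.
Proof. by move=> e e0; exists e => // x; rewrite -cconjB absC_conj. Qed.

(** Caratheodory's form of the derivative: the slope is a function continuous at z. Product, inverse
    and chain rules become algebraic identities between slopes, and no case distinction at z is
    needed. *)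
Definition cder (f : C -> C) (z l : C) := exists phi, [/\ ccont phi z, phi z = l &
  exists2 r : R, 0 < r & forall x, absC (x - z) < r -> f x - f z = phi x * (x - z)].

Lemma cderP f z l : cder f z l <-> (forall e : R, 0 < e -> exists d : R, 0 < d /\
    forall h : C, h != 0 -> absC h < d -> absC ((f (z + h) - f z) / h - l) < e).
Proof.
split.
  move=> [phi [cphi <- [r r0 hr]]] e e0; have [d d0 hd] := cphi e e0.
  exists (Num.min d r); split; first by rewrite lt_min d0.
  move=> h h0; rewrite lt_min => /andP[h1 h2].
  have zh : z + h - z = h by ring.
  by rewrite hr zh // mulfK // hd // zh.
move=> H; exists (fun x => if x == z then l else (f x - f z) / (x - z)); split.
- move=> e e0; have [d [d0 hd]] := H e e0; exists d => // x xd.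
  rewrite eqxx; case: eqP => [_|/eqP xz]; first by rewrite subrr absC0.
  have := hd (x - z); rewrite subr_eq0 xz [z + (x - z)](_ : _ = x); last by ring.
  exact.
- by rewrite eqxx.
- exists 1 => // x _; case: eqP => [->|/eqP xz]; first by rewrite !subrr mulr0.
  by rewrite divfK // subr_eq0.
Qed.

Lemma holo_atP f z : holo_at f z <-> exists l, cder f z l.
Proof. by split=> -[l /cderP h]; exists l. Qed.

Lemma cder_holo f z l : cder f z l -> holo_at f z.
Proof. by move=> h; apply/holo_atP; exists l. Qed.

Lemma cder_cont f z l : cder f z l -> ccont f z.
Proof.
move=> [phi [cphi _ [r r0 hr]]].
apply: (@ccont_local _ (fun x => f z + phi x * (x - z)) z r) => //.
  by move=> x /hr <-; rewrite addrCA subrr addr0.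
apply: ccontD; first exact: ccont_cst.
by apply: ccontM => //; apply: ccontB; [exact: ccont_id | exact: ccont_cst].
Qed.

Lemma holo_cont f z : holo_at f z -> ccont f z.
Proof. by move=> /holo_atP[l /cder_cont]. Qed.

Lemma cder_local f g z l (r : R) : 0 < r ->
  (forall x, absC (x - z) < r -> f x = g x) -> cder g z l -> cder f z l.
Proof.
move=> r0 fg [phi [cphi pl [r' r'0 hr']]]; exists phi; split => //.
exists (Num.min r r'); first by rewrite lt_min r0.
by move=> x; rewrite lt_min => /andP[xr xr']; rewrite !fg ?hr' // subrr absC0.
Qed.

Lemma holo_local f g z (r : R) : 0 < r ->
  (forall x, absC (x - z) < r -> f x = g x) -> holo_at g z -> holo_at f z.
Proof.
move=> r0 fg /holo_atP[l h]; apply/holo_atP; exists l; exact: (cder_local r0 fg).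
Qed.

Lemma cder_eq f z l m : cder f z l -> l = m -> cder f z m.
Proof. by move=> h <-. Qed.

Lemma cder_cst (c : C) z : cder (fun=> c) z 0.
Proof.
exists (fun=> 0); split => //; first exact: ccont_cst.
by exists 1 => // x _; rewrite subrr mul0r.
Qed.

Lemma cder_id z : cder id z 1.
Proof.
exists (fun=> 1); split => //; first exact: ccont_cst.
by exists 1 => // x _; rewrite mul1r.
Qed.

Lemma cderD f g z l m : cder f z l -> cder g z m -> cder (fun x => f x + g x) z (l + m).
Proof.
move=> [p [cp <- [r r0 hr]]] [q [cq <- [s s0 hs]]].
exists (fun x => p x + q x); split => //; first exact: ccontD.
exists (Num.min r s); first by rewrite lt_min r0.
move=> x; rewrite lt_min => /andP[/hr A /hs B].
by rewrite mulrDl -A -B; ring.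
Qed.

Lemma cderN f z l : cder f z l -> cder (fun x => - f x) z (- l).
Proof.
move=> [p [cp <- [r r0 hr]]]; exists (fun x => - p x); split => //; first exact: ccontN.
by exists r => // x /hr A; rewrite mulNr -A; ring.
Qed.

Lemma cderB f g z l m : cder f z l -> cder g z m -> cder (fun x => f x - g x) z (l - m).
Proof. by move=> hf hg; apply: cderD => //; apply: cderN. Qed.

Lemma cderM f g z l m : cder f z l -> cder g z m ->
  cder (fun x => f x * g x) z (l * g z + f z * m).
Proof.
move=> hf hg; have cg := cder_cont hg.
move: hf hg => [p [cp <- [r r0 hr]]] [q [cq <- [s s0 hs]]].
exists (fun x => p x * g x + f z * q x); split => //.
  by apply: ccontD; apply: ccontM => //; exact: ccont_cst.
exists (Num.min r s); first by rewrite lt_min r0.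
move=> x; rewrite lt_min => /andP[/hr A /hs B].
rewrite (_ : _ * (x - z) = p x * (x - z) * g x + f z * (q x * (x - z))); last by ring.
by rewrite -A -B; ring.
Qed.

Lemma cderV f z l : cder f z l -> f z != 0 -> cder (fun x => (f x)^-1) z (- l / (f z) ^+ 2).
Proof.
move=> hf f0; have cf := cder_cont hf; have [d d0 hd] := ccont_neq0 cf f0.
move: hf => [p [cp <- [r r0 hr]]].
exists (fun x => - p x / (f x * f z)); split => //.
  apply: ccont_div; [exact: ccontN | | exact: mulf_neq0].
  by apply: ccontM => //; exact: ccont_cst.
exists (Num.min r d); first by rewrite lt_min r0.
move=> x; rewrite lt_min => /andP[/hr A /hd B].
have fx0 : f x != 0 by rewrite -absC_gt0; apply: le_lt_trans B; rewrite divr_ge0 ?absC_ge0.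
rewrite (_ : _ * (x - z) = - (p x * (x - z)) / (f x * f z)); last by field; rewrite fx0 f0.
by rewrite -A; field; rewrite fx0 f0.
Qed.

Lemma cderX f n z l : cder f z l ->
  cder (fun x => f x ^+ n) z (n%:R * f z ^+ n.-1 * l).
Proof.
move=> hf; elim: n => [|n IH].
  by rewrite !mul0r; apply: (cder_local (g := fun=> 1) ltr01) => //; exact: cder_cst.
have := cderM hf IH.
rewrite (_ : _ + _ = n.+1%:R * f z ^+ n.+1.-1 * l); last first.
  case: n {IH} => [|n] /=; first by rewrite expr0; ring.
  by rewrite -(natr1 n.+1) exprS; ring.
by apply: (cder_local ltr01) => x _; rewrite exprS.
Qed.

Lemma cder_comp f g z l m : cder g z m -> cder f (g z) l ->
  cder (fun x => f (g x)) z (l * m).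
Proof.
move=> hg hf; have cg := cder_cont hg.
move: hf hg => [p [cp <- [r r0 hr]]] [q [cq <- [s s0 hs]]].
exists (fun x => p (g x) * q x); split => //.
  by apply: ccontM => //; exact: (ccont_comp cg cp).
have [d d0 hd] := cg _ r0.
exists (Num.min s d); first by rewrite lt_min s0.
move=> x; rewrite lt_min => /andP[/hs A /hd /hr ->].
by rewrite A mulrA.
Qed.

Lemma cder_fstar f z l : cder f (cconj z) l -> cder (fstar f) z (cconj l).
Proof.
move=> [p [cp <- [r r0 hr]]]; exists (fun x => cconj (p (cconj x))); split => //.
  apply: (ccont_comp (g := fun x => p (cconj x)) _ (@ccont_conj _)).
  by apply: ccont_comp cp; exact: ccont_conj.
exists r => // x xr; rewrite /fstar -cconjB hr; first by rewrite cconjM cconjB !cconjK.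
by rewrite -cconjB absC_conj.
Qed.

Lemma holo_cst (c : C) z : holo_at (fun=> c) z.
Proof. exact: cder_holo (@cder_cst c z). Qed.
Lemma holo_id z : holo_at id z.
Proof. exact: cder_holo (@cder_id z). Qed.
Lemma holoD f g z : holo_at f z -> holo_at g z -> holo_at (fun x => f x + g x) z.
Proof. by move=> /holo_atP[l h] /holo_atP[m k]; exact: cder_holo (cderD h k). Qed.
Lemma holoB f g z : holo_at f z -> holo_at g z -> holo_at (fun x => f x - g x) z.
Proof. by move=> /holo_atP[l h] /holo_atP[m k]; exact: cder_holo (cderB h k). Qed.
Lemma holoM f g z : holo_at f z -> holo_at g z -> holo_at (fun x => f x * g x) z.
Proof. by move=> /holo_atP[l h] /holo_atP[m k]; exact: cder_holo (cderM h k). Qed.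
Lemma holo_div f g z : holo_at f z -> holo_at g z -> g z != 0 ->
  holo_at (fun x => f x / g x) z.
Proof.
move=> /holo_atP[l h] /holo_atP[m k] g0; exact: cder_holo (cderM h (cderV k g0)).
Qed.
Lemma holo_fstar f z : holo_at f (cconj z) -> holo_at (fstar f) z.
Proof. by move=> /holo_atP[l h]; exact: cder_holo (cder_fstar h). Qed.
Lemma holo_comp f g z : holo_at g z -> holo_at f (g z) -> holo_at (fun x => f (g x)) z.
Proof. by move=> /holo_atP[l h] /holo_atP[m k]; exact: cder_holo (cder_comp h k). Qed.

Lemma fstarK f : fstar (fstar f) = f.
Proof. by apply/funext => z; rewrite /fstar !cconjK. Qed.

Lemma entire_fstar f : entire f -> entire (fstar f).
Proof. by move=> ef z; apply: holo_fstar. Qed.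

(** * Path integrals *)

(* Over an abstract [realType], because the concrete type [R] is not canonically a
   normed module and the theorems on limits and derivatives do not apply to it. *)
Definition rcont (T : realType) (f : T -> T) (t : T) := forall e : T, 0 < e ->
  exists2 d : T, 0 < d & forall s, `|s - t| < d -> `|f s - f t| < e.

Definition rder (T : realType) (f : T -> T) (t l : T) := forall e : T, 0 < e ->
  exists2 d : T, 0 < d &
    forall s, `|s - t| < d -> `|f s - f t - l * (s - t)| <= e * `|s - t|.

Lemma rcontP (T : realType) (f : T -> T) (t : T) : {for t, continuous f} <-> rcont f t.
Proof.
split.
  move=> cf e e0; have /cvgrPdist_lt/(_ e e0)/nbhs_ballP[d /= d0 hd] : f x @[x --> t] --> f t by exact: cf.
  exists d => // s; rewrite distrC => /hd /=; by rewrite distrC.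
move=> H; apply: (proj2 (@cvgrPdist_lt _ _ _ _ _ _ _)) => e e0; have [d d0 hd] := H e e0.
apply/nbhs_ballP; exists d => //= s; rewrite /ball /= distrC => /hd.
by rewrite distrC.
Qed.

Lemma rderP (T : realType) (f : T -> T) (t l : T) : is_derive t 1 f l <-> rder f t l.
Proof.
split.
  move=> [df dv] e e0.
  have /cvgrPdist_lt /(_ e e0) : (fun h : T => h^-1 *: ((f \o shift t) (h *: (1:T)) - f t)) @ 0^' --> l.
    by rewrite -dv; exact: df.
  rewrite near_withinE => /nbhs_ballP[d /= d0 hd]; exists d => // s sd.
  have [->|st] := eqVneq s t; first by rewrite !subrr mulr0 subr0 normr0 mulr0.
  have st0 : s - t != 0 by rewrite subr_eq0.
  have := hd (s - t); rewrite /ball /= sub0r normrN => /(_ sd st0).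
  rewrite /= /GRing.scale /= mulr1 subrK distrC => /ltW h.
  rewrite (_ : _ - _ = ((s - t)^-1 * (f s - f t) - l) * (s - t)); last by field.
  by rewrite normrM ler_wpM2r.
move=> H.
have cv : (fun h : T => h^-1 *: ((f \o shift t) (h *: (1:T)) - f t)) @ 0^' --> l.
  apply/cvgrPdist_le => e e0; rewrite near_withinE; have [d d0 hd] := H e e0.
  apply/nbhs_ballP; exists d => //= h; rewrite /ball /= sub0r normrN => hh h0.
  have := hd (h + t); rewrite addrK => /(_ hh) A.
  rewrite /GRing.scale /= mulr1 distrC.
  rewrite (_ : _ - l = (f (h + t) - f t - l * h) / h); last by field.
  by rewrite normrM normfV ler_pdivrMr // normr_gt0.
split; first by apply/cvg_ex; exists l; exact: cv.
by apply: cvg_lim => //.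
Qed.

Lemma rder_cont (T : realType) (f : T -> T) (t l : T) : rder f t l -> rcont f t.
Proof.
move=> /rderP[df _]; apply/rcontP; apply: differentiable_continuous.
exact/derivable1_diffP.
Qed.

Lemma rderB (T : realType) (f g : T -> T) (t l m : T) : rder f t l -> rder g t m ->
  rder (fun s => f s - g s) t (l - m).
Proof. by move=> /rderP df /rderP dg; apply/rderP; exact: is_deriveB. Qed.

(** The endpoints may come in either order, because the path integrals below are signed. *)
Definition between (T : realType) (a b t : T) := Num.min a b <= t <= Num.max a b.

Lemma betweenC (T : realType) (a b t : T) : between a b t = between b a t.
Proof. by rewrite /between minC maxC. Qed.

Lemma between_le (T : realType) (a b t : T) : a <= b -> between a b t = (a <= t <= b).
Proof. by move=> ab; rewrite /between; rewrite min_l // max_r. Qed.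

Lemma between_l (T : realType) (a b : T) : between a b a.
Proof. by rewrite /between ge_min lexx le_max lexx. Qed.

Lemma between_r (T : realType) (a b : T) : between a b b.
Proof. by rewrite betweenC between_l. Qed.

Lemma between_dist (T : realType) (a b t : T) : between a b t -> `|t - a| <= `|b - a|.
Proof.
have [ab|/ltW ab] := leP a b.
  rewrite between_le // => /andP[h1 h2]; rewrite !ger0_norm; lra.
rewrite betweenC between_le // => /andP[h1 h2]; rewrite !ler0_norm; lra.
Qed.

Lemma between_sub (T : realType) (a b u v t : T) : between a b u -> between a b v -> between u v t ->
  between a b t.
Proof.
rewrite /between => /andP[u1 u2] /andP[v1 v2] /andP[t1 t2].
apply/andP; split.
  by apply: le_trans t1; rewrite le_min u1 v1.
by apply: (le_trans t2); rewrite ge_max u2 v2.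
Qed.

Lemma MVT_bound (T : realType) (F f : T -> T) (a b M : T) :
  (forall t, between a b t -> rder F t (f t)) ->
  (forall t, between a b t -> `|f t| <= M) -> `|F b - F a| <= M * `|b - a|.
Proof.
wlog ab : a b / a < b => [H dF fM|].
  have [ab|ba|->] := ltgtP a b; first exact: H.
    rewrite distrC (distrC b); apply: H => // t tt.
      by apply: dF; rewrite betweenC.
    by apply: fM; rewrite betweenC.
  by rewrite !subrr normr0 mulr0.
move=> dF fM.
have bt t : t \in `[a, b]%R -> between a b t.
  by rewrite in_itv /= => tab; rewrite between_le // ltW.
have := @MVT T F f a b ab; case.
- by move=> t tab; apply/rderP; apply: dF; apply: bt; apply: subset_itv_oo_cc.
- apply: continuous_in_subspaceT => t; rewrite inE => tab; apply/rcontP.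
  by apply: (@rder_cont _ _ _ (f t)); apply: dF; apply: bt.
- move=> c cab ->; rewrite normrM ler_wpM2r // fM //; apply: bt; exact: subset_itv_oo_cc.
Qed.

(** The integral from c is differentiable only to the right of c, so a primitive on the whole line
    takes a base point that moves left with x. Subtracting the value at 0 makes the result
    independent of the base point. *)
Lemma ex_antiderivative (T : realType) (f : T -> T) : (forall t, rcont f t) ->
  exists F : T -> T, forall t, rder F t (f t).
Proof.
move=> cf0; have cf : continuous f by move=> t; apply/rcontP.
pose mu := @lebesgue_measure T.
have intf (a b : T) : mu.-integrable `[a, b] (EFin \o f).
  apply: continuous_compact_integrable; first exact: segment_compact.
  exact: continuous_subspaceT.
pose G (c x : T) := \int[mu]_(t in `[c, x]) f t.
have dG (c x : T) : c < x -> is_derive x 1 (G c) (f x).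
  move=> cx; have x1 : x < x + 1 by rewrite ltrDl.
  have [d1 d2] := continuous_FTC1_closed x1 (intf c (x + 1)) cx (cf x).
  by split; [exact: d1 | rewrite -derive1E; exact: d2].
have GB c m x : m <= c -> c <= x -> G m x - G m c = G c x.
  move=> mc cx; rewrite /G Rintegral_itvB ?bnd_simp //.
  by apply: Rintegral_itv_obnd_cbnd; apply: integrableS (intf c x) => //; apply: subset_itvr; rewrite bnd_simp.
pose F (x : T) := G (- (`|x| + 1)) x - G (- (`|x| + 1)) 0.
have FE c x : c <= - (`|x| + 1) -> F x = G c x - G c 0.
  move=> cx; set m := - (`|x| + 1) in cx *.
  have mx : m <= x by rewrite /m; have := ler_norm (- x); rewrite normrN; lra.
  have m0 : m <= 0 by rewrite /m; have := normr_ge0 x; lra.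
  rewrite /F -/m -(GB m c x) // -(GB m c 0) //; lra.
(* The base point c serves all x with |x - t| < 1 at once, so near t the function F is a fixed
   integral minus a constant. *)
exists F => t; apply/rderP; pose c := - (`|t| + 2).
have ct : c < t by rewrite /c; have := ler_norm (- t); rewrite normrN; lra.
apply: (@near_eq_is_derive _ _ _ (fun x => G c x - G c 0)).
  apply/nbhs_ballP; exists 1 => //= x; rewrite /ball /= => tx.
  symmetry; apply: FE; rewrite /c.
  have : `|x| <= `|t| + `|t - x| by rewrite -{1}(subKr t x) ler_normB.
  lra.
have := @is_deriveB _ _ _ (G c) (cst (G c 0)) t 1 (f t) 0 (dG _ _ ct) (is_derive_cst _ _ _).
by rewrite subr0.
Qed.

(** A primitive picked by choice, with default 0 for functions that have none. Only differences of
    its values are used, so the choice of the constant does not matter. *)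
Definition prim (f : R -> R) : R -> R :=
  xget (fun=> 0) [set F | forall t : R, rder F t (f t)].

Lemma primP (f : R -> R) (t : R) : (forall s, rcont f s) -> rder (prim f) t (f t).
Proof.
by move=> /ex_antiderivative[F HF]; rewrite /prim; case: xgetP => [G _ HG|/(_ F)].
Qed.

Definition rccont (g : R -> C) (t : R) := forall e : R, 0 < e ->
  exists2 d : R, 0 < d & forall s, `|s - t| < d -> absC (g s - g t) < e.

Lemma rccont_Re g t : rccont g t -> rcont (fun s => complex.Re (g s)) t.
Proof.
move=> cg; move=> e e0; have [d d0 hd] := cg e e0; exists d => // s /hd.
by apply: le_lt_trans; rewrite -ReB Re_abs.
Qed.

Lemma rccont_Im g t : rccont g t -> rcont (fun s => complex.Im (g s)) t.
Proof.
move=> cg; move=> e e0; have [d d0 hd] := cg e e0; exists d => // s /hd.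
by apply: le_lt_trans; rewrite -ImB Im_abs.
Qed.

Lemma rccont_abs g t : rccont g t -> rcont (fun s => absC (g s)) t.
Proof.
move=> cg; move=> e e0; have [d d0 hd] := cg e e0; exists d => // s /hd.
apply: le_lt_trans; have h1 := absC_rtri (g s) (g t); have h2 := absC_rtri (g t) (g s).
rewrite absCC in h2; rewrite ler_norml; lra.
Qed.

Lemma rccont_RtoC (f : R -> R) t : rcont f t -> rccont (fun s => RtoC (f s)) t.
Proof.
move=> cf e e0; have [d d0 hd] := cf e e0; exists d => // s /hd.
by rewrite -RtoCB absC_R.
Qed.

Lemma rccont_comp (F : C -> C) g t : rccont g t -> ccont F (g t) ->
  rccont (fun s => F (g s)) t.
Proof.
move=> cg cf e e0; have [d d0 hd] := cf _ e0; have [d' d'0 hd'] := cg _ d0.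
by exists d' => // x /hd' /hd.
Qed.

Lemma rccont_ccont (g : R -> C) t : rccont g t ->
  ccont (fun z => g (complex.Re z)) (RtoC t).
Proof.
move=> cg e e0; have [d d0 hd] := cg _ e0; exists d => // x xd; apply: hd.
by apply: le_lt_trans xd; apply: le_trans (Re_abs _); rewrite ReB.
Qed.

Lemma ccont_rccont (F : C -> C) t : ccont F (RtoC t) -> rccont (fun s => F (RtoC s)) t.
Proof.
move=> cF e e0; have [d d0 hd] := cF _ e0; exists d => // s sd; apply: hd.
by rewrite -RtoCB absC_R.
Qed.

Lemma rccontD f g t : rccont f t -> rccont g t -> rccont (fun x => f x + g x) t.
Proof.
move=> /rccont_ccont cf /rccont_ccont cg; exact: (ccont_rccont (ccontD cf cg)).
Qed.
Lemma rccontB f g t : rccont f t -> rccont g t -> rccont (fun x => f x - g x) t.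
Proof.
move=> /rccont_ccont cf /rccont_ccont cg; exact: (ccont_rccont (ccontB cf cg)).
Qed.
Lemma rccontM f g t : rccont f t -> rccont g t -> rccont (fun x => f x * g x) t.
Proof.
move=> /rccont_ccont cf /rccont_ccont cg; exact: (ccont_rccont (ccontM cf cg)).
Qed.
Lemma rccont_div f g t : rccont f t -> rccont g t -> g t != 0 -> rccont (fun x => f x / g x) t.
Proof.
move=> /rccont_ccont cf /rccont_ccont cg g0; exact: (ccont_rccont (ccont_div cf cg g0)).
Qed.
Lemma rccont_cst c t : rccont (fun=> c) t.
Proof. by move=> e e0; exists 1 => // x _; rewrite subrr absC0. Qed.

Lemma rccont_hor (y t : R) : rccont (fun s => Complex s y) t.
Proof.
move=> e e0; exists e => // s; apply: le_lt_trans.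
rewrite (_ : _ - _ = RtoC (s - t)) ?absC_R //; apply: eqC; rewrite ?ReB ?ImB /=; ring.
Qed.

Lemma rccont_ver (x t : R) : rccont (fun s => Complex x s) t.
Proof.
move=> e e0; exists e => // s; apply: le_lt_trans.
rewrite (_ : _ - _ = iC * RtoC (s - t)); last by apply: eqC; rewrite ?ReB ?ImB ?ReM ?ImM /=; ring.
by rewrite absCM absC_i mul1r absC_R.
Qed.

(** Caratheodory's form again, now for curves, so that [cder] and [lder] compose by multiplying
    slopes. *)
Definition lder (g : R -> C) (t : R) (l : C) := exists phi, [/\ rccont phi t, phi t = l &
  exists2 r : R, 0 < r & forall s, `|s - t| < r -> g s - g t = phi s * RtoC (s - t)].

Lemma lder_comp (F : C -> C) g t l m : lder g t m -> cder F (g t) l ->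
  lder (fun s => F (g s)) t (l * m).
Proof.
move=> [q [cq <- [s s0 hs]]] [p [cp <- [r r0 hr]]].
have cg : rccont g t.
  move=> e e0.
  have : rccont (fun x => g t + q x * RtoC (x - t)) t.
    apply: rccontD; first exact: rccont_cst.
    apply: rccontM => //; apply: (rccont_RtoC (f := fun x => x - t)) => e' e'0.
    by exists e' => // u; rewrite subrr subr0.
  move=> /(_ e e0)[d d0 hd]; exists (Num.min s d); first by rewrite lt_min s0.
  move=> x; rewrite lt_min => /andP[/hs A /hd].
  by rewrite -A subrr mulr0 addr0 addrCA subrr addr0.
exists (fun x => p (g x) * q x); split => //.
  by apply: rccontM => //; exact: (rccont_comp cg cp).
have [d d0 hd] := cg _ r0.
exists (Num.min s d); first by rewrite lt_min s0.
move=> x; rewrite lt_min => /andP[/hs A /hd /hr ->].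
by rewrite A mulrA.
Qed.

Lemma lder_RtoC (f : R -> R) (t l : R) : rder f t l ->
  lder (fun s => RtoC (f s)) t (RtoC l).
Proof.
move=> H.
exists (fun s => if s == t then RtoC l else RtoC ((f s - f t) / (s - t))); split.
- move=> e e0; have e2 : 0 < e / 2 by rewrite divr_gt0.
  have [d d0 hd] := H _ e2; exists d => // s /hd h.
  rewrite eqxx; case: eqP => [_|/eqP st]; first by rewrite subrr absC0.
  rewrite -RtoCB absC_R.
  have st0 : s - t != 0 by rewrite subr_eq0.
  rewrite (_ : _ - l = (f s - f t - l * (s - t)) / (s - t)); last by field.
  rewrite normrM normfV ltr_pdivrMr ?normr_gt0 //; apply: le_lt_trans h _.
  by rewrite ltr_pM2r ?normr_gt0 // ltr_pdivrMr // ltr_pMr // ltr1n.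
- by rewrite eqxx.
- exists 1 => // s _; case: eqP => [->|/eqP st]; first by rewrite !subrr mulr0.
  by rewrite -RtoCB -RtoCM divfK // subr_eq0.
Qed.

Lemma lder_hor (y t : R) : lder (fun s => Complex s y) t 1.
Proof.
exists (fun=> 1); split => //; first exact: rccont_cst.
exists 1 => // s _; rewrite mul1r; apply: eqC; rewrite ?ReB ?ImB /=; ring.
Qed.

Lemma lder_ver (x t : R) : lder (fun s => Complex x s) t iC.
Proof.
exists (fun=> iC); split => //; first exact: rccont_cst.
exists 1 => // s _; apply: eqC; rewrite ?ReB ?ImB ?ReM ?ImM /=; ring.
Qed.

Lemma lderD f g t l m : lder f t l -> lder g t m -> lder (fun x => f x + g x) t (l + m).
Proof.
move=> [p [cp <- [r r0 hr]]] [q [cq <- [s s0 hs]]].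
exists (fun x => p x + q x); split => //; first exact: rccontD.
exists (Num.min r s); first by rewrite lt_min r0.
move=> x; rewrite lt_min => /andP[/hr A /hs B].
by rewrite mulrDl -A -B; ring.
Qed.

Lemma lderZ (c : C) f t l : lder f t l -> lder (fun x => c * f x) t (c * l).
Proof.
move=> hf; apply: (lder_comp (F := fun z => c * z) hf).
by have := cderM (@cder_cst c (f t)) (@cder_id (f t)); rewrite mul0r add0r mulr1.
Qed.

Lemma lder_Re g t l : lder g t l -> rder (fun s => complex.Re (g s)) t (complex.Re l).
Proof.
move=> [p [cp <- [r r0 hr]]] e e0.
have [d d0 hd] := cp _ e0; exists (Num.min r d); first by rewrite lt_min r0.
move=> s; rewrite lt_min => /andP[/hr A /hd /ltW B].
rewrite (_ : _ - _ = complex.Re ((p s - p t) * RtoC (s - t))).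
  by apply: le_trans (Re_abs _) _; rewrite absCM absC_R ler_wpM2r.
by rewrite mulrBl -A !ReB ReM /=; ring.
Qed.

Lemma lder_Im g t l : lder g t l -> rder (fun s => complex.Im (g s)) t (complex.Im l).
Proof.
move=> [p [cp <- [r r0 hr]]] e e0.
have [d d0 hd] := cp _ e0; exists (Num.min r d); first by rewrite lt_min r0.
move=> s; rewrite lt_min => /andP[/hr A /hd /ltW B].
rewrite (_ : _ - _ = complex.Im ((p s - p t) * RtoC (s - t))).
  by apply: le_trans (Im_abs _) _; rewrite absCM absC_R ler_wpM2r.
by rewrite mulrBl -A !ImB ImM /=; ring.
Qed.

(* A difference of values of a primitive instead of a Lebesgue integral: this gives
   additivity in the endpoints without integrability conditions. *)
Definition path_int (g : R -> C) (a b : R) : C :=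
  let u f := prim f b - prim f a in
  Complex (u (fun s => complex.Re (g s))) (u (fun s => complex.Im (g s))).

(** [prim] needs [g] continuous everywhere, but [G] has to be a primitive only on the segment. There
    the two primitives differ by a function of derivative 0, and [MVT_bound] with constant 0 shows
    that it does not vary. *)
Lemma path_int_FTC (G g : R -> C) a b : (forall t, rccont g t) ->
  (forall t, between a b t -> lder G t (g t)) -> path_int g a b = G b - G a.
Proof.
move=> cg dG.
have key (u v : R -> R) : (forall s, rcont u s) ->
    (forall t, between a b t -> rder v t (u t)) ->
    prim u b - prim u a = v b - v a.
  move=> cu dv; apply/eqP; rewrite -subr_eq0 -normr_le0.
  have := @MVT_bound _ (fun t => prim u t - v t) (fun=> 0) a b 0.
  rewrite mul0r (_ : _ - _ - (_ - _) = prim u b - prim u a - (v b - v a)); last by ring.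
  apply => [t tab|t _]; last by rewrite normr0.
  by have := rderB (primP t cu) (dv t tab); rewrite subrr.
apply: eqC => /=; rewrite ?ReB ?ImB.
  apply: (key (fun s => complex.Re (g s)) (fun s => complex.Re (G s))) => [t|t /dG].
    exact: rccont_Re.
  exact: lder_Re.
apply: (key (fun s => complex.Im (g s)) (fun s => complex.Im (G s))) => [t|t /dG].
  exact: rccont_Im.
exact: lder_Im.
Qed.

Lemma path_int_prim (g : R -> C) : (forall t, rccont g t) ->
  exists G, (forall t, lder G t (g t)) /\ forall a b, path_int g a b = G b - G a.
Proof.
move=> cg.
pose G t := RtoC (prim (fun s => complex.Re (g s)) t)
          + iC * RtoC (prim (fun s => complex.Im (g s)) t).
have dG t : lder G t (g t).
  rewrite [g t]complexE' ComplexE; apply: lderD.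
    by apply: lder_RtoC; apply: primP => s; exact: rccont_Re.
  by apply: lderZ; apply: lder_RtoC; apply: primP => s; exact: rccont_Im.
by exists G; split => // a b; apply: path_int_FTC.
Qed.

Lemma path_int_chasles g a b c : path_int g a c = path_int g a b + path_int g b c.
Proof. by apply: eqC; rewrite ?ReD ?ImD /=; ring. Qed.

Lemma path_int_rev g a b : path_int g a b = - path_int g b a.
Proof. by apply: eqC; rewrite ?ReN ?ImN /=; ring. Qed.

Lemma path_int_refl g a : path_int g a a = 0.
Proof. by apply: eqC; rewrite /= subrr. Qed.

Lemma path_intD f g a b : (forall t, rccont f t) -> (forall t, rccont g t) ->
  path_int (fun t => f t + g t) a b = path_int f a b + path_int g a b.
Proof.
move=> cf cg; have [F [dF ->]] := path_int_prim cf; have [G [dG ->]] := path_int_prim cg.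
rewrite (path_int_FTC (G := fun t => F t + G t)); first by ring.
  by move=> t; apply: rccontD.
by move=> t _; apply: lderD.
Qed.

Lemma path_intZ (c : C) f a b : (forall t, rccont f t) ->
  path_int (fun t => c * f t) a b = c * path_int f a b.
Proof.
move=> cf; have [F [dF ->]] := path_int_prim cf.
rewrite (path_int_FTC (G := fun t => c * F t)); first by ring.
  by move=> t; apply: rccontM => //; exact: rccont_cst.
by move=> t _; apply: lderZ.
Qed.

Lemma path_intB f g a b : (forall t, rccont f t) -> (forall t, rccont g t) ->
  path_int (fun t => f t - g t) a b = path_int f a b - path_int g a b.
Proof.
move=> cf cg.
have -> : (fun t => f t - g t) = (fun t => f t + -1 * g t).
  by apply/funext => t; rewrite mulN1r.
rewrite path_intD // ?path_intZ ?mulN1r // => t.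
by apply: rccontM => //; exact: rccont_cst.
Qed.

(** The factor 2 comes from bounding the real and imaginary parts separately by the mean value
    theorem. *)
Lemma path_int_bound f a b M : (forall t, rccont f t) ->
  (forall t, between a b t -> absC (f t) <= M) -> absC (path_int f a b) <= 2 * M * `|b - a|.
Proof.
move=> cf fM; apply: le_trans (absC_le _) _.
rewrite (_ : 2 * M * `|b - a| = M * `|b - a| + M * `|b - a|); last by ring.
apply: lerD => /=; apply: MVT_bound.
- by move=> t _; apply: primP => s; exact: rccont_Re.
- by move=> t tab; apply: le_trans (Re_abs _) _; apply: fM.
- by move=> t _; apply: primP => s; exact: rccont_Im.
- by move=> t tab; apply: le_trans (Im_abs _) _; apply: fM.
Qed.

(** * Cauchy's theorem *)

(* The boundary integral over [x1,x2] x [y1,y2]; it is signed, so the corners may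
   come in any order. *)
Definition rect_int (f : C -> C) (x1 x2 y1 y2 : R) : C :=
  path_int (fun s => f (Complex s y1)) x1 x2 - path_int (fun s => f (Complex s y2)) x1 x2
  + iC * (path_int (fun s => f (Complex x2 s)) y1 y2 - path_int (fun s => f (Complex x1 s)) y1 y2).

Lemma rccont_horf f y t : (forall z, ccont f z) -> rccont (fun s => f (Complex s y)) t.
Proof. by move=> cf; apply: rccont_comp (cf _); exact: rccont_hor. Qed.

Lemma rccont_verf f x t : (forall z, ccont f z) -> rccont (fun s => f (Complex x s)) t.
Proof. by move=> cf; apply: rccont_comp (cf _); exact: rccont_ver. Qed.

Lemma rect_int_splitx f x2 x1 x3 y1 y2 : rect_int f x1 x3 y1 y2 = rect_int f x1 x2 y1 y2 + rect_int f x2 x3 y1 y2.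
Proof.
rewrite /rect_int (path_int_chasles _ x1 x2 x3) (path_int_chasles (fun s => f (Complex s y2)) x1 x2 x3).
by ring.
Qed.

Lemma rect_int_splity f y2 x1 x2 y1 y3 : rect_int f x1 x2 y1 y3 = rect_int f x1 x2 y1 y2 + rect_int f x1 x2 y2 y3.
Proof.
rewrite /rect_int (path_int_chasles _ y1 y2 y3) (path_int_chasles (fun s => f (Complex x1 s)) y1 y2 y3).
by ring.
Qed.

Lemma rect_int_swapx f x1 x2 y1 y2 : rect_int f x2 x1 y1 y2 = - rect_int f x1 x2 y1 y2.
Proof.
by rewrite /rect_int (path_int_rev _ x2) (path_int_rev (fun s => f (Complex s y2)) x2); ring.
Qed.

Lemma rect_int_swapy f x1 x2 y1 y2 : rect_int f x1 x2 y2 y1 = - rect_int f x1 x2 y1 y2.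
Proof.
by rewrite /rect_int (path_int_rev _ y2) (path_int_rev (fun s => f (Complex x1 s)) y2); ring.
Qed.

Lemma rect_int_bound f x1 x2 y1 y2 M : (forall z, ccont f z) ->
  (forall x y, between x1 x2 x -> between y1 y2 y -> absC (f (Complex x y)) <= M) ->
  absC (rect_int f x1 x2 y1 y2) <= 4 * M * (`|x2 - x1| + `|y2 - y1|).
Proof.
move=> cf fM; rewrite /rect_int.
apply: le_trans (absCD _ _) _; rewrite absCM absC_i mul1r.
have h y : between y1 y2 y -> absC (path_int (fun s => f (Complex s y)) x1 x2) <= 2 * M * `|x2 - x1|.
  by move=> yy; apply: path_int_bound => [t|t tt]; [exact: rccont_horf|exact: fM].
have v x : between x1 x2 x -> absC (path_int (fun s => f (Complex x s)) y1 y2) <= 2 * M * `|y2 - y1|.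
  by move=> xx; apply: path_int_bound => [t|t tt]; [exact: rccont_verf|exact: fM].
have := h _ (between_l y1 y2); have := h _ (between_r y1 y2).
have := v _ (between_l x1 x2); have := v _ (between_r x1 x2).
have := absCB (path_int (fun s => f (Complex s y1)) x1 x2) (path_int (fun s => f (Complex s y2)) x1 x2).
have := absCB (path_int (fun s => f (Complex x2 s)) y1 y2) (path_int (fun s => f (Complex x1 s)) y1 y2).
lra.
Qed.

Lemma rect_int_B f g x1 x2 y1 y2 : (forall z, ccont f z) -> (forall z, ccont g z) ->
  rect_int (fun z => f z - g z) x1 x2 y1 y2 = rect_int f x1 x2 y1 y2 - rect_int g x1 x2 y1 y2.
Proof.
move=> cf cg; rewrite /rect_int !path_intB; first by ring.
all: by move=> t; (exact: rccont_horf || exact: rccont_verf).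
Qed.

Lemma rect_int_primitive H h x1 x2 y1 y2 : (forall z, ccont h z) ->
  (forall z, cder H z (h z)) -> rect_int h x1 x2 y1 y2 = 0.
Proof.
move=> ch dH; rewrite /rect_int mulrBr -!path_intZ; last 2 first.
- by move=> t; exact: rccont_verf.
- by move=> t; exact: rccont_verf.
have hor y : path_int (fun s => h (Complex s y)) x1 x2 = H (Complex x2 y) - H (Complex x1 y).
  apply: (path_int_FTC (G := fun s => H (Complex s y))) => [t|t _]; first exact: rccont_horf.
  by have := lder_comp (lder_hor y t) (dH _); rewrite mulr1.
have ver x : path_int (fun s => iC * h (Complex x s)) y1 y2 = H (Complex x y2) - H (Complex x y1).
  apply: (path_int_FTC (G := fun s => H (Complex x s))) => [t|t _].
    by apply: rccontM; [exact: rccont_cst|exact: rccont_verf].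
  by have := lder_comp (lder_ver x t) (dH _); rewrite mulrC.
by rewrite !hor !ver; ring.
Qed.

Lemma nested_intervals (l r : nat -> R) :
  (forall n, l n <= l n.+1) -> (forall n, r n.+1 <= r n) -> (forall n, l n <= r n) ->
  exists p, forall n, l n <= p <= r n.
Proof.
move=> lS rS lr.
have lm n m : (n <= m)%N -> l n <= l m.
  by move=> /subnK <-; elim: (m - n)%N => [|k IH] //; apply: le_trans IH _.
have rm n m : (n <= m)%N -> r m <= r n.
  by move=> /subnK <-; elim: (m - n)%N => [|k IH] //; exact: (le_trans (rS _) IH).
have lrnm n m : l n <= r m.
  have := lm n (maxn n m) (leq_maxl _ _); have := rm m (maxn n m) (leq_maxr _ _).
  by have := lr (maxn n m); lra.
exists (sup (range l)) => n; apply/andP; split.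
  apply: sup_upper_bound; last by exists n.
  by split; [exists (l 0%N), 0%N | exists (r 0%N) => _ [m _ <-]].
by apply: sup_le_ub => [|_ [m _ <-]] //; exists (l 0%N), 0%N.
Qed.

Lemma exp2n_lt (d : R) : 0 < d -> exists n, 2^-1 ^+ n < d.
Proof.
move=> d0; exists (Num.bound d^-1).
have b := archi_boundP (ltW (_ : 0 < d^-1)); rewrite invr_gt0 in b.
have {}b := b d0.
rewrite exprVn invf_plt ?posrE ?exprn_gt0 //; apply: lt_trans b _.
by rewrite -natrX ltr_nat ltn_expl.
Qed.

Lemma quarter (a b c d : C) (k : R) : 4 * k < absC (a + b + c + d) ->
  [\/ k < absC a, k < absC b, k < absC c | k < absC d].
Proof.
move=> h.
have [|ha] := ltP k (absC a); first by constructor 1.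
have [|hb] := ltP k (absC b); first by constructor 2.
have [|hc] := ltP k (absC c); first by constructor 3.
have [|hd] := ltP k (absC d); first by constructor 4.
have := absCD (a + b + c) d; have := absCD (a + b) c; have := absCD a b; lra.
Qed.

(** Bisection. If the integral is nonzero, one quarter of the rectangle keeps more than its share at
    each stage, so the integrals stay above k * S * 4^-n. At the common point of the rectangles the
    affine part of f integrates to 0, and the remainder is too small. *)
Lemma goursat_le f x1 x2 y1 y2 : x1 <= x2 -> y1 <= y2 -> (forall z, ccont f z) ->
  (forall x y, x1 <= x <= x2 -> y1 <= y <= y2 -> holo_at f (Complex x y)) ->
  rect_int f x1 x2 y1 y2 = 0.
Proof.
move=> x12 y12 cf hf; apply/eqP; rewrite -absC_eq0 eq_le absC_ge0 andbT leNgt.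
apply/negP => J0.
pose a := x2 - x1; pose b := y2 - y1; pose S := a ^+ 2 + b ^+ 2.
have a0 : 0 <= a by rewrite subr_ge0.
have b0 : 0 <= b by rewrite subr_ge0.
have S0 : 0 <= S by rewrite addr_ge0 ?sqr_ge0.
(* The denominator makes k * S strictly smaller than the initial integral, also when the rectangle
   is degenerate and S = 0. *)
pose k := absC (rect_int f x1 x2 y1 y2) / (2 * (S + 1)).
have k0 : 0 < k by rewrite divr_gt0 // mulr_gt0 // ltr_pwDr.
pose q n : R := 2^-1 ^+ n.
have q0 n : 0 < q n by rewrite exprn_gt0.
have qS n : q n = q n.+1 + q n.+1 by rewrite /q exprS; lra.
pose Bad (n : nat) (p : R * R) := k * (S * (q n * q n)) <
  absC (rect_int f p.1 (p.1 + a * q n) p.2 (p.2 + b * q n)).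
have bad0 : Bad 0%N (x1, y1).
  rewrite /Bad /q expr0 !mulr1 /= (_ : x1 + a = x2); last by rewrite /a; ring.
  rewrite (_ : y1 + b = y2); last by rewrite /b; ring.
  rewrite /k mulrAC ltr_pdivrMr; last by rewrite mulr_gt0 // ltr_pwDr.
  by rewrite ltr_pM2l //; lra.
(* The implication stands under the existential so that [choice] gives a total step function. *)
have step (np : nat * (R * R)) : exists p', Bad np.1 np.2 ->
    [/\ Bad np.1.+1 p', np.2.1 <= p'.1 <= np.2.1 + a * q np.1.+1 &
        np.2.2 <= p'.2 <= np.2.2 + b * q np.1.+1].
  case: np => n [x y] /=.
  have aq : 0 <= a * q n.+1 by rewrite mulr_ge0 // ltW.
  have bq : 0 <= b * q n.+1 by rewrite mulr_ge0 // ltW.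
  pose x' := x + a * q n.+1; pose y' := y + b * q n.+1.
  have [B|nB] := pselect (Bad n (x, y)); last by exists (x, y) => /nB.
  have xE : x + a * q n = x' + a * q n.+1 by rewrite /x' qS; ring.
  have yE : y + b * q n = y' + b * q n.+1 by rewrite /y' qS; ring.
  have SE : k * (S * (q n * q n)) = 4 * (k * (S * (q n.+1 * q n.+1))) by rewrite qS; ring.
  move: B; rewrite /Bad /= SE xE yE (rect_int_splitx f x' x) (rect_int_splity f y' x x') (rect_int_splity f y' x') addrA.
  move=> /quarter[] B; [exists (x, y)|exists (x, y')|exists (x', y)|exists (x', y')] => _;
    by split => //=; rewrite ?/x' ?/y'; apply/andP; split; lra.
have [F HF] := choice step.
pose u := nat_rect (fun=> (R * R)%type) (x1, y1) (fun n p => F (n, p)).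
have badu n : Bad n (u n) by elim: n => [|n /(HF (n, _))[]] //.
have uS n : (u n).1 <= (u n.+1).1 <= (u n).1 + a * q n.+1.
  by have [] := HF (n, u n) (badu n).
have vS n : (u n).2 <= (u n.+1).2 <= (u n).2 + b * q n.+1.
  by have [] := HF (n, u n) (badu n).
have [p1 hp1] : exists p, forall n, (u n).1 <= p <= (u n).1 + a * q n.
  apply: (nested_intervals (l := fun n => (u n).1) (r := fun n => (u n).1 + a * q n)) => n.
  - by have /andP[] := uS n.
  - have /andP[_] := uS n; rewrite (qS n) mulrDr; lra.
  - by rewrite lerDl mulr_ge0 // ltW.
have [p2 hp2] : exists p, forall n, (u n).2 <= p <= (u n).2 + b * q n.
  apply: (nested_intervals (l := fun n => (u n).2) (r := fun n => (u n).2 + b * q n)) => n.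
  - by have /andP[] := vS n.
  - have /andP[_] := vS n; rewrite (qS n) mulrDr; lra.
  - by rewrite lerDl mulr_ge0 // ltW.
pose z0 := Complex p1 p2.
have : holo_at f z0.
  apply: hf; [have := hp1 0%N|have := hp2 0%N]; rewrite /q /= mulr1 ?/a ?/b => /andP[h1 h2];
    apply/andP; split; lra.
move=> /holo_atP[l [phi [cphi pl [r r0 hr]]]].
(* In the final estimate 4 * (k / 8) * (a + b)^2 = k * (a + b)^2 / 2, which is at most k * S. *)
have k8 : 0 < k / 8 by rewrite divr_gt0.
have [d d0 hd] := cphi _ k8.
have [n hn] : exists n, (a + b) * q n < Num.min d r.
  have ab1 : 0 < a + b + 1 by rewrite ltr_pwDr // addr_ge0.
  have [|n hn] := @exp2n_lt (Num.min d r / (a + b + 1)).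
    by rewrite divr_gt0 // lt_min d0.
  exists n; move: hn; rewrite ltr_pdivlMr // -/(q n) mulrC; apply: le_lt_trans.
  by rewrite ler_wpM2r ?ltW //; lra.
pose g z := f z0 + l * (z - z0).
pose H z := f z0 * z + l * ((z - z0) ^+ 2 / 2%:R).
have cg z : ccont g z.
  apply: ccontD; first exact: ccont_cst.
  apply: ccontM; first exact: ccont_cst.
  by apply: ccontB; [exact: ccont_id|exact: ccont_cst].
have dH z : cder H z (g z).
  have d1 : cder (fun z => z - z0) z 1.
    by have := cderB (cder_id z) (@cder_cst z0 z); rewrite subr0.
  have two : (2%:R : C) != 0 by rewrite pnatr_eq0.
  apply: cder_eq (cderD (cderM (@cder_cst (f z0) z) (cder_id z))
     (cderM (@cder_cst l z) (cderM (cderX 2 d1) (@cder_cst (2%:R^-1) z)))) _.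
  by rewrite /g /= expr1; field.
have Jg := rect_int_primitive (u n).1 ((u n).1 + a * q n) (u n).2 ((u n).2 + b * q n) cg dH.
have := badu n; rewrite /Bad -[X in absC X]subr0 -Jg -rect_int_B //.
apply/negP; rewrite -leNgt.
have aq : 0 <= a * q n by rewrite mulr_ge0 // ltW.
have bq : 0 <= b * q n by rewrite mulr_ge0 // ltW.
apply: (@le_trans _ _ (4 * (k / 8 * ((a + b) * q n)) * (a * q n + b * q n))).
  have := @rect_int_bound (fun z => f z - g z) (u n).1 ((u n).1 + a * q n) (u n).2 ((u n).2 + b * q n)
     (k / 8 * ((a + b) * q n)).
  rewrite ![_ + _ * _ - _]addrAC !subrr !add0r !ger0_norm //; apply.
    by move=> z; apply: ccontB.
  move=> x y; rewrite !between_le ?lerDl // => xx yy.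
  have zz : absC (Complex x y - z0) <= (a + b) * q n.
    apply: le_trans (absC_le _) _; rewrite mulrDl ReB ImB /=; apply: lerD.
      have /andP[h1 h2] := hp1 n; move: xx => /andP[h3 h4]; rewrite ler_norml; lra.
    have /andP[h1 h2] := hp2 n; move: yy => /andP[h3 h4]; rewrite ler_norml; lra.
  have := le_lt_trans zz hn; rewrite lt_min => /andP[zd zr].
  rewrite /g opprD addrA hr // -mulrBl absCM -pl.
  by apply: ler_pM; rewrite ?absC_ge0 // ltW // hd.
rewrite -mulrDl (_ : _ * _ = k * (((a + b) ^+ 2 / 2) * (q n * q n))); last by field.
apply: (ler_wpM2l (ltW k0)); apply: ler_wpM2r; first by rewrite mulr_ge0 // ltW.
by rewrite /S; have := sqr_ge0 (a - b); rewrite !expr2; lra.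
Qed.

Lemma goursat f x1 x2 y1 y2 : (forall z, ccont f z) ->
  (forall x y, between x1 x2 x -> between y1 y2 y -> holo_at f (Complex x y)) ->
  rect_int f x1 x2 y1 y2 = 0.
Proof.
move=> cf; wlog x12 : x1 x2 / x1 <= x2.
  move=> W hf; have [|/ltW] := leP x1 x2; first by move=> /W; apply.
  move=> /W; rewrite rect_int_swapx => W'; apply: oppr_inj; rewrite oppr0; apply: W' => x y xx.
  by apply: hf; rewrite betweenC.
wlog y12 : y1 y2 / y1 <= y2.
  move=> W hf; have [|/ltW] := leP y1 y2; first by move=> /W; apply.
  move=> /W; rewrite rect_int_swapy => W'; apply: oppr_inj; rewrite oppr0; apply: W' => x y xx yy.
  by apply: hf; rewrite // betweenC.
move=> hf; apply: goursat_le => // x y xx yy; apply: hf; by rewrite between_le.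
Qed.

Lemma goursat_corner f u v x y : (forall z, ccont f z) ->
  (forall s t, between u x s -> between v y t -> Complex s t != Complex u v ->
     holo_at f (Complex s t)) ->
  rect_int f u x v y = 0.
Proof.
move=> cf hf.
have [<-|xu] := eqVneq u x; first by rewrite /rect_int !path_int_refl !subrr mulr0 addr0.
have [<-|yv] := eqVneq v y; first by rewrite /rect_int !path_int_refl !subrr mulr0 addr0.
pose S := `|x - u| + `|y - v|.
have S0 : 0 < S by rewrite ltr_wpDl // normr_gt0 subr_eq0 eq_sym.
apply/eqP; rewrite -absC_eq0 eq_le absC_ge0 andbT.
apply/ler_addgt0Pl => e e0; rewrite addr0.
pose M := absC (f (Complex u v)) + 1.
have M0 : 0 < M by rewrite ltr_wpDl // absC_ge0.
have [d d0 hd] := cf (Complex u v) _ ltr01.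
(* The rectangle at the corner, scaled by t, lies within d of the corner, where |f| <= M; by
   [rect_int_bound] its integral is at most 4 * M * t * S <= e. *)
pose t := Num.min 1 (Num.min (d / (2 * S)) (e / (4 * M * S))).
have t0 : 0 < t by rewrite !lt_min ltr01 !divr_gt0 // !mulr_gt0.
have t1 : t <= 1 by rewrite ge_min lexx.
have td : t * S < d.
  have : t <= d / (2 * S) by rewrite !ge_min lexx orbT.
  by rewrite ler_pdivlMr ?mulr_gt0 //; lra.
have te : 4 * M * (t * S) <= e.
  have : t <= e / (4 * M * S) by rewrite !ge_min lexx !orbT.
  by rewrite ler_pdivlMr ?mulr_gt0 //; lra.
pose x' := u + t * (x - u); pose y' := v + t * (y - v).
have btw (a b : R) : between a b (a + t * (b - a)).
  have [ab|/ltW ab] := leP a b.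
    by rewrite between_le //; apply/andP; split; nra.
  by rewrite betweenC between_le //; apply/andP; split; nra.
have nbt (a b c : R) : a != b -> between (a + t * (b - a)) b c -> c != a.
  move=> ab; have [lab|lab|eab] := ltgtP a b; last by rewrite eab eqxx in ab.
    rewrite between_le; last by nra.
    move=> /andP[h _]; rewrite gt_eqF //; apply: lt_le_trans h; rewrite ltrDl mulr_gt0 //; lra.
  rewrite betweenC between_le; last by nra.
  move=> /andP[_ h]; rewrite lt_eqF //; apply: le_lt_trans h _; rewrite gtrDl pmulr_rlt0 //; lra.
rewrite (rect_int_splity _ y') (rect_int_splitx _ x').
rewrite (goursat (x1 := x')) //; last first.
  move=> s r ss rr; apply: hf.
  - by apply: between_sub ss; [exact: btw|exact: between_r].
  - by apply: between_sub rr; [exact: between_l|exact: btw].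
  - by apply: contra (nbt _ _ _ xu ss) => /eqP[->].
rewrite (goursat (y1 := y')) //; last first.
  move=> s r ss rr; apply: hf => //.
  - by apply: between_sub rr; [exact: btw|exact: between_r].
  - by apply: contra (nbt _ _ _ yv rr) => /eqP[_ ->].
rewrite !addr0; apply: le_trans te.
apply: (@le_trans _ _ (4 * M * (`|x' - u| + `|y' - v|))).
  apply: rect_int_bound => // s r ss rr.
  have : absC (Complex s r - Complex u v) < d.
    apply: le_lt_trans (absC_le _) _; rewrite ReB ImB /=; apply: le_lt_trans td.
    have := between_dist ss; have := between_dist rr.
    by rewrite /x' /y' ![_ + _ * _ - _]addrAC !subrr !add0r !normrM (gtr0_norm t0) /S; lra.
  move=> /hd; have := absC_rtri (f (Complex s r)) (f (Complex u v)); rewrite /M; lra.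
rewrite /x' /y' ![_ + _ * _ - _]addrAC !subrr !add0r !normrM (gtr0_norm t0) /S; lra.
Qed.

(* The exceptional point is cut out as a corner of up to four rectangles, and a small
   rectangle at that corner contributes arbitrarily little. *)
Lemma goursat_except f w x1 x2 y1 y2 : (forall z, ccont f z) ->
  (forall x y, between x1 x2 x -> between y1 y2 y -> Complex x y != w ->
     holo_at f (Complex x y)) ->
  rect_int f x1 x2 y1 y2 = 0.
Proof.
case: w => u v cf hf.
have [/andP[uu vv]|nw] := boolP (between x1 x2 u && between y1 y2 v); last first.
  apply: goursat => // x y xx yy; apply: hf => //.
  by apply: contra nw => /eqP[<- <-]; rewrite xx.
have corner x y : between x1 x2 x -> between y1 y2 y -> rect_int f u x v y = 0.
  move=> xx yy; apply: goursat_corner => // s t ss tt; apply: hf.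
    exact: between_sub ss.
  exact: between_sub tt.
rewrite (rect_int_splitx f u x1 x2) (rect_int_splity f v x1 u) (rect_int_splity f v u x2) (rect_int_swapx f u x1 y1 v).
rewrite (rect_int_swapy f u x1 v y1) (rect_int_swapx f u x1 v y2) (rect_int_swapy f u x2 v y1).
by rewrite !corner ?between_l ?between_r // !oppr0 !addr0.
Qed.

(** The primitive integrates horizontally at height de + 1 from the imaginary axis, then vertically.
    The vanishing integral over a rectangle reroutes its increment along two short segments at z.
    One point w of mere continuity is allowed, so that the lemma applies to a divided difference
    before that is known to be holomorphic at w. *)
Lemma ex_primitive f w (de : R) : (forall z, ccont f z) ->
  (forall z, de < complex.Im z -> z != w -> holo_at f z) ->
  exists H, forall z, de < complex.Im z -> cder H z (f z).
Proof.
move=> cf hf; pose y0 := de + 1.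
have dy0 : de < y0 by rewrite ltrDl.
pose V x y := path_int (fun s => f (Complex x s)) y0 y.
pose U y x := path_int (fun s => f (Complex s y)) 0 x.
exists (fun z => U y0 (complex.Re z) + iC * V (complex.Re z) (complex.Im z)).
case=> a b /= db; apply/cderP => e e0.
(* The two segments contribute at most (e / 4) (|h| + |k|), which is below e |h + ik|. *)
have e4 : 0 < e / 8 by rewrite divr_gt0.
have [d d0 hd] := cf (Complex a b) _ e4.
exists (Num.min d (b - de)); split; first by rewrite lt_min d0 subr_gt0.
case=> h k hk0; rewrite lt_min => /andP[hkd hkb] /=.
have hd' : `|h| <= absC (Complex h k) by exact: (Re_abs (Complex h k)).
have kd' : `|k| <= absC (Complex h k) by exact: (Im_abs (Complex h k)).
have dbk : de < b + k.
  have := ler_norm (- k); rewrite normrN; lra.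
have J0 : rect_int f a (a + h) y0 b = 0.
  apply: (goursat_except (w := w)) => // x y _ yy; apply: hf => /=.
  by apply: lt_le_trans (proj1 (andP yy)); rewrite lt_min dy0.
have key : U y0 (a + h) + iC * V (a + h) (b + k) - (U y0 a + iC * V a b) =
    path_int (fun s => f (Complex s b)) a (a + h) + iC * path_int (fun s => f (Complex (a + h) s)) b (b + k).
  move: J0; rewrite /rect_int /U /V (path_int_chasles _ 0 a (a + h)) (path_int_chasles _ y0 b (b + k)) => J0.
  by rewrite -[RHS]addr0 -J0; ring.
have hor : path_int (fun s => f (Complex s b)) a (a + h) =
    path_int (fun s => f (Complex s b) - f (Complex a b)) a (a + h) + f (Complex a b) * RtoC h.
  rewrite path_intB; [|by move=> t; exact: rccont_horf|by move=> t; exact: rccont_cst].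
  rewrite (path_int_FTC (G := fun s => f (Complex a b) * RtoC s) (g := fun=> f (Complex a b))).
  - by rewrite RtoCD; ring.
  - by move=> t; exact: rccont_cst.
  - move=> t _; have := lderZ (f (Complex a b)) (lder_hor 0 t); rewrite mulr1; exact.
have ver : path_int (fun s => f (Complex (a + h) s)) b (b + k) =
    path_int (fun s => f (Complex (a + h) s) - f (Complex a b)) b (b + k) + f (Complex a b) * RtoC k.
  rewrite path_intB; [|by move=> t; exact: rccont_verf|by move=> t; exact: rccont_cst].
  rewrite (path_int_FTC (G := fun s => f (Complex a b) * RtoC s) (g := fun=> f (Complex a b))).
  - by rewrite RtoCD; ring.
  - by move=> t; exact: rccont_cst.
  - move=> t _; have := lderZ (f (Complex a b)) (lder_hor 0 t); rewrite mulr1; exact.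
rewrite key hor ver.
set A := path_int _ a _; set B := path_int _ b _.
have hkE : Complex h k = RtoC h + iC * RtoC k by exact: ComplexE.
rewrite (_ : _ / _ - _ = (A + iC * B) / Complex h k); last first.
  rewrite hkE in hk0 *; by field.
rewrite absCM absCV ltr_pdivrMr ?absC_gt0 //.
have hk1 : 0 < absC (Complex h k) by rewrite absC_gt0.
have bA : absC A <= 2 * (e / 8) * `|a + h - a|.
  apply: path_int_bound => [t|t tt].
    by apply: rccontB; [exact: rccont_horf|exact: rccont_cst].
  apply/ltW/hd; apply: le_lt_trans (absC_le _) _; rewrite ReB ImB /= subrr normr0 addr0.
  have := between_dist tt; rewrite addrAC subrr add0r; lra.
have bB : absC B <= 2 * (e / 8) * `|b + k - b|.
  apply: path_int_bound => [t|t tt].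
    by apply: rccontB; [exact: rccont_verf|exact: rccont_cst].
  apply/ltW/hd; have := between_dist tt; rewrite addrAC subrr add0r => tk.
  apply: le_lt_trans hkd; rewrite -(@ler_pXn2r _ 2) ?nnegrE ?absC_ge0 // !absC_sqr ReB ImB /=.
  rewrite addrAC subrr add0r lerD2l -(real_normK (num_real (t - b))) -(real_normK (num_real k)).
  by rewrite ler_pXn2r ?nnegrE.
have := absCD A (iC * B); rewrite absCM absC_i mul1r.
move: bA bB; rewrite ![_ + _ - _]addrAC !subrr !add0r => bA bB.
have : e / 8 * `|h| <= e / 8 * absC (Complex h k) by rewrite ler_wpM2l // ltW.
have : e / 8 * `|k| <= e / 8 * absC (Complex h k) by rewrite ler_wpM2l // ltW.
have : 0 < e * absC (Complex h k) by rewrite mulr_gt0.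
lra.
Qed.

(** * Cauchy's formula and divided differences *)

Definition deriv (f : C -> C) (a : C) : C := xget 0 [set l | cder f a l].

Lemma derivP f a : holo_at f a -> cder f a (deriv f a).
Proof. by move=> /holo_atP[l fl]; rewrite /deriv; case: xgetP => [m _ //|/(_ l)]. Qed.

Definition divdiff (a : C) (f : C -> C) (z : C) : C :=
  if z == a then deriv f a else (f z - f a) / (z - a).

Lemma divdiffE a f z : divdiff a f z * (z - a) = f z - f a.
Proof.
rewrite /divdiff; case: eqP => [->|/eqP za]; first by rewrite !subrr mulr0.
by rewrite divfK // subr_eq0.
Qed.

Lemma divdiff_ne a f z : z != a -> divdiff a f z = (f z - f a) / (z - a).
Proof. by rewrite /divdiff => /negbTE ->. Qed.

Lemma divdiff_cont_at a f : holo_at f a -> ccont (divdiff a f) a.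
Proof.
move=> /derivP [phi [cphi pa [r r0 hr]]].
apply: ccont_local r0 _ cphi => x /hr fx.
rewrite /divdiff; case: eqP => [->|/eqP xa]; first by rewrite pa.
by rewrite fx mulfK // subr_eq0.
Qed.

Lemma absC_sub_gt0 (z a : C) : z != a -> 0 < absC (z - a).
Proof. by rewrite absC_gt0 subr_eq0. Qed.

Lemma ball_ne (z a x : C) : absC (x - z) < absC (z - a) -> x != a.
Proof. by move=> h; apply/eqP => xa; move: h; rewrite xa absCC ltxx. Qed.

Lemma divdiff_holo_ne a f z : z != a -> holo_at f z -> holo_at (divdiff a f) z.
Proof.
move=> za hf; apply: (holo_local (g := fun x => (f x - f a) / (x - a)) (absC_sub_gt0 za)).
  by move=> x /ball_ne xa; rewrite divdiff_ne.
apply: holo_div; [apply: holoB => //|apply: holoB; [exact: holo_id|]|by rewrite subr_eq0];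
  exact: holo_cst.
Qed.

Lemma divdiff_cont_ne a f z : z != a -> ccont f z -> ccont (divdiff a f) z.
Proof.
move=> za cf; apply: (ccont_local (g := fun x => (f x - f a) / (x - a)) (absC_sub_gt0 za)).
  by move=> x /ball_ne xa; rewrite divdiff_ne.
apply: ccont_div; [apply: ccontB => //|apply: ccontB; [exact: ccont_id|]|by rewrite subr_eq0];
  exact: ccont_cst.
Qed.

Lemma ccont_limit_eq f g a (r : R) : 0 < r -> ccont f a -> ccont g a ->
  (forall d : R, 0 < d -> exists2 z, absC (z - a) < d & f z = g z) -> f a = g a.
Proof.
move=> r0 cf cg fg; apply/eqP; rewrite -subr_eq0 -absC_eq0 eq_le absC_ge0 andbT.
apply/ler_addgt0Pl => e e0; rewrite addr0.
have [d d0 hd] := ccontB cf cg e0; have [z za fz] := fg d d0.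
by have := hd z za; rewrite fz subrr sub0r absCN => /ltW.
Qed.

(** * Cauchy's formula on circles *)

Definition circ (a : C) (r t : R) : C := a + RtoC r * (RtoC (cos t) + iC * RtoC (sin t)).

Lemma rder_cos (T : realType) (t : T) : rder (@cos T) t (- sin t).
Proof. by apply/rderP; exact: is_derive_cos. Qed.

Lemma rder_sin (T : realType) (t : T) : rder (@sin T) t (cos t).
Proof. by apply/rderP; exact: is_derive_sin. Qed.

Lemma lder_circ a r t : lder (circ a r) t (iC * (circ a r t - a)).
Proof.
have h : lder (fun t => RtoC (cos t) + iC * RtoC (sin t)) t
   (RtoC (- sin t) + iC * RtoC (cos t)).
  apply: lderD; first by apply: lder_RtoC; exact: rder_cos.
  by apply: lderZ; apply: lder_RtoC; exact: rder_sin.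
have := lder_comp h (cderD (@cder_cst a _) (cderM (@cder_cst (RtoC r) _) (@cder_id _))).
rewrite /circ (_ : (_ + _) * _ = iC * (a + RtoC r * (RtoC (cos t) + iC * RtoC (sin t)) - a)) //.
rewrite RtoCN.
have := iC_sqr.
move: iC (RtoC (sin t)) (RtoC (cos t)) (RtoC r) => i s c ro ii.
rewrite (_ : i * (a + _ - a) = ro * (i * c + i * i * s)); last by ring.
by rewrite ii; ring.
Qed.

Lemma lder_rccont g t l : lder g t l -> rccont g t.
Proof.
move=> [q [cq _ [s s0 hs]]] e e0.
have : rccont (fun x => g t + q x * RtoC (x - t)) t.
  apply: rccontD; first exact: rccont_cst.
  apply: rccontM => //; apply: (rccont_RtoC (f := fun x => x - t)) => e' e'0.
  by exists e' => // u; rewrite subrr subr0.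
move=> /(_ e e0)[d d0 hd]; exists (Num.min s d); first by rewrite lt_min s0.
move=> x; rewrite lt_min => /andP[/hs A /hd].
by rewrite -A subrr mulr0 addr0 addrCA subrr addr0.
Qed.

Lemma rccont_circ a r t : rccont (circ a r) t.
Proof. exact: lder_rccont (lder_circ a r t). Qed.

Lemma absC_circ a r t : 0 < r -> absC (circ a r t - a) = r.
Proof.
move=> r0; rewrite /circ addrAC subrr add0r absCM absC_R gtr0_norm //.
rewrite -[RHS]mulr1; congr (_ * _); rewrite -ComplexE /absC /=.
by rewrite cos2Dsin2 sqrtr1.
Qed.

Lemma circ_ne a r t : 0 < r -> circ a r t - a != 0.
Proof. by move=> r0; rewrite -absC_gt0 absC_circ. Qed.

Lemma circ_dist a r t w : 0 < r -> r - absC (w - a) <= absC (circ a r t - w).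
Proof.
move=> r0; rewrite -{1}(absC_circ a t r0).
have := absC_rtri (circ a r t - a) (w - a).
by rewrite (_ : _ - (w - a) = circ a r t - w); [apply|ring].
Qed.

Lemma circ_ne2 a r t w : 0 < r -> absC (w - a) < r -> circ a r t - w != 0.
Proof.
by move=> r0 wr; rewrite -absC_gt0; apply: lt_le_trans (circ_dist _ _ _ r0); rewrite subr_gt0.
Qed.

Lemma circ_2pi a r : circ a r (2 * pi) = circ a r 0.
Proof. by rewrite /circ mulr_natl cos2pi sin2pi cos0 sin0. Qed.

Lemma pi2_norm : `|2 * pi - 0 : R| = 2 * pi.
Proof. by rewrite subr0 ger0_norm // mulr_ge0 // pi_ge0. Qed.

Lemma le_geo0 (T : realType) (x K y : T) : 0 <= x < 1 -> (forall n, y <= K * x ^+ n) -> y <= 0.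
Proof.
move=> /andP[x0 x1] h.
have cv : (fun n => K * x ^+ n) @ \oo --> K * 0.
  by apply: cvgM; [exact: cvg_cst|apply: cvg_expr; rewrite ger0_norm].
rewrite -(mulr0 K) -(cvg_lim _ cv) //.
by apply: limr_ge; [apply/cvg_ex; exists (K * 0)|exact: nearW].
Qed.

(** Powers of z - a with exponent at most -2 have a single-valued primitive, and the circle is
    closed. The factor [iC * (circ a r t - a)] is the derivative of the parametrisation. *)
Lemma path_int_circ_pow a r k : 0 < r ->
  path_int (fun t => iC * (circ a r t - a) / (circ a r t - a) ^+ k.+2) 0 (2 * pi) = 0.
Proof.
move=> r0.
pose G z := - (k.+1%:R)^-1 * ((z - a) ^+ k.+1)^-1.
have k0 : (k.+1%:R : C) != 0 by rewrite pnatr_eq0.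
rewrite (path_int_FTC (G := fun t => G (circ a r t))).
- by rewrite circ_2pi subrr.
- move=> t; apply: rccont_div; last by rewrite expf_neq0 // circ_ne.
    apply: rccontM; first exact: rccont_cst.
    by apply: rccontB; [exact: rccont_circ|exact: rccont_cst].
  have := rccont_comp (F := fun z => (z - a) ^+ k.+2) (rccont_circ a r t); apply.
  by apply: ccontX; apply: ccontB; [exact: ccont_id|exact: ccont_cst].
- move=> t _.
  have z0 := circ_ne a t r0; set z := circ a r t in z0 *.
  have d1 : cder (fun z => z - a) z 1.
    by have := cderB (cder_id z) (@cder_cst a z); rewrite subr0.
  have zk : (z - a) ^+ k.+1 != 0 by rewrite expf_neq0.
  have := lder_comp (lder_circ a r t)
    (cderM (@cder_cst (- (k.+1%:R)^-1) z) (cderV (cderX k.+1 d1) zk)).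
  rewrite -/z; congr (lder _ _ _).
  rewrite mul0r add0r mulr1 [k.+1.-1]/= -!exprM.
  rewrite (_ : (k.+1 * 2 = k + k.+2)%N); last by rewrite mulnC mul2n -addnn addSnnS.
  rewrite exprD.
  have zk2 : (z - a) ^+ k.+2 != 0 by rewrite expf_neq0.
  have zk0 : (z - a) ^+ k != 0 by rewrite expf_neq0.
  by field; rewrite zk2 zk0 -natr1 in k0 *; rewrite addrC.
Qed.

Section circle.
Variables (a : C) (r : R) (r0 : 0 < r) (F : C -> C).
Hypothesis cF : forall t, ccont F (circ a r t).

(* [kern_step] is one step of the expansion of 1/(z - w) in powers of (w - a)/(z - a). *)
Definition kern n w t := F (circ a r t) * (iC * (circ a r t - a))
  / ((circ a r t - a) ^+ n * (circ a r t - w)).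

Lemma rccont_kern n w t : absC (w - a) < r -> rccont (kern n w) t.
Proof.
move=> wr; have cc b : rccont (fun t => circ a r t - b) t.
  by apply: rccontB; [exact: rccont_circ|exact: rccont_cst].
apply: rccont_div; last by rewrite mulf_neq0 ?expf_neq0 ?circ_ne ?circ_ne2.
  apply: rccontM; first by apply: rccont_comp (cF t); exact: rccont_circ.
  by apply: rccontM => //; exact: rccont_cst.
apply: rccontM => //.
have := rccont_comp (F := fun z => (z - a) ^+ n) (rccont_circ a r t); apply.
by apply: ccontX; apply: ccontB; [exact: ccont_id|exact: ccont_cst].
Qed.

Lemma kern_step n w : absC (w - a) < r ->
  path_int (kern n w) 0 (2 * pi) = path_int (kern n a) 0 (2 * pi) + (w - a) * path_int (kern n.+1 w) 0 (2 * pi).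
Proof.
move=> wr; have ar : absC (a - a) < r by rewrite subrr absC0.
rewrite -path_intZ; last by move=> t; exact: rccont_kern.
rewrite -path_intD; first last.
- by move=> t; apply: rccontM; [exact: rccont_cst|exact: rccont_kern].
- by move=> t; exact: rccont_kern.
congr (path_int _ _ _); apply/funext => t; rewrite /kern exprS.
have h1 := circ_ne a t r0; have h2 := circ_ne2 t r0 wr.
have h3 : (circ a r t - a) ^+ n != 0 by rewrite expf_neq0.
have cE : circ a r t - w = (circ a r t - a) - (w - a) by ring.
rewrite cE in h2 *; move: h1 h2 h3.
move: (circ a r t - a) (w - a) => u v; move: (u ^+ n) => x h1 h2 h3.
by field; rewrite h2 h1 h3.
Qed.

Lemma kern_bound M n w : (forall t, between 0 (2 * pi) t -> absC (F (circ a r t)) <= M) -> absC (w - a) < r ->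
  absC (path_int (kern n w) 0 (2 * pi)) <= 2 * (M * r / (r ^+ n * (r - absC (w - a)))) * (2 * pi).
Proof.
move=> hM wr; have := @path_int_bound (kern n w) 0 (2 * pi) (M * r / (r ^+ n * (r - absC (w - a)))).
rewrite pi2_norm; apply => [t|t tt]; first exact: rccont_kern.
rewrite /kern absCM absCV absCM absCM absC_i mul1r absCM absCX absC_circ //.
have d := circ_dist a t w r0; have s0 : 0 < r - absC (w - a) by rewrite subr_gt0.
have M0 : 0 <= M by apply: le_trans (hM t tt); exact: absC_ge0.
apply: ler_pM.
- by rewrite mulr_ge0 ?absC_ge0 // ltW.
- by rewrite invr_ge0 mulr_ge0 ?absC_ge0 // exprn_ge0 // ltW.
- by rewrite ler_pM2r // hM.
- rewrite lef_pV2 ?posrE.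
  + by rewrite ler_pM2l // exprn_gt0.
  + by rewrite mulr_gt0 ?exprn_gt0 //; apply: lt_le_trans d.
  + by rewrite mulr_gt0 ?exprn_gt0.
Qed.

End circle.

(** Expanding 1/(z - w) around a by [kern_step] leaves only the term 1/(z - a): the higher terms
    vanish by [path_int_circ_pow], and the remainder decays like (|w - a| / r)^n. *)
Lemma path_int_circ_winding a r w : 0 < r -> absC (w - a) < r ->
  path_int (fun t => iC * (circ a r t - a) / (circ a r t - w)) 0 (2 * pi) = iC * RtoC (2 * pi).
Proof.
move=> r0 wr; pose F (z : C) := (1 : C).
have cF t : ccont F (circ a r t) by exact: ccont_cst.
have -> : (fun t => iC * (circ a r t - a) / (circ a r t - w)) = kern a r F 0 w.
  by apply/funext => t; rewrite /kern /F expr0 !mul1r.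
have A0 : path_int (kern a r F 0 a) 0 (2 * pi) = iC * RtoC (2 * pi).
  have -> : kern a r F 0 a = fun=> iC.
    apply/funext => t; rewrite /kern /F expr0 !mul1r mulfK //; exact: circ_ne.
  rewrite (path_int_FTC (G := fun t => iC * RtoC t)).
  - by rewrite RtoC0 mulr0 subr0.
  - by move=> t; exact: rccont_cst.
  - by move=> t _; have := lderZ iC (lder_hor 0 t); rewrite mulr1; exact.
have AS k : path_int (kern a r F k.+1 a) 0 (2 * pi) = 0.
  rewrite -(path_int_circ_pow a k r0); congr (path_int _ _ _); apply/funext => t.
  by rewrite /kern /F mul1r -exprSr.
have step n := kern_step r0 cF n wr.
have K1 : path_int (kern a r F 1 w) 0 (2 * pi) = 0.
  apply/eqP; rewrite -absC_eq0 eq_le absC_ge0 andbT.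
  apply: (@le_geo0 _ (absC (w - a) / r) (2 * (1 * r / (r * (r - absC (w - a)))) * (2 * pi))).
    by rewrite divr_ge0 ?absC_ge0 ?ltW //= ltr_pdivrMr // mul1r.
  move=> n.
  have -> : path_int (kern a r F 1 w) 0 (2 * pi) = (w - a) ^+ n * path_int (kern a r F n.+1 w) 0 (2 * pi).
    elim: n => [|n ->]; first by rewrite mul1r.
    by rewrite step AS add0r mulrA -exprSr.
  have F1 (t : R) : between 0 (2 * pi) t -> absC (F (circ a r t)) <= 1 by rewrite absC1.
  rewrite absCM absCX.
  have := kern_bound r0 cF n.+1 F1 wr.
  move=> /(ler_wpM2l (exprn_ge0 n (absC_ge0 (w - a)))) /le_trans; apply.
  have sn : r - absC (w - a) != 0 by rewrite subr_eq0 gt_eqF.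
  rewrite exprS exprMn exprVn le_eqVlt; apply/orP; left; apply/eqP.
  have rn : r ^+ n != 0 by rewrite expf_neq0 // gt_eqF.
  have rr : r != 0 by rewrite gt_eqF.
  move: (absC (w - a)) (r ^+ n) (_ ^+ n) sn rn => x y z sn rn.
  by field; rewrite sn rr rn.
by rewrite step K1 A0 mulr0 addr0.
Qed.

Lemma Im_circ a r t (de : R) : 0 < r -> de < complex.Im a - r -> de < complex.Im (circ a r t).
Proof.
move=> r0 h; have := Im_abs (circ a r t - a); rewrite absC_circ // ImB ler_norml => /andP[+ _].
lra.
Qed.

(** The divided difference of F at w is continuous, and holomorphic off w, so it has a primitive and
    integrates to 0 around the circle. What is left is F w times the winding integral. *)
Lemma cauchy_circle F a r w (de : R) : 0 < r -> (forall z, ccont F z) ->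
  (forall z, de < complex.Im z -> holo_at F z) -> de < complex.Im a - r ->
  absC (w - a) < r ->
  path_int (kern a r F 0 w) 0 (2 * pi) = iC * RtoC (2 * pi) * F w.
Proof.
move=> r0 cF hF da wr.
have dw : de < complex.Im w.
  have := Im_abs (w - a); rewrite ImB ler_norml => /andP[+ _]; lra.
have cq z : ccont (divdiff w F) z.
  have [->|zw] := eqVneq z w; first by apply: divdiff_cont_at; exact: hF.
  exact: divdiff_cont_ne.
have [H dH] : exists H, forall z, de < complex.Im z -> cder H z (divdiff w F z).
  by apply: (ex_primitive (w := w)) => // z dz zw; apply: divdiff_holo_ne => //; exact: hF.
have c1 t : rccont (fun t => divdiff w F (circ a r t) * (iC * (circ a r t - a))) t.
  apply: rccontM; first by apply: rccont_comp (cq _); exact: rccont_circ.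
  apply: rccontM; first exact: rccont_cst.
  by apply: rccontB; [exact: rccont_circ|exact: rccont_cst].
have c2 t : rccont (fun t => iC * (circ a r t - a) / (circ a r t - w)) t.
  apply: rccont_div; last exact: circ_ne2.
    apply: rccontM; first exact: rccont_cst.
    by apply: rccontB; [exact: rccont_circ|exact: rccont_cst].
  by apply: rccontB; [exact: rccont_circ|exact: rccont_cst].
have Z : path_int (fun t => divdiff w F (circ a r t) * (iC * (circ a r t - a))) 0 (2 * pi) = 0.
  rewrite (path_int_FTC (G := fun t => H (circ a r t))) //; first by rewrite circ_2pi subrr.
  by move=> t _; apply: lder_comp (lder_circ a r t) (dH _ _); exact: Im_circ.
have -> : kern a r F 0 w = fun t => divdiff w F (circ a r t) * (iC * (circ a r t - a))
    + F w * (iC * (circ a r t - a) / (circ a r t - w)).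
  apply/funext => t; have cw := circ_ne2 t r0 wr.
  rewrite divdiff_ne; last by rewrite -subr_eq0.
  by rewrite /kern expr0 mul1r; field.
rewrite path_intD //; last by move=> t; apply: rccontM => //; exact: rccont_cst.
by rewrite Z add0r path_intZ // path_int_circ_winding // mulrC.
Qed.

Lemma ccont_clip (m : R) z : ccont (fun z => Complex (complex.Re z) (Num.max (complex.Im z) m)) z.
Proof.
move=> e e0; exists e => // x; apply: le_lt_trans.
rewrite -(@ler_pXn2r _ 2) ?nnegrE ?absC_ge0 // !absC_sqr !ReB !ImB /= lerD2l.
rewrite -(real_normK (num_real (_ - _))) -[leRHS](real_normK (num_real _)).
rewrite ler_pXn2r ?nnegrE //.
have [h1|h1] := leP (complex.Im x) m; have [h2|h2] := leP (complex.Im z) m.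
- by rewrite subrr normr0.
- rewrite !ler0_norm; lra.
- rewrite !ger0_norm; lra.
- by [].
Qed.

(** Path integrals ask for continuity on the whole plane. Replacing Im z by max(Im z, m) provides it
    without changing f on the half-plane Im z >= m. *)
Lemma holo_clip f (de m : R) : (forall z, de < complex.Im z -> holo_at f z) -> de < m ->
  exists g, [/\ forall z, ccont g z, forall z, m < complex.Im z -> holo_at g z &
    forall z, m <= complex.Im z -> g z = f z].
Proof.
move=> hf dm; pose cl z := Complex (complex.Re z) (Num.max (complex.Im z) m).
have clE z : m <= complex.Im z -> cl z = z.
  by case: z => x y /= my; rewrite /cl /= max_l.
exists (fun z => f (cl z)); split => z.
- apply: (ccont_comp (ccont_clip m z)); apply: holo_cont; apply: hf => /=.
  by rewrite lt_max dm orbT.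
- move=> mz; have r0 : 0 < complex.Im z - m by rewrite subr_gt0.
  apply: (holo_local r0 _ (hf z (lt_trans dm mz))) => x xz; rewrite clE //.
  have := Im_abs (x - z); rewrite ImB ler_norml => /andP[+ _]; lra.
- by move=> /clE ->.
Qed.

Lemma ccont_bounded_on (g : R -> R) (a b : R) : a <= b -> (forall t, rcont g t) ->
  exists M, forall t, a <= t <= b -> g t <= M.
Proof.
have key (T : realType) (f : T -> T) (u v : T) : u <= v -> (forall t, rcont f t) ->
    exists M, forall t, u <= t <= v -> f t <= M.
  move=> uv cf.
  have cf' : {within `[u, v], continuous f}.
    by apply: continuous_subspaceT => t; apply/rcontP.
  have [c _ hc] := EVT_max uv cf'; exists (f c) => t tt; apply: hc; by rewrite in_itv.
exact: key.
Qed.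

Lemma circ_bounded F a r : (forall z, ccont F z) ->
  exists M, forall t, between 0 (2 * pi) t -> absC (F (circ a r t)) <= M.
Proof.
move=> cF.
have cc t : rccont (fun t => F (circ a r t)) t by apply: rccont_comp (cF _); exact: rccont_circ.
have pi20 : (0 : R) <= 2 * pi by rewrite mulr_ge0 // pi_ge0.
have [M hM] := ccont_bounded_on pi20 (fun t => rccont_abs (cc t)).
by exists M => t; rewrite between_le // => /hM.
Qed.

Lemma absC_2pi : absC (iC * RtoC (2 * pi)) = 2 * pi.
Proof. by rewrite absCM absC_i mul1r absC_R ger0_norm // mulr_ge0 // pi_ge0. Qed.

Lemma cauchy_bound F a r w M (de : R) : 0 < r -> (forall z, ccont F z) ->
  (forall z, de < complex.Im z -> holo_at F z) -> de < complex.Im a - r ->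
  (forall t, between 0 (2 * pi) t -> absC (F (circ a r t)) <= M) ->
  absC (w - a) < r -> absC (F w) <= 2 * (M * r / (r - absC (w - a))).
Proof.
move=> r0 cF hF da hM wr.
have := kern_bound r0 (fun t => cF (circ a r t)) 0 hM wr.
rewrite (cauchy_circle r0 cF hF da wr) absCM absC_2pi expr0 mul1r.
by rewrite [leLHS]mulrC ler_pM2r // mulr_gt0 // pi_gt0.
Qed.

(** Removable singularity. The Cauchy integrals L n satisfy L n z - L n a = (z - a) * L n.+1 z and L
    0 = f near a, so the divided difference is L 1, and its own slope at a is the continuous
    function L 2. *)
Lemma divdiff_holo f a (de : R) : de < complex.Im a ->
  (forall z, de < complex.Im z -> holo_at f z) -> holo_at (divdiff a f) a.
Proof.
move=> da hf; pose m := (de + complex.Im a) / 2.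
have dm : de < m by rewrite /m; lra.
have ma : m < complex.Im a by rewrite /m; lra.
have [F [cF hF FE]] := holo_clip hf dm.
pose r := (complex.Im a - m) / 2.
have r0 : 0 < r by rewrite divr_gt0 // subr_gt0.
have mr : m < complex.Im a - r by rewrite /r; lra.
have cFc t : ccont F (circ a r t) by exact: cF.
have near_m z : absC (z - a) < r -> m <= complex.Im z.
  move=> za; have := Im_abs (z - a); rewrite ImB ler_norml => /andP[+ _]; lra.
pose c := iC * RtoC (2 * pi).
have c0 : c != 0 by rewrite -absC_gt0 absC_2pi mulr_gt0 // pi_gt0.
pose L n z := c^-1 * path_int (kern a r F n z) 0 (2 * pi).
have aa : absC (a - a) < r by rewrite subrr absC0.
have LS n z : absC (z - a) < r -> L n z - L n a = (z - a) * L n.+1 z.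
  by move=> zr; rewrite /L (kern_step r0 cFc n zr); ring.
have [M hM] := circ_bounded a r cF.
have cL n : ccont (L n) a.
  pose K := absC c^-1 * (2 * (M * r / (r ^+ n.+1 * (r / 2))) * (2 * pi)).
  have M0 : 0 <= M by apply: le_trans (hM _ (between_l _ _)); exact: absC_ge0.
  have rn : 0 < r ^+ n.+1 by rewrite exprn_gt0.
  have LB z : absC (z - a) < r / 2 -> absC (L n.+1 z) <= K.
    move=> zr; have zr' : absC (z - a) < r by lra.
    rewrite /L absCM; apply: ler_wpM2l; first exact: absC_ge0.
    apply: le_trans (kern_bound r0 cFc n.+1 hM zr') _.
    apply: ler_wpM2r; first by rewrite mulr_ge0 // pi_ge0.
    apply: ler_wpM2l => //; apply: ler_wpM2l; first by rewrite mulr_ge0 // ltW.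
    rewrite lef_pV2 ?posrE ?mulr_gt0 ?divr_gt0 ?subr_gt0 //.
    apply: ler_wpM2l; first exact: ltW.
    lra.
  have K0 : 0 <= K by apply: le_trans (LB a _); rewrite ?absC_ge0 // subrr absC0 divr_gt0.
  have K1 : 0 < K + 1 by rewrite ltr_wpDl.
  move=> e e0; exists (Num.min (r / 2) (e / (K + 1))).
    by rewrite lt_min (divr_gt0 r0) // divr_gt0.
  move=> z; rewrite lt_min => /andP[z1 z2].
  rewrite LS; last by lra.
  rewrite absCM; apply: (@le_lt_trans _ _ (absC (z - a) * K)).
    by apply: ler_wpM2l; [exact: absC_ge0|exact: LB].
  move: z2; rewrite ltr_pdivlMr //; apply: le_lt_trans.
  by apply: ler_wpM2l; [exact: absC_ge0|lra].
have Fz z : absC (z - a) < r -> L 0%N z = F z.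
  by move=> zr; rewrite /L (cauchy_circle r0 cF hF mr zr) mulrA mulVf // mul1r.
have dqL z : absC (z - a) < r -> z != a -> divdiff a f z = L 1%N z.
  move=> zr za; rewrite divdiff_ne // -!FE ?near_m // -!Fz // LS //.
  by rewrite mulrC mulKf // subr_eq0.
(* At a itself the two functions agree because both are continuous there and agree at nearby
   points. *)
have dqLa : divdiff a f a = L 1%N a.
  apply: (ccont_limit_eq r0 (divdiff_cont_at (hf a da)) (cL 1%N)) => d d0.
  pose h := Num.min (d / 2) (r / 2).
  have h0 : 0 < h by rewrite lt_min; apply/andP; split; exact: divr_gt0.
  have hd : h < d by rewrite /h gt_min; apply/orP; left; lra.
  have hr : h < r by rewrite /h gt_min; apply/orP; right; lra.
  have E : absC (a + RtoC h - a) = h by rewrite addrAC subrr add0r absC_R gtr0_norm.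
  exists (a + RtoC h); first by rewrite E.
  apply: dqL; first by rewrite E.
  by rewrite -subr_eq0 -absC_eq0 E gt_eqF.
apply: (holo_local (g := L 1%N) r0).
  by move=> z zr; have [->|za] := eqVneq z a; [exact: dqLa|exact: dqL].
apply: (@cder_holo _ _ (L 2%N a)); exists (L 2%N); split => //.
by exists r => // z zr; rewrite LS // mulrC.
Qed.

Lemma divdiff_entire f a : entire f -> entire (divdiff a f).
Proof.
move=> ef z; have [->|za] := eqVneq z a; last exact: divdiff_holo_ne.
apply: (@divdiff_holo f a (complex.Im a - 1)) => //; lra.
Qed.

(* If the zeros accumulate at [a], all iterated divided differences of [E] vanish there,
   so that E(w) = (w - a)^n D_n(w) with D_n bounded. *)
Lemma zero_isolated E a w : entire E -> absC (w - a) <= 1 / 2 -> E w != 0 ->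
  exists2 d : R, 0 < d & forall z, z != a -> absC (z - a) < d -> E z != 0.
Proof.
move=> eE wa Ew; apply: contrapT => /forall2NP nd.
have acc (d : R) : 0 < d -> exists z, [/\ z != a, absC (z - a) < d & E z = 0].
  move=> d0; have [//|/existsNP[z]] := nd d.
  by move=> /not_implyP[za] /not_implyP[zd] /negP/negPn/eqP Ez; exists z.
pose D n := iter n (divdiff a) E.
have eD n : entire (D n) by elim: n => [|n IH] //; exact: divdiff_entire.
have [n0 nz] : (forall n, D n a = 0) /\ (forall n z, z != a -> E z = 0 -> D n z = 0).
  have H n : D n a = 0 /\ (forall z, z != a -> E z = 0 -> D n z = 0).
    have base m : (forall z, z != a -> E z = 0 -> D m z = 0) -> D m a = 0.
      move=> hm; apply: (ccont_limit_eq (r := 1) ltr01 (holo_cont (eD m a)) (@ccont_cst 0 a)).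
      by move=> d /acc[z [za zd Ez]]; exists z => //; exact: hm.
    elim: n => [|n [IH1 IH2]]; first by split => //; exact: base.
    have h z : z != a -> E z = 0 -> D n.+1 z = 0.
      by move=> za Ez; rewrite /D iterS -/(D n) divdiff_ne // IH1 IH2 // subr0 mul0r.
    by split => //; exact: base.
  by split => n; have [] := H n.
have ED n z : E z = (z - a) ^+ n * D n z.
  elim: n => [|n ->]; first by rewrite mul1r.
  rewrite exprSr -mulrA; congr (_ * _).
  by rewrite /D iterS -/(D n) mulrC divdiffE n0 subr0.
have [M hM] := circ_bounded a 1 (fun z => holo_cont (eE z)).
have w1 : absC (w - a) < 1 by lra.
suff : absC (E w) <= 0 by rewrite le_eqVlt absC_eq0 (negbTE Ew) ltNge absC_ge0.
apply: (@le_geo0 _ (absC (w - a)) (2 * (M * 1 / (1 - absC (w - a))))).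
  by rewrite absC_ge0.
move=> n; rewrite (ED n) absCM absCX mulrC; apply: ler_wpM2r; first by rewrite exprn_ge0 ?absC_ge0.
apply: (@cauchy_bound (D n) a 1 w M (complex.Im a - 2)) => //; try lra.
- by move=> z; apply: holo_cont; exact: eD.
- by move=> z _; exact: eD.
- move=> t tt; have := hM t tt; rewrite (ED n) absCM absCX absC_circ // expr1n mul1r; exact.
Qed.

(** * Real and complex integrals over the line *)

Definition mfun (T : realType) (f : T -> T) :=
  measurable_fun setT (f : measurableTypeR T -> measurableTypeR T).

Section real_integrals.
Variable T : realType.
Local Notation mu := (@lebesgue_measure T).
Implicit Types f g : T -> T.

Definition nnint f : \bar T := (\int[mu]_x (f x)%:E)%E.

Lemma nnint_le f g : mfun f -> mfun g ->
  (forall x, 0 <= f x) -> (forall x, f x <= g x) -> (nnint f <= nnint g)%E.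
Proof.
move=> mf mg f0 fg; apply: ge0_le_integral => //.
- by move=> x _; rewrite lee_fin.
- exact/measurable_EFinP.
- exact/measurable_EFinP.
- by move=> x _; rewrite lee_fin.
Qed.

Lemma nnintD f g : mfun f -> mfun g ->
  (forall x, 0 <= f x) -> (forall x, 0 <= g x) ->
  nnint (fun x => f x + g x) = (nnint f + nnint g)%E.
Proof.
move=> mf mg f0 g0; rewrite /nnint -ge0_integralD //.
- by move=> x _; rewrite lee_fin.
- exact/measurable_EFinP.
- by move=> x _; rewrite lee_fin.
- exact/measurable_EFinP.
Qed.

Lemma nnintZ f (k : T) : mfun f -> (forall x, 0 <= f x) -> 0 <= k ->
  nnint (fun x => k * f x) = (k%:E * nnint f)%E.
Proof.
move=> mf f0 k0; rewrite /nnint -ge0_integralZl_EFin //.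
- by move=> x _; rewrite lee_fin.
- exact/measurable_EFinP.
Qed.

Lemma nnintZ_le f (k M : T) : mfun f -> (forall x, 0 <= f x) -> 0 <= k ->
  (nnint f <= M%:E)%E -> (nnint (fun x => (k * f x)%R) <= (k * M)%:E)%E.
Proof.
move=> mf f0 k0 fM; rewrite nnintZ // EFinM; by apply: lee_wpmul2l.
Qed.

Lemma nnint_integrable f (M : T) : mfun f -> (forall x, 0 <= f x) ->
  (nnint f <= M%:E)%E -> mu.-integrable setT (EFin \o f).
Proof.
move=> mf f0 fM; apply/integrableP; split; first exact/measurable_EFinP.
apply: le_lt_trans (ltry M); apply: le_trans fM; rewrite /nnint.
by under eq_integral => x _ do rewrite /= ger0_norm //.
Qed.

Lemma nnint_Rintegral f : (forall x, 0 <= f x) -> mu.-integrable setT (EFin \o f) ->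
  nnint f = (\int[mu]_x f x)%:E.
Proof.
by move=> f0 fi; rewrite /Rintegral fineK //; exact: integrable_fin_num.
Qed.

Lemma int_le_abs f g : mfun f -> (forall x, `|f x| <= g x) ->
  mu.-integrable setT (EFin \o g) -> mu.-integrable setT (EFin \o f).
Proof.
move=> mf fg; apply: le_integrable => //; first exact/measurable_EFinP.
by move=> x _ /=; rewrite lee_fin; apply: le_trans (fg x) (ler_norm _).
Qed.

Lemma Rint_abs_le f g (M : T) : mfun f -> mfun g ->
  (forall x, `|f x| <= g x) -> (nnint g <= M%:E)%E -> `|\int[mu]_x f x| <= M.
Proof.
move=> mf mg fg gM; have g0 x : 0 <= g x by apply: le_trans (fg x).
have gi := nnint_integrable mg g0 gM.
have fi := int_le_abs mf fg gi.
apply: le_trans (le_normr_Rintegral _ fi) _ => //.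
have : \int[mu]_x `|f x| <= \int[mu]_x g x.
  apply: le_Rintegral => //.
  apply: (int_le_abs (g := g)) => //; first exact: measurableT_comp.
  by move=> x; rewrite normr_id.
move/le_trans; apply; rewrite -lee_fin -nnint_Rintegral //.
Qed.

Lemma ae_imp (P Q : measurableTypeR T -> Prop) : (forall x, P x -> Q x) ->
  {ae mu, forall x, P x} -> {ae mu, forall x, Q x}.
Proof.
move=> PQ [N [mN N0 sN]]; exists N; split => // x nQ; apply: sN => Px; apply: nQ.
exact: PQ.
Qed.

Lemma fatou_real (f : nat -> T -> T) (f0 : T -> T) (M : T) :
  (forall n, mfun (f n)) -> mfun f0 ->
  (forall n x, 0 <= f n x) -> (forall x, 0 <= f0 x) ->
  {ae mu, forall x, f n x @[n --> \oo] --> f0 x} ->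
  (forall n, nnint (f n) <= M%:E)%E -> (nnint f0 <= M%:E)%E.
Proof.
move=> mf mf0 fn0 f00 cv fM.
have mF n : measurable_fun setT ((fun x => (f n x)%:E) : measurableTypeR T -> \bar T).
  by apply/measurable_EFinP; exact: mf.
have F0 n x : [set: measurableTypeR T] x -> (0 <= (f n x)%:E)%E by move=> _; rewrite lee_fin.
have fat := fatou mu measurableT mF F0.
apply: (@le_trans _ _ (\int[mu]_x limn_einf (fun n => (f n x)%:E))%E).
  apply: ae_ge0_le_integral => //.
  - by move=> x _; rewrite lee_fin.
  - exact/measurable_EFinP.
  - move=> x _; rewrite limn_einf_lim; apply: lime_ge; first exact: is_cvg_einfs.
    by apply: nearW => n; apply: le_ereal_inf_tmp => _ [m /= nm <-]; rewrite lee_fin.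
  - rewrite /limn_einf; apply: measurableT_comp => //.
    by apply: measurable_fun_limn_esup => n; apply: measurableT_comp => //.
  - apply: ae_imp cv => x fx _.
    have fx' : (f n x)%:E @[n --> \oo] --> (f0 x)%:E by apply: (cvg_comp _ _ fx); exact: cvg_id.
    rewrite is_cvg_limn_einfE; last by apply/cvg_ex; exists (f0 x)%:E.
    by have /cvg_lim -> := fx'.
apply: le_trans fat _; rewrite limn_einf_lim.
apply: lime_le; first exact: is_cvg_einfs.
by apply: nearW => n; apply: le_trans (fM n); apply: ereal_inf_lbound; exists n => /=.
Qed.

Lemma dct_real (f : nat -> T -> T) (f0 G : T -> T) :
  (forall n, mfun (f n)) -> mfun f0 ->
  {ae mu, forall x, f n x @[n --> \oo] --> f0 x} ->
  mu.-integrable setT (EFin \o G) -> (forall n x, `|f n x| <= G x) ->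
  mu.-integrable setT (EFin \o f0) /\
  \int[mu]_x f n x @[n --> \oo] --> \int[mu]_x f0 x.
Proof.
move=> mf mf0 cv iG fG.
have [|||||i0 _ c] := @dominated_convergence _ _ _ mu setT measurableT
  (fun n => EFin \o f n) (EFin \o f0) (EFin \o G).
- by move=> n; apply/measurable_EFinP; exact: mf.
- exact/measurable_EFinP.
- by apply: ae_imp cv => x fx _; apply: (cvg_comp _ _ fx); exact: cvg_id.
- exact: iG.
- by apply: aeW => x n _ /=; rewrite lee_fin.
split => //; apply: fine_cvg; rewrite fineK; first exact: c.
exact: integrable_fin_num.
Qed.

Definition clipr (c x : T) := Num.max (- c) (Num.min c x).

Lemma clipr_le c x : 0 <= c -> `|clipr c x| <= c.
Proof.
move=> c0; rewrite ler_norml; apply/andP; split; first by rewrite le_max lexx.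
by rewrite ge_max ge_min lexx andbT; lra.
Qed.

Lemma clipr_id c x : `|x| <= c -> clipr c x = x.
Proof. by rewrite ler_norml => /andP[h1 h2]; rewrite /clipr min_r // max_r. Qed.

Lemma clipr_dist c x : 0 <= c -> `|x - clipr c x| <= `|x|.
Proof.
move=> c0; rewrite /clipr.
have [h1|h1] := leP c x.
  have [h2|h2] := leP (- c) c; last by lra.
  by rewrite !ger0_norm; lra.
have [h2|h2] := leP (- c) x; first by rewrite subrr normr0.
by rewrite !ler0_norm; lra.
Qed.

Lemma measurable_clipr (f c : T -> T) : mfun f -> mfun c ->
  mfun (fun x => clipr (c x) (f x)).
Proof.
move=> mf mc; apply: measurable_maxr; first exact: measurable_funN.
exact: measurable_minr.
Qed.

(** A pointwise Cauchy-Schwarz bound: |g| is at most the geometric mean of a fixed weight G and of a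
    function phi that may change with g but has integral at most M. With G integrable this makes
    families of such g uniformly integrable. *)
Definition dominated (G : T -> T) (M : T) (g : T -> T) :=
  mfun g /\ exists phi : T -> T, [/\ mfun phi, forall x, 0 <= phi x,
    (nnint phi <= M%:E)%E & forall x, g x ^+ 2 <= phi x * G x].

Lemma amgm (a b g : T) : 0 <= a -> 0 <= b -> g ^+ 2 <= a * b -> `|g| <= a + b.
Proof.
move=> a0 b0 h; rewrite -(@ler_pXn2r _ 2) ?nnegrE ?addr_ge0 // real_normK ?num_real //.
by apply: le_trans h _; nra.
Qed.

Lemma dominated_integrable G M g : (forall x, 0 <= G x) -> mu.-integrable setT (EFin \o G) ->
  dominated G M g -> mu.-integrable setT (EFin \o g).
Proof.
move=> G0 iG [mg [phi [mphi phi0 phiM gG]]].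
apply: (int_le_abs (g := fun x => phi x + G x)) => //; first by move=> x; exact: amgm.
have := integrableD measurableT (nnint_integrable mphi phi0 phiM) iG.
by congr (integrable _ _ _).
Qed.

(** Clipping changes g only where |g| > c * G, and there g^2 <= phi * G forces |g| <= phi / c. *)
Lemma dominated_clip G M g (c : T) : (forall x, 0 <= G x) -> mfun G ->
  mu.-integrable setT (EFin \o G) -> dominated G M g -> 0 < c ->
  `|\int[mu]_x g x - \int[mu]_x clipr (c * G x) (g x)| <= M / c.
Proof.
move=> G0 mG iG dg c0; have ig := dominated_integrable G0 iG dg.
have [mg [phi [mphi phi0 phiM gG]]] := dg.
have mcG : mfun (fun x => c * G x).
  by apply: measurable_funM => //; exact: measurable_cst.
have mcl := measurable_clipr mg mcG.
have cG0 x : 0 <= c * G x by rewrite mulr_ge0 // ltW.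
have icG : mu.-integrable setT (EFin \o (fun x => c * G x)).
  have := integrableZl measurableT c iG; by congr (integrable _ _ _).
have icl : mu.-integrable setT (EFin \o (fun x => clipr (c * G x) (g x))).
  by apply: (int_le_abs (g := fun x => c * G x)) => // x; exact: clipr_le.
rewrite -RintegralB //.
apply: (Rint_abs_le (g := fun x => c^-1 * phi x)).
- exact: measurable_funB.
- by apply: measurable_funM => //; exact: measurable_cst.
- move=> x; have [h|h] := leP `|g x| (c * G x).
    by rewrite clipr_id // subrr normr0 mulr_ge0 // invr_ge0 ltW.
  apply: le_trans (clipr_dist _ (cG0 x)) _.
  rewrite mulrC ler_pdivlMr //.
  have gg := gG x; rewrite -(real_normK (num_real (g x))) in gg.
  (* Where G vanishes the domination forces g to vanish, so dividing by G is needed only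
     elsewhere. *)
  have [Gx|Gx] := eqVneq (G x) 0.
    move: gg; rewrite Gx mulr0 => gg.
    have -> : `|g x| = 0 by apply/eqP; rewrite -sqrf_eq0 eq_le gg sqr_ge0.
    by rewrite mul0r.
  have Gp : 0 < G x by rewrite lt_def Gx G0.
  rewrite -(ler_pM2r Gp); apply: le_trans gg; rewrite expr2 -mulrA.
  by apply: ler_wpM2l => //; exact: ltW.
- rewrite nnintZ ?invr_ge0 ?(ltW c0) // mulrC EFinM.
  by apply: lee_wpmul2l => //; rewrite lee_fin invr_ge0 ltW.
Qed.

Lemma clipr_cvg (c : T) (u : nat -> T) (l : T) : u n @[n --> \oo] --> l ->
  clipr c (u n) @[n --> \oo] --> clipr c l.
Proof.
move=> ul; have ct : {for l, continuous (clipr c)}.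
  apply: continuous_max; first exact: cst_continuous.
  apply: continuous_min; first exact: cst_continuous.
  exact: cvg_id.
exact: (cvg_comp _ _ ul ct).
Qed.

(* Convergence of integrals without a common integrable bound: by [dominated_clip] the
   part of [g n] exceeding [c * G] contributes at most [M / c], uniformly in [n]. *)
Lemma dominated_limit G M (g : nat -> T -> T) (g0 : T -> T) :
  (forall x, 0 <= G x) -> mfun G -> mu.-integrable setT (EFin \o G) ->
  (forall n, dominated G M (g n)) -> dominated G M g0 ->
  {ae mu, forall x, g n x @[n --> \oo] --> g0 x} ->
  \int[mu]_x g n x @[n --> \oo] --> \int[mu]_x g0 x.
Proof.
move=> G0 mG iG dg dg0 cv; apply/cvgrPdist_le => e e0.
have M0 : 0 <= M.
  have [_ [phi [mphi phi0 phiM _]]] := dg0.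
  rewrite -lee_fin; apply: le_trans phiM; apply: integral_ge0 => x _; by rewrite lee_fin.
pose c := (M + 1) * 3 / e.
have c0 : 0 < c by rewrite divr_gt0 // mulr_gt0 // ltr_wpDl.
have Mc : M / c <= e / 3.
  have Ec : e / 3 * c = M + 1 by rewrite /c; field; rewrite gt_eqF.
  by rewrite ler_pdivrMr // Ec; lra.
have mcG : mfun (fun x => c * G x).
  by apply: measurable_funM => //; exact: measurable_cst.
have icG : mu.-integrable setT (EFin \o (fun x => c * G x)).
  have := integrableZl measurableT c iG; by congr (integrable _ _ _).
have [_ /cvgrPdist_le cl] := @dct_real (fun n x => clipr (c * G x) (g n x))
  (fun x => clipr (c * G x) (g0 x)) (fun x => c * G x)
  (fun n => measurable_clipr (dg n).1 mcG) (measurable_clipr dg0.1 mcG)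
  (ae_imp (fun x => @clipr_cvg (c * G x) _ _) cv) icG
  (fun n x => clipr_le _ (mulr_ge0 (ltW c0) (G0 x))).
have e3 : 0 < e / 3 by rewrite divr_gt0.
have := cl _ e3; apply: filterS => n h.
have h1 := le_trans (dominated_clip G0 mG iG (dg n) c0) Mc.
have h2 := le_trans (dominated_clip G0 mG iG dg0 c0) Mc.
move: h h1 h2; rewrite !ler_norml => /andP[? ?] /andP[? ?] /andP[? ?].
apply/andP; split; lra.
Qed.

(** Twice the integral over the half-line, by evenness; the primitive there is atan(x / y) / y. *)
Lemma nnint_cauchy (y : T) : 0 < y -> nnint (fun x => (x ^+ 2 + y ^+ 2)^-1) = (pi / y)%:E.
Proof.
move=> y0; have yn0 : y != 0 by rewrite gt_eqF.
have p0 (x : T) : 0 < x ^+ 2 + y ^+ 2 by rewrite ltr_wpDl ?sqr_ge0 // exprn_gt0.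
pose f (x : T) := (x ^+ 2 + y ^+ 2)^-1.
have cf : continuous f.
  move=> x; apply: cvgV; first by rewrite gt_eqF.
  by apply: cvgD; [exact: exprn_continuous|exact: cvg_cst].
rewrite /nnint ge0_symfun_integralT //; last 2 first.
- by move=> x; rewrite invr_ge0 ltW.
- by move=> x /=; rewrite sqrrN.
pose F (x : T) := y^-1 * atan (y^-1 * x).
have dF (x : T) : is_derive x 1 F (f x).
  apply/rderP; rewrite /f.
  have h1 : is_derive x 1 (fun x : T => y^-1 * x) y^-1.
    by have := @is_deriveZ _ _ _ id y^-1 x 1 1 (is_derive_id _ _); rewrite /GRing.scale /= mulr1.
  have h2 : is_derive x 1 (fun x : T => atan (y^-1 * x)) ((1 + (y^-1 * x) ^+ 2)^-1 * y^-1).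
    exact: (@is_derive1_comp _ (@atan T) (fun x : T => y^-1 * x)).
  have h3 := @is_deriveZ _ _ _ (fun x : T => atan (y^-1 * x)) y^-1 x 1 _ h2.
  apply/rderP; apply: is_derive_eq h3 _.
  rewrite /GRing.scale /=; field.
  by rewrite yn0 /= gt_eqF //; have := p0 x; lra.
rewrite -set_itvcy (@ge0_continuous_FTC2y _ f F 0 (y^-1 * (pi / 2))).
- rewrite /F mulr0 atan0 mulr0 -EFinB -EFinM; congr (_%:E); by field.
- by move=> x _; rewrite invr_ge0 ltW.
- exact: continuous_subspaceT.
- apply: cvgM; first exact: cvg_cst.
  apply: (cvg_comp _ _ _ (@cvgy_atan T)).
  apply/cvgryPge => A.
  by apply: filterS (nbhs_pinfty_ge (num_real (y * A))) => x; rewrite ler_pdivlMl.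
- by move=> x _; have [] := dF x.
- apply: cvg_at_right_filter; apply: differentiable_continuous; apply/derivable1_diffP.
  by have [] := dF 0.
- by move=> x _; rewrite derive1E; have [_] := dF x.
Qed.

End real_integrals.

Section real_measurability.
Variable T : realType.
Local Notation mu := (@lebesgue_measure T).
Implicit Types f g : T -> T.

Lemma mfun_cont f : (forall x, rcont f x) -> mfun f.
Proof. by move=> cf; apply: continuous_measurable_fun => x; apply/rcontP. Qed.

Lemma mfun_cst (c : T) : mfun (fun=> c).
Proof. exact: measurable_cst. Qed.

Lemma mfunD f g : mfun f -> mfun g -> mfun (fun x => f x + g x).
Proof. exact: measurable_funD. Qed.

Lemma mfunB f g : mfun f -> mfun g -> mfun (fun x => f x - g x).
Proof. exact: measurable_funB. Qed.

Lemma mfunM f g : mfun f -> mfun g -> mfun (fun x => f x * g x).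
Proof. exact: measurable_funM. Qed.

Lemma mfunN f : mfun f -> mfun (fun x => - f x).
Proof. exact: measurable_funN. Qed.

Lemma mfun_sqr f : mfun f -> mfun (fun x => f x ^+ 2).
Proof. exact: measurable_funX. Qed.

(** Inversion is discontinuous at 0, where its value is 0 by convention. It is the pointwise limit
    of the continuous functions x / (x^2 + 1/(n + 1)), which also vanish at 0. *)
Lemma mfunV f : mfun f -> mfun (fun x => (f x)^-1).
Proof.
move=> mf.
have key : mfun (fun x : T => x^-1).
  apply: (@measurable_fun_cvg _ _ _ setT (fun n (x : T) => x / (x ^+ 2 + n.+1%:R^-1))).
    move=> n; apply: continuous_measurable_fun => x.
    have p : 0 < x ^+ 2 + n.+1%:R^-1 by rewrite ltr_wpDl ?sqr_ge0 // invr_gt0.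
    apply: cvgM; first exact: cvg_id.
    apply: cvgV; first by rewrite gt_eqF.
    by apply: cvgD; [exact: exprn_continuous|exact: cvg_cst].
  move=> x _; have [->|x0] := eqVneq x 0.
    rewrite invr0; under eq_fun do rewrite mul0r; exact: cvg_cst.
  rewrite (_ : x^-1 = x / (x ^+ 2 + 0)); last by field.
  apply: cvgM; first exact: cvg_cst.
  apply: cvgV; first by rewrite addr0 expf_neq0.
  by apply: cvgD; [exact: cvg_cst|exact: cvg_harmonic].
exact: (measurableT_comp key mf).
Qed.

Lemma seq_cvgP (u : nat -> T) (l : T) : u n @[n --> \oo] --> l <->
  (forall e : T, 0 < e -> exists N, forall n, (N <= n)%N -> `|u n - l| < e).
Proof.
split.
  move=> /cvgrPdist_lt h e e0; have [N _ hN] := h e e0.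
  by exists N => n /hN; rewrite distrC.
move=> h; apply/cvgrPdist_lt => e e0; have [N hN] := h e e0.
by exists N => // n /= /hN; rewrite distrC.
Qed.

Lemma FTC2_real (F f : T -> T) (a b : T) : a < b -> (forall t, rder F t (f t)) ->
  (forall t, rcont f t) -> (\int[mu]_(x in `[a, b]) (f x)%:E)%E = (F b - F a)%:E.
Proof.
move=> ab dF cf; rewrite EFinB; apply: continuous_FTC2 => //.
- by apply: continuous_subspaceT => t; apply/rcontP.
- have cF t : {for t, continuous F} by apply/rcontP; apply: rder_cont (dF t).
  split.
  + by move=> x _; have /rderP[] := dF x.
  + by apply: cvg_at_right_filter; exact: cF.
  + by apply: cvg_at_left_filter; exact: cF.
- by move=> x _; rewrite derive1E; have /rderP[_] := dF x.
Qed.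

Lemma integral_const_le (f phi : T -> T) (a b c M : T) : a <= b -> mfun f -> mfun phi ->
  (forall x, 0 <= phi x) -> (nnint phi <= M%:E)%E -> 0 <= c ->
  (forall x, a <= x <= b -> `|f x| <= c * (phi x + 1)) ->
  (\int[mu]_(x in `[a, b]) `|(f x)%:E| <= (c * (M + (b - a)))%:E)%E.
Proof.
move=> ab mf mphi phi0 phiM c0 fphi.
have mab : measurable (`[a, b] : set (measurableTypeR T)) by exact: measurable_itv.
have mphi' : measurable_fun (`[a, b] : set (measurableTypeR T)) (fun x : measurableTypeR T => (phi x)%:E).
  by apply/measurable_EFinP; apply: measurable_funTS.
have m1 : measurable_fun (`[a, b] : set (measurableTypeR T)) (fun x : measurableTypeR T => 1%:E : \bar T).
  exact: measurable_cst.
apply: (@le_trans _ _ (\int[mu]_(x in `[a, b]) (c%:E * ((phi x)%:E + 1%:E)))%E).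
  apply: ge0_le_integral => //.
  - by apply: measurableT_comp => //; apply/measurable_EFinP; apply: measurable_funTS.
  - by apply: measurable_funeM; exact: emeasurable_funD.
rewrite ge0_integralZl_EFin //; last 2 first.
- by move=> x _; apply: adde_ge0; rewrite lee_fin.
- exact: emeasurable_funD.
rewrite ge0_integralD //; last by move=> x _; rewrite lee_fin.
rewrite (EFinM c); apply: lee_wpmul2l; first by rewrite lee_fin.
rewrite EFinD; apply: leeD.
  apply: le_trans phiM; apply: ge0_subset_integral => //.
  - exact/measurable_EFinP.
  - by move=> x _; rewrite lee_fin.
have /= -> := @integral_cst _ _ _ mu _ mab 1%E.
have := lebesgue_measure_itv `[a, b]%R; rewrite mul1e /= => ->.
by case: ifP => _; rewrite // lee_fin subr_ge0.
Qed.

(** Turns an L^1 bound on phi into control of a primitive over a short interval. It will be applied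
    with phi = |A|^2 for a Hardy function A. *)
Lemma primitive_increment_le (F f phi : T -> T) (a b c M : T) : a <= b ->
  (forall t, rder F t (f t)) -> (forall t, rcont f t) -> mfun phi ->
  (forall x, 0 <= phi x) -> (nnint phi <= M%:E)%E -> 0 <= c ->
  (forall x, a <= x <= b -> `|f x| <= c * (phi x + 1)) ->
  `|F b - F a| <= c * (M + (b - a)).
Proof.
move=> ab dF cf mphi phi0 phiM c0 fphi.
have := integral_const_le ab (mfun_cont cf) mphi phi0 phiM c0 fphi.
have M0 : 0 <= M by rewrite -lee_fin; apply: le_trans phiM; apply: integral_ge0 => x _; rewrite lee_fin.
move: ab; rewrite le_eqVlt => /predU1P[<- _|ab].
  by rewrite !subrr normr0 addr0 mulr_ge0.
rewrite -lee_fin; apply: le_trans.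
have -> : (`|F b - F a|)%:E = `|(F b - F a)%:E|%E by [].
rewrite -(FTC2_real ab dF cf).
apply: le_abse_integral; first exact: measurable_itv.
by apply/measurable_EFinP; apply: measurable_funTS; exact: mfun_cont.
Qed.

Lemma full_line_integral (F f : T -> T) : (forall t, rder F t (f t)) -> (forall t, rcont f t) ->
  mu.-integrable setT (EFin \o f) ->
  F n.+1%:R - F (- n.+1%:R) @[n --> \oo] --> \int[mu]_x f x.
Proof.
move=> dF cf fi.
pose I n : set (measurableTypeR T) := `[(- n.+1%:R : T), n.+1%:R].
have mI n : measurable (I n) by exact: measurable_itv.
have mf := mfun_cont cf.
have mg n : mfun (f \_ (I n)).
  by apply/(measurable_restrictT _ (mI n)); apply: measurable_funTS.
have cv : {ae mu, forall x, (f \_ (I n)) x @[n --> \oo] --> f x}.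
  apply: aeW => x; apply/seq_cvgP => e e0.
  exists (Num.bound `|x : T|) => n hn.
  have xI : I n x.
    rewrite /I /= in_itv /= -ler_norml; apply: ltW.
    apply: lt_le_trans (archi_boundP (normr_ge0 (x : T))) _.
    by rewrite ler_nat ltnW.
  by rewrite patchE mem_set // subrr normr0.
have ifn : mu.-integrable setT (EFin \o (fun x => `|f x|)).
  by have := integrable_abse fi; congr (integrable _ _ _).
have gf n x : `|(f \_ (I n)) x| <= `|f x| by rewrite patchE; case: ifP; rewrite ?normr0.
have [_ lim] := dct_real mg mf cv ifn gf.
suff -> : (fun n => F n.+1%:R - F (- n.+1%:R)) = (fun n => \int[mu]_x (f \_ (I n)) x) by [].
apply/funext => n.
rewrite -Rintegral_mkcond /Rintegral (FTC2_real _ dF cf) //.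
by apply: lt_trans (_ : 0 < _); rewrite ?oppr_lt0.
Qed.

End real_measurability.

Notation mu := (@lebesgue_measure R).

(** * Complex-valued measurability, integrals and limits, taken componentwise *)

Definition cmeas (f : R -> C) := mfun (fun x => complex.Re (f x)) /\ mfun (fun x => complex.Im (f x)).

Definition cintble (f : R -> C) :=
  mu.-integrable setT (EFin \o (fun x => complex.Re (f x))) /\
  mu.-integrable setT (EFin \o (fun x => complex.Im (f x))).

Definition cint (f : R -> C) : C :=
  Complex (\int[mu]_x complex.Re (f x)) (\int[mu]_x complex.Im (f x)).

Definition sqn (f : R -> C) (x : R) : R := absC (f x) ^+ 2.

Lemma cmeas_cont f : (forall t, rccont f t) -> cmeas f.
Proof. by move=> cf; split; apply: mfun_cont => t; [exact: rccont_Re|exact: rccont_Im]. Qed.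

Lemma cmeas_cst c : cmeas (fun=> c).
Proof. by split; exact: mfun_cst. Qed.

Lemma cmeasD f g : cmeas f -> cmeas g -> cmeas (fun x => f x + g x).
Proof.
move=> [f1 f2] [g1 g2]; split.
  by rewrite (_ : (fun x => _) = fun x => complex.Re (f x) + complex.Re (g x));
    [exact: mfunD|apply/funext => x; rewrite ReD].
by rewrite (_ : (fun x => _) = fun x => complex.Im (f x) + complex.Im (g x));
    [exact: mfunD|apply/funext => x; rewrite ImD].
Qed.

Lemma cmeasM f g : cmeas f -> cmeas g -> cmeas (fun x => f x * g x).
Proof.
move=> [f1 f2] [g1 g2]; split.
  rewrite (_ : (fun x => _) = fun x => complex.Re (f x) * complex.Re (g x) - complex.Im (f x) * complex.Im (g x));
    last by apply/funext => x; rewrite ReM.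
  by apply: mfunB; exact: mfunM.
rewrite (_ : (fun x => _) = fun x => complex.Re (f x) * complex.Im (g x) + complex.Im (f x) * complex.Re (g x));
    last by apply/funext => x; rewrite ImM.
by apply: mfunD; exact: mfunM.
Qed.

Lemma cmeas_conj f : cmeas f -> cmeas (fun x => cconj (f x)).
Proof. by move=> [f1 f2]; split => //=; exact: mfunN. Qed.

Lemma cmeasB f g : cmeas f -> cmeas g -> cmeas (fun x => f x - g x).
Proof.
move=> mf mg; rewrite (_ : (fun x => _) = fun x => f x + (-1) * g x); last by apply/funext => x; rewrite mulN1r.
by apply: cmeasD => //; apply: cmeasM => //; exact: cmeas_cst.
Qed.

Lemma mfun_sqn f : cmeas f -> mfun (sqn f).
Proof.
move=> [f1 f2]; rewrite (_ : sqn f = fun x => complex.Re (f x) ^+ 2 + complex.Im (f x) ^+ 2);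
  last by apply/funext => x; rewrite /sqn absC_sqr.
by apply: mfunD; exact: mfun_sqr.
Qed.

Lemma sqn_ge0 f x : 0 <= sqn f x.
Proof. exact: sqr_ge0. Qed.

Lemma cmeasV f : cmeas f -> cmeas (fun x => (f x)^-1).
Proof.
move=> mf; have ms := mfunV (mfun_sqn mf).
rewrite (_ : (fun x => _) = fun x => cconj (f x) * RtoC (sqn f x)^-1).
  by apply: cmeasM; [exact: cmeas_conj|split => //; exact: mfun_cst].
apply/funext => x; rewrite /sqn RtoCV -mulC_conj.
have [->|fx] := eqVneq (f x) 0; first by rewrite cconj0 !mul0r invr0.
have cx : cconj (f x) != 0 by rewrite cconj_eq0.
by field; rewrite fx cx.
Qed.

Lemma cmeas_div f g : cmeas f -> cmeas g -> cmeas (fun x => f x / g x).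
Proof. by move=> mf mg; apply: cmeasM => //; exact: cmeasV. Qed.

Lemma cintble_le f (g : R -> R) : cmeas f -> (forall x, absC (f x) <= g x) ->
  mu.-integrable setT (EFin \o g) -> cintble f.
Proof.
move=> [f1 f2] fg ig; split; apply: (int_le_abs (g := g)) => // x; apply: le_trans (fg x).
  exact: Re_abs.
exact: Im_abs.
Qed.

Lemma cintD f g : cintble f -> cintble g -> cint (fun x => f x + g x) = cint f + cint g.
Proof.
move=> [f1 f2] [g1 g2]; apply: eqC => /=; rewrite ?ReD ?ImD /= -RintegralD //.
  by apply: eq_Rintegral => x _; rewrite ReD.
by apply: eq_Rintegral => x _; rewrite ImD.
Qed.

Lemma integrableZ_real (k : R) (f : R -> R) : mu.-integrable setT (EFin \o f) ->
  mu.-integrable setT (EFin \o (fun x => k * f x)).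
Proof. by move=> fi; have := integrableZl measurableT k fi; congr (integrable _ _ _). Qed.

Lemma integrableD_real (f g : R -> R) : mu.-integrable setT (EFin \o f) ->
  mu.-integrable setT (EFin \o g) -> mu.-integrable setT (EFin \o (fun x => f x + g x)).
Proof. by move=> fi gi; have := integrableD measurableT fi gi; congr (integrable _ _ _). Qed.

Lemma integrableB_real (f g : R -> R) : mu.-integrable setT (EFin \o f) ->
  mu.-integrable setT (EFin \o g) -> mu.-integrable setT (EFin \o (fun x => f x - g x)).
Proof. by move=> fi gi; have := integrableB measurableT fi gi; congr (integrable _ _ _). Qed.

Lemma cintbleD f g : cintble f -> cintble g -> cintble (fun x => f x + g x).
Proof.
move=> [f1 f2] [g1 g2]; split.
  have := integrableD_real f1 g1; congr (integrable _ _ _); apply/funext => x /=; by rewrite ReD.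
have := integrableD_real f2 g2; congr (integrable _ _ _); apply/funext => x /=; by rewrite ImD.
Qed.

Lemma cintbleZ (c : C) f : cintble f -> cintble (fun x => c * f x).
Proof.
move=> [f1 f2]; split.
  have := integrableB_real (integrableZ_real (complex.Re c) f1) (integrableZ_real (complex.Im c) f2).
  by congr (integrable _ _ _); apply/funext => x /=; rewrite ReM.
have := integrableD_real (integrableZ_real (complex.Re c) f2) (integrableZ_real (complex.Im c) f1).
by congr (integrable _ _ _); apply/funext => x /=; rewrite ImM.
Qed.

Lemma cintZ (c : C) f : cintble f -> cint (fun x => c * f x) = c * cint f.
Proof.
move=> [f1 f2]; apply: eqC; rewrite ?ReM ?ImM /= -!RintegralZl // -?RintegralB -?RintegralD //;
  try exact: integrableZ_real.
  by apply: eq_Rintegral => x _; rewrite ReM.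
by apply: eq_Rintegral => x _; rewrite ImM.
Qed.

Lemma cint_conj f : cintble f -> cint (fun x => cconj (f x)) = cconj (cint f).
Proof.
move=> [f1 f2]; apply: eqC => //=; rewrite -mulN1r -RintegralZl //.
by apply: eq_Rintegral => x _; rewrite mulN1r.
Qed.

Lemma cintble_conj f : cintble f -> cintble (fun x => cconj (f x)).
Proof.
move=> [f1 f2]; split => //.
have := integrableZ_real (-1) f2; congr (integrable _ _ _); apply/funext => x /=; by rewrite mulN1r.
Qed.

Lemma cint_eq f g : (forall x, f x = g x) -> cint f = cint g.
Proof. by move=> fg; congr cint; apply/funext. Qed.

Definition Ccvg (u : nat -> C) (l : C) := forall e : R, 0 < e ->
  exists N, forall n, (N <= n)%N -> absC (u n - l) < e.

Lemma Ccvg_Re u l : Ccvg u l -> complex.Re (u n) @[n --> \oo] --> (complex.Re l : R).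
Proof.
move=> h; apply: (proj2 (@seq_cvgP R _ _)) => e e0; have [N hN] := h e e0; exists N => n /hN.
by apply: le_lt_trans; rewrite -ReB Re_abs.
Qed.

Lemma Ccvg_Im u l : Ccvg u l -> complex.Im (u n) @[n --> \oo] --> (complex.Im l : R).
Proof.
move=> h; apply: (proj2 (@seq_cvgP R _ _)) => e e0; have [N hN] := h e e0; exists N => n /hN.
by apply: le_lt_trans; rewrite -ImB Im_abs.
Qed.

Lemma Ccvg_ReIm u l : complex.Re (u n) @[n --> \oo] --> (complex.Re l : R) ->
  complex.Im (u n) @[n --> \oo] --> (complex.Im l : R) -> Ccvg u l.
Proof.
move=> /(proj1 (@seq_cvgP R _ _)) h1 /(proj1 (@seq_cvgP R _ _)) h2 e e0.
have e2 : 0 < e / 2 by rewrite divr_gt0.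
have [N hN] := h1 _ e2; have [N' hN'] := h2 _ e2.
exists (maxn N N') => n; rewrite geq_max => /andP[/hN A /hN' B].
apply: le_lt_trans (absC_le _) _; rewrite ReB ImB; lra.
Qed.

Lemma Ccvg_sqn (u : nat -> C) l : Ccvg u l -> absC (u n) ^+ 2 @[n --> \oo] --> (absC l ^+ 2 : R).
Proof.
move=> ul; rewrite absC_sqr.
rewrite (_ : (fun n => _) = fun n => complex.Re (u n) ^+ 2 + complex.Im (u n) ^+ 2); last first.
  by apply/funext => n; rewrite absC_sqr.
have key (T : realType) (a b : nat -> T) (x y : T) : a n @[n --> \oo] --> x ->
    b n @[n --> \oo] --> y -> a n ^+ 2 + b n ^+ 2 @[n --> \oo] --> x ^+ 2 + y ^+ 2.
  by move=> ax bx; rewrite !expr2; under eq_fun do rewrite !expr2; apply: cvgD; exact: cvgM.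
apply: key; [exact: Ccvg_Re|exact: Ccvg_Im].
Qed.

Lemma Ccvg_cont (F : C -> C) (z : nat -> C) (a : C) : Ccvg z a -> ccont F a -> Ccvg (fun n => F (z n)) (F a).
Proof.
move=> za cF e e0; have [d d0 hd] := cF e e0; have [N hN] := za d d0.
by exists N => n /hN /hd.
Qed.

Definition cdom (G : R -> R) (M : R) (g : R -> C) :=
  cmeas g /\ exists phi : R -> R, [/\ mfun phi, forall x, 0 <= phi x,
    (nnint phi <= M%:E)%E & forall x, sqn g x <= phi x * G x].

Lemma cdom_Re G M g : cdom G M g -> dominated G M (fun x => complex.Re (g x)).
Proof.
move=> [[g1 g2] [phi [h1 h2 h3 h4]]]; split => //; exists phi; split => // x.
by apply: le_trans (h4 x); rewrite /sqn absC_sqr lerDl sqr_ge0.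
Qed.

Lemma cdom_Im G M g : cdom G M g -> dominated G M (fun x => complex.Im (g x)).
Proof.
move=> [[g1 g2] [phi [h1 h2 h3 h4]]]; split => //; exists phi; split => // x.
by apply: le_trans (h4 x); rewrite /sqn absC_sqr lerDr sqr_ge0.
Qed.

Lemma cdom_cintble G M g : (forall x, 0 <= G x) -> mu.-integrable setT (EFin \o G) ->
  cdom G M g -> cintble g.
Proof.
move=> G0 iG dg; split.
  exact: dominated_integrable G0 iG (cdom_Re dg).
exact: dominated_integrable G0 iG (cdom_Im dg).
Qed.

Lemma cdom_limit G M (g : nat -> R -> C) (g0 : R -> C) :
  (forall x, 0 <= G x) -> mfun G -> mu.-integrable setT (EFin \o G) ->
  (forall n, cdom G M (g n)) -> cdom G M g0 ->
  {ae mu, forall x, Ccvg (fun n => g n x) (g0 x)} ->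
  Ccvg (fun n => cint (g n)) (cint g0).
Proof.
move=> G0 mG iG dg dg0 cv; apply: Ccvg_ReIm => /=.
  apply: (dominated_limit G0 mG iG (fun n => cdom_Re (dg n)) (cdom_Re dg0)).
  by apply: ae_imp cv => x; exact: Ccvg_Re.
apply: (dominated_limit G0 mG iG (fun n => cdom_Im (dg n)) (cdom_Im dg0)).
by apply: ae_imp cv => x; exact: Ccvg_Im.
Qed.

(** A substitute for the Cauchy-Schwarz inequality: multiplying phi by d and G by 1/d leaves the
    hypothesis intact, so the two terms of the bound can be balanced. The factor 2 is for the two
    components. *)
Lemma cdom_abs_le (G phi : R -> R) (g : R -> C) (a b : R) : cmeas g -> mfun G -> mfun phi ->
  (forall x, 0 <= G x) -> (forall x, 0 <= phi x) ->
  (nnint phi <= a%:E)%E -> (nnint G <= b%:E)%E -> (forall x, sqn g x <= phi x * G x) ->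
  absC (cint g) <= 2 * (a + b).
Proof.
move=> [g1 g2] mG mphi G0 phi0 pa Gb gG.
have S : (nnint (fun x => (phi x + G x)%R) <= (a + b)%:E)%E.
  by rewrite nnintD // EFinD leeD.
have mS : mfun (fun x => phi x + G x) by exact: mfunD.
apply: le_trans (absC_le _) _; rewrite mulrDl mul1r; apply: lerD => /=; apply: Rint_abs_le S => // x;
  apply: amgm => //; apply: le_trans (gG x); rewrite /sqn absC_sqr.
  by rewrite lerDl sqr_ge0.
by rewrite lerDr sqr_ge0.
Qed.

(** * Hardy space functions *)

Definition hor (A : C -> C) (y : R) : R -> C := fun x => A (Complex x y).

Definition H2bound (A : C -> C) (M : R) := (forall z, 0 < complex.Im z -> holo_at A z) /\
  forall y : R, 0 < y -> (nnint (sqn (hor A y)) <= M%:E)%E.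

Lemma H2U_bound A : H2U A -> exists M, H2bound A M.
Proof. by move=> [hA [M hM]]; exists M; split. Qed.

Lemma H2bound_H2U A M : H2bound A M -> H2U A.
Proof. by move=> [hA hM]; split => //; exists M. Qed.

(** This is 1/|x - iy|^2, or pi / y times the Poisson kernel of the point iy. *)
Definition cauchyG (y x : R) : R := (x ^+ 2 + y ^+ 2)^-1.

Lemma cauchyG_gt0 (y x : R) : 0 < y -> 0 < x ^+ 2 + y ^+ 2.
Proof. by move=> y0; rewrite ltr_wpDl ?sqr_ge0 // exprn_gt0. Qed.

Lemma cauchyG_ge0 y x : 0 <= cauchyG y x.
Proof. by rewrite invr_ge0 addr_ge0 // sqr_ge0. Qed.

Lemma mfun_id (T : realType) : mfun (fun x : T => x).
Proof. exact: measurable_id. Qed.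

Lemma mfun_cauchyG y : mfun (cauchyG y).
Proof.
by apply: mfunV; apply: mfunD; [apply: mfun_sqr; exact: mfun_id|exact: mfun_cst].
Qed.

Lemma nnint_cauchyG y : 0 < y -> nnint (cauchyG y) = (pi / y)%:E.
Proof. exact: nnint_cauchy. Qed.

Lemma integrable_cauchyG y : 0 < y -> mu.-integrable setT (EFin \o cauchyG y).
Proof.
move=> y0; apply: (@nnint_integrable _ _ (pi / y)); [exact: mfun_cauchyG|exact: cauchyG_ge0|].
by rewrite nnint_cauchyG.
Qed.

Lemma absC_shift x y v : absC (Complex x y + iC * RtoC v) ^+ 2 = x ^+ 2 + (y + v) ^+ 2.
Proof. by rewrite absC_sqr ReD ImD ReM ImM /=; ring. Qed.

Lemma shift_neq0 z v : 0 <= complex.Im z -> 0 < v -> z + iC * RtoC v != 0.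
Proof.
case: z => x y /= y0 v0; rewrite -absC_gt0 lt_def absC_ge0 andbT -sqrf_eq0 absC_shift.
by rewrite gt_eqF // cauchyG_gt0 // ltr_wpDl.
Qed.

Lemma nnint_ge0 (T : realType) (f : T -> T) : (forall x, 0 <= f x) -> (0 <= nnint f)%E.
Proof. by move=> f0; apply: integral_ge0 => x _; rewrite lee_fin. Qed.

Lemma le_nat_eps (T : realType) (K e : T) : 0 < e -> exists n : nat, K / n.+1%:R < e.
Proof.
move=> e0; exists (Num.bound `|K / e|); rewrite ltr_pdivrMr //.
have h : K / e < (Num.bound `|K / e|).+1%:R.
  apply: le_lt_trans (ler_norm _) _; apply: lt_trans (archi_boundP (normr_ge0 _)) _.
  by rewrite ltr_nat.
by move: h; rewrite ltr_pdivrMr // mulrC.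
Qed.

Lemma Ccvg_close (u u' : nat -> C) (a b : C) (K : R) : Ccvg u a -> Ccvg u' b ->
  (forall n, absC (u n - u' n) <= K / n.+1%:R) -> a = b.
Proof.
move=> ua ub h; apply/eqP; rewrite -subr_eq0 -absC_eq0 eq_le absC_ge0 andbT.
apply/ler_addgt0Pl => e e0; rewrite addr0.
have e3 : 0 < e / 3 by rewrite divr_gt0.
have [N hN] := ua _ e3; have [N' hN'] := ub _ e3.
have [k hk] := le_nat_eps `|K| e3.
pose n := maxn k (maxn N N').
have A := hN n; have B := hN' n; have D := h n.
have {}A : absC (u n - a) < e / 3 by apply: A; rewrite /n !leq_max leqnn orbT.
have {}B : absC (u' n - b) < e / 3 by apply: B; rewrite /n !leq_max leqnn !orbT.
have {}D : absC (u n - u' n) < e / 3.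
  apply: le_lt_trans D _; apply: le_lt_trans hk.
  apply: (@le_trans _ _ (`|K| / n.+1%:R)).
    by apply: ler_wpM2r; [rewrite invr_ge0|exact: ler_norm].
  by apply: ler_wpM2l => //; rewrite lef_pV2 ?posrE // ler_nat ltnS leq_max leqnn.
have T1 := absC_tri (u n) a b; have T2 := absC_tri (u' n) (u n) b.
rewrite absCC in T1; rewrite (absCC a) in T1; rewrite absCC; lra.
Qed.

Section line_integrals.
Variables (A : C -> C) (M v : R).
Hypotheses (hA : H2bound A M) (v0 : 0 < v).

Let h z := A z / (z + iC * RtoC v).

Lemma line_M_ge0 : 0 <= M.
Proof. by rewrite -lee_fin; apply: le_trans (hA.2 1 ltr01); apply: nnint_ge0 => x; exact: sqn_ge0. Qed.

Lemma line_holo z : 0 < complex.Im z -> holo_at h z.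
Proof.
move=> z0; apply: holo_div; first exact: hA.1.
  by apply: holoD; [exact: holo_id|exact: holo_cst].
by apply: shift_neq0 => //; exact: ltW.
Qed.

Lemma line_rccont y t : 0 < y -> rccont (hor h y) t.
Proof. by move=> y0; apply: rccont_comp; [exact: rccont_hor|apply: holo_cont; exact: line_holo]. Qed.

Lemma line_rccontA y t : 0 < y -> rccont (hor A y) t.
Proof. by move=> y0; apply: rccont_comp; [exact: rccont_hor|apply: holo_cont; exact: hA.1]. Qed.

Lemma sqn_line y x : 0 < y -> sqn (hor h y) x = sqn (hor A y) x * cauchyG (y + v) x.
Proof.
move=> y0; rewrite /sqn /hor /h absCM absCV exprMn exprVn.
by rewrite /cauchyG -absC_shift.
Qed.

Lemma line_cdom y : 0 < y -> cdom (cauchyG (y + v)) M (hor h y).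
Proof.
move=> y0; split; first by apply: cmeas_cont => t; exact: line_rccont.
exists (sqn (hor A y)); split; [|exact: sqn_ge0|exact: hA.2|by move=> x; rewrite sqn_line].
by apply: mfun_sqn; apply: cmeas_cont => t; exact: line_rccontA.
Qed.

Lemma line_cintble y : 0 < y -> cintble (hor h y).
Proof.
move=> y0; apply: cdom_cintble (line_cdom y0); first exact: cauchyG_ge0.
by apply: integrable_cauchyG; rewrite addr_gt0.
Qed.

Lemma line_abs_le (n x y : R) : 0 < n -> n <= `|x| -> 0 < y ->
  absC (h (Complex x y)) <= n^-1 * (sqn (hor A y) x + 1).
Proof.
move=> n0 nx y0; rewrite /h absCM absCV mulrC.
have zn : n <= absC (Complex x y + iC * RtoC v).
  apply: le_trans nx _; rewrite -(@ler_pXn2r _ 2) ?nnegrE ?absC_ge0 // absC_shift.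
  by rewrite real_normK ?num_real // lerDl sqr_ge0.
apply: ler_pM; rewrite ?absC_ge0 ?invr_ge0 ?absC_ge0 //.
  by rewrite lef_pV2 ?posrE //; apply: lt_le_trans zn.
rewrite /sqn /hor; have := absC_ge0 (A (Complex x y)); move: (absC _) => a a0; nra.
Qed.

(* The vertical sides of the rectangle, averaged over [n, n + 1] and [-n-1, -n], are
   increments of a second primitive, so that no iterated integral is needed. *)
Lemma line_const (eta Y : R) : 0 < eta -> eta <= Y -> cint (hor h eta) = cint (hor h Y).
Proof.
(* Two levels below eta: each of the two successive integrations is preceded by a clipping that
   gives up part of the half-plane. *)
move=> eta0 etaY; pose m1 := eta / 3; pose m2 := 2 * eta / 3.
have [m10 m12 m2e] : [/\ 0 < m1, m1 < m2 & m2 < eta] by rewrite /m1 /m2; split; lra.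
have [g [cg hg gE]] := holo_clip line_holo m10.
have [H dH] : exists H, forall z, m1 < complex.Im z -> cder H z (g z).
  by apply: (ex_primitive (w := 0)) => // z mz _; exact: hg.
have [HH [cHH hHH HHE]] := holo_clip (fun z mz => cder_holo (dH z mz)) m12.
have [K dK] : exists K, forall z, m2 < complex.Im z -> cder K z (HH z).
  by apply: (ex_primitive (w := 0)) => // z mz _; exact: hHH.
have F1 y t : eta <= y -> lder (hor HH y) t (hor h y t).
  move=> ey; have -> : hor HH y = hor H y.
    by apply/funext => s; rewrite /hor HHE //=; lra.
  have := lder_comp (lder_hor y t) (dH (Complex t y) _); rewrite mulr1 gE /=; last by lra.
  by apply; lra.
have F2 y t : eta <= y -> lder (hor K y) t (hor HH y t).
  by move=> ey; have := lder_comp (lder_hor y t) (dK (Complex t y) _); rewrite mulr1; apply => /=; lra.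
have F3 x t : eta <= t -> lder (fun s => K (Complex x s)) t (iC * HH (Complex x t)).
  by move=> ey; have := lder_comp (lder_ver x t) (dK (Complex x t) _); rewrite mulrC; apply => /=; lra.
have inc (n p y a b : R) : 0 < n -> (forall x, p <= x <= p + 1 -> n <= `|x|) -> eta <= y ->
    p <= a <= p + 1 -> p <= b <= p + 1 ->
    absC (HH (Complex b y) - HH (Complex a y)) <= 2 * (n^-1 * (M + 1)).
  move=> n0 np ey; wlog ab : a b / a <= b.
    move=> W aa bb; have [/W|/ltW /W] := leP a b; first exact.
    by rewrite absCC; apply.
  move=> /andP[a1 a2] /andP[b1 b2].
  have y0 : 0 < y by lra.
  have M0 := line_M_ge0.
  have n10 : 0 <= n^-1 by rewrite invr_ge0 ltW.
  have mphi : mfun (sqn (hor A y)).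
    by apply: mfun_sqn; apply: cmeas_cont => t; exact: line_rccontA.
  have bnd x : a <= x <= b -> absC (hor h y x) <= n^-1 * (sqn (hor A y) x + 1).
    by move=> /andP[xa xb]; apply: line_abs_le => //; apply: np; apply/andP; split; lra.
  have le1 : n^-1 * (M + (b - a)) <= n^-1 * (M + 1) by apply: ler_wpM2l => //; lra.
  apply: le_trans (absC_le _) _; rewrite mulrDl mul1r ReB ImB; apply: lerD; apply: le_trans le1.
    apply: (@primitive_increment_le _ (fun s => complex.Re (hor HH y s)) (fun s => complex.Re (hor h y s))
       (sqn (hor A y))) => //.
    - by move=> t; apply: lder_Re; exact: F1.
    - by move=> t; apply: rccont_Re; exact: line_rccont.
    - by move=> x; exact: sqn_ge0.
    - exact: hA.2.
    - by move=> x /bnd; apply: le_trans; exact: Re_abs.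
  apply: (@primitive_increment_le _ (fun s => complex.Im (hor HH y s)) (fun s => complex.Im (hor h y s))
       (sqn (hor A y))) => //.
  - by move=> t; apply: lder_Im; exact: F1.
  - by move=> t; apply: rccont_Im; exact: line_rccont.
  - by move=> x; exact: sqn_ge0.
  - exact: hA.2.
  - by move=> x /bnd; apply: le_trans; exact: Im_abs.
have side (n p c : R) : 0 < n -> (forall x, p <= x <= p + 1 -> n <= `|x|) -> p <= c <= p + 1 ->
    absC (HH (Complex c Y) - HH (Complex c eta)) <= 4 * (n^-1 * (M + 1)) * (2 + (Y - eta)).
  move=> n0 np pc; set B := 2 * (n^-1 * (M + 1)).
  have pp : p <= p <= p + 1 by apply/andP; split; lra.
  have pp1 : p <= p + 1 <= p + 1 by apply/andP; split; lra.
  pose D y := K (Complex (p + 1) y) - K (Complex p y).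
  (* D y is the average of HH(., y) over the unit interval at p, and HH varies there by at most
     B. *)
  have e1 y : eta <= y -> absC (D y - HH (Complex c y)) <= 2 * B.
    move=> ey; have := @path_int_bound (fun s => HH (Complex s y) - HH (Complex c y)) p (p + 1) B.
    rewrite (path_int_FTC (G := fun s => K (Complex s y) + (- HH (Complex c y)) * RtoC s)); first last.
    - move=> t _; apply: lderD; first exact: F2.
      by have := lderZ (- HH (Complex c y)) (lder_hor 0 t); rewrite mulr1; exact.
    - by move=> t; apply: rccontB; [exact: rccont_horf|exact: rccont_cst].
    rewrite (_ : p + 1 - p = 1) ?normr1 ?mulr1; last by ring.
    rewrite (_ : _ - _ = D y - HH (Complex c y)); last by rewrite /D RtoCD RtoC1; ring.
    apply => t; first by apply: rccontB; [exact: rccont_horf|exact: rccont_cst].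
    by rewrite between_le ?lerDl // => tt; exact: (inc n p).
  (* The vertical derivative of D is i times an increment of HH over the unit interval, so [inc]
     bounds it by B. *)
  have e2 : absC (D Y - D eta) <= 2 * B * (Y - eta).
    have := @path_int_bound (fun s => iC * (HH (Complex (p + 1) s) - HH (Complex p s))) eta Y B.
    have cc t : rccont (fun s => iC * (HH (Complex (p + 1) s) - HH (Complex p s))) t.
      apply: rccontM; first exact: rccont_cst.
      by apply: rccontB; exact: rccont_verf.
    rewrite (path_int_FTC (G := D)) //; last first.
      move=> t; rewrite between_le // => /andP[et _].
      rewrite mulrBr /D; have := lderD (F3 (p + 1) t et) (lderZ (-1) (F3 p t et)).
      rewrite !mulN1r; congr (lder _ _ _); by apply/funext => s; rewrite mulN1r.
    rewrite (ger0_norm (_ : 0 <= Y - eta)) ?subr_ge0 //; apply => // t.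
    rewrite between_le // => /andP[et _]; rewrite absCM absC_i mul1r; exact: (inc n p).
  have r1 := e1 Y etaY; have r2 := e1 eta (lexx _).
  have r3 := absC_tri (D Y) (HH (Complex c Y)) (HH (Complex c eta)).
  have r4 := absC_tri (D eta) (D Y) (HH (Complex c eta)).
  rewrite (absCC _ (D Y)) in r3.
  rewrite (_ : 4 * _ * _ = 2 * B + 2 * B + 2 * B * (Y - eta)); last by rewrite /B; ring.
  move: (2 * B * (Y - eta)) (2 * B) e2 r1 r2 => X Z; lra.
have lim y : eta <= y -> Ccvg (fun n => HH (Complex n.+1%:R y) - HH (Complex (- n.+1%:R) y)) (cint (hor h y)).
  move=> ey; have y0 : 0 < y by lra.
  have [i1 i2] := line_cintble y0.
  apply: Ccvg_ReIm.
    have := full_line_integral (fun t => lder_Re (F1 y t ey)) (fun t => rccont_Re (line_rccont t y0)) i1.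
    by under eq_fun do rewrite -ReB.
  have := full_line_integral (fun t => lder_Im (F1 y t ey)) (fun t => rccont_Im (line_rccont t y0)) i2.
  by under eq_fun do rewrite -ImB.
apply: (Ccvg_close (lim eta (lexx _)) (lim Y etaY) (K := 8 * (M + 1) * (2 + (Y - eta)))) => n.
have n0 : (0 : R) < n.+1%:R by rewrite ltr0n.
have r1 := side n.+1%:R n.+1%:R n.+1%:R n0.
(* On the left the averaging interval is [-n-2, -n-1], lying outside the endpoint so that |x| >= n +
   1 holds on it. *)
have r2 := side n.+1%:R (- n.+1%:R - 1) (- n.+1%:R) n0.
set u := n.+1%:R in n0 r1 r2 *.
have {}r1 : absC (HH (Complex u Y) - HH (Complex u eta)) <= 4 * (u^-1 * (M + 1)) * (2 + (Y - eta)).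
  apply: r1; last by apply/andP; split; lra.
  by move=> x /andP[ux _]; apply: le_trans ux (ler_norm _).
have {}r2 : absC (HH (Complex (- u) Y) - HH (Complex (- u) eta)) <= 4 * (u^-1 * (M + 1)) * (2 + (Y - eta)).
  apply: r2; last by apply/andP; split; lra.
  by move=> x /andP[_ xu]; rewrite -normrN; apply: le_trans (ler_norm _); lra.
rewrite (_ : 8 * (M + 1) * (2 + (Y - eta)) / u =
   4 * (u^-1 * (M + 1)) * (2 + (Y - eta)) + 4 * (u^-1 * (M + 1)) * (2 + (Y - eta))); last by ring.
rewrite absCC in r1; apply: le_trans (lerD r1 r2); apply: le_trans (absCD _ _).
by rewrite le_eqVlt; apply/orP; left; apply/eqP; congr absC; ring.
Qed.

(** On the line at height Y the weight has integral pi / (Y + v), while A keeps its bound M. The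
    scaling d first makes the part with M small, and Y is then taken large depending on d. *)
Lemma line_small (eta e : R) : 0 < eta -> 0 < e -> exists Y, eta <= Y /\ absC (cint (hor h Y)) <= e.
Proof.
move=> eta0 e0; have M0 := line_M_ge0.
have M1 : 0 < M + 1 by rewrite ltr_wpDl.
have [d [d0 h1]] : exists d, 0 < d /\ d * M <= e / 4.
  exists (e / (4 * (M + 1))); split; first by rewrite divr_gt0 // mulr_gt0.
  rewrite mulrAC ler_pdivrMr ?mulr_gt0 // (_ : e / 4 * _ = e * (M + 1)); last by field.
  by rewrite ler_pM2l //; lra.
have p0 : (0 : R) < pi by exact: pi_gt0.
pose Y := eta + 4 * pi / (e * d).
have Yx : 0 < 4 * pi / (e * d) by rewrite divr_gt0 // mulr_gt0.
have Y0 : 0 < Y by rewrite addr_gt0.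
have Yv : 0 < Y + v by rewrite addr_gt0.
exists Y; split; first by rewrite lerDl ltW.
have di0 : 0 <= d^-1 by rewrite invr_ge0 ltW.
apply: (@le_trans _ _ (2 * (d * M + d^-1 * (pi / (Y + v))))).
  apply: (@cdom_abs_le (fun x => d^-1 * cauchyG (Y + v) x) (fun x => d * sqn (hor A Y) x)).
  - by apply: cmeas_cont => t; exact: line_rccont.
  - by apply: mfunM; [exact: mfun_cst|exact: mfun_cauchyG].
  - apply: mfunM; [exact: mfun_cst|]; apply: mfun_sqn; apply: cmeas_cont => t; exact: line_rccontA.
  - by move=> x; rewrite mulr_ge0 // cauchyG_ge0.
  - by move=> x; rewrite mulr_ge0 ?sqn_ge0 // ltW.
  - apply: nnintZ_le; [|by move=> x; exact: sqn_ge0|exact: ltW|exact: hA.2].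
    by apply: mfun_sqn; apply: cmeas_cont => t; exact: line_rccontA.
  - apply: nnintZ_le; [exact: mfun_cauchyG|exact: cauchyG_ge0|by []|].
    by rewrite nnint_cauchyG.
  - move=> x; rewrite sqn_line // (_ : d * _ * _ = sqn (hor A Y) x * cauchyG (Y + v) x) //.
    by field; rewrite gt_eqF.
have h2 : d^-1 * (pi / (Y + v)) <= e / 4.
  rewrite mulrA ler_pdivrMr // mulrC ler_pdivrMr //.
  have : 4 * pi / (e * d) <= Y + v by rewrite /Y addrAC lerDr addr_ge0 // ltW.
  rewrite ler_pdivrMr ?mulr_gt0 // => q; rewrite (_ : e / 4 * (Y + v) * d = (Y + v) * (e * d) / 4); last by field.
  by move: q; move: ((Y + v) * (e * d)) => X; lra.
lra.
Qed.

Lemma line_zero (eta : R) : 0 < eta -> cint (hor h eta) = 0.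
Proof.
move=> eta0; apply/eqP; rewrite -absC_eq0 eq_le absC_ge0 andbT.
apply/ler_addgt0Pl => e e0; rewrite addr0.
by have [Y [eY hY]] := line_small eta0 e0; rewrite (line_const eta0 eY).
Qed.

End line_integrals.

(** * Boundary values, Cauchy's formula and Poisson's formula on the real line *)

(** A Hardy function that is also given on the real line and is continuous at almost every real
    point, so that its values there are its boundary values. Quotients of entire functions by E fit
    this pattern. *)
Record bvH2 (A : C -> C) (M : R) : Prop := BvH2 {
  bv_bound : H2bound A M;
  bv_meas : cmeas (fun t => A (RtoC t));
  bv_cont : {ae mu, forall x, ccont A (RtoC x)} }.

Lemma Ccvg_bdry x : Ccvg (fun n => Complex x n.+1%:R^-1) (RtoC x).
Proof.
move=> e e0; have [N hN] := le_nat_eps 1 e0; exists N => n Nn.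
rewrite (_ : _ - _ = iC * RtoC n.+1%:R^-1); last by apply: eqC; rewrite ?ReB ?ImB ?ReM ?ImM /=; ring.
rewrite absCM absC_i mul1r absC_R ger0_norm ?invr_ge0 //; apply: le_lt_trans hN.
by rewrite mul1r lef_pV2 ?posrE // ler_nat ltnS.
Qed.

Lemma hor_rccont A y t : (forall z, 0 < complex.Im z -> holo_at A z) -> 0 < y ->
  rccont (hor A y) t.
Proof.
by move=> hA y0; apply: rccont_comp; [exact: rccont_hor|apply: holo_cont; exact: hA].
Qed.

Lemma bv_rccont A M y t : bvH2 A M -> 0 < y -> rccont (hor A y) t.
Proof. by move=> [[hA _] _ _]; exact: hor_rccont. Qed.

Lemma bv_horE A M y : bvH2 A M -> 0 < y -> mfun (sqn (hor A y)).
Proof. by move=> bA y0; apply: mfun_sqn; apply: cmeas_cont => t; exact: bv_rccont bA y0. Qed.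

(** Fatou's lemma along the lines at height 1/(n + 1). *)
Lemma bv_bdry A M : bvH2 A M -> (nnint (sqn (fun t => A (RtoC t))) <= M%:E)%E.
Proof.
move=> bA; have n0 n : (0 : R) < n.+1%:R^-1 by rewrite invr_gt0.
apply: (@fatou_real R (fun n => sqn (hor A n.+1%:R^-1))).
- by move=> n; exact: bv_horE bA (n0 n).
- by apply: mfun_sqn; exact: bv_meas bA.
- by move=> n x; exact: sqn_ge0.
- by move=> x; exact: sqn_ge0.
- apply: ae_imp (bv_cont bA) => x cx; apply: (@Ccvg_sqn (fun n => A (Complex x n.+1%:R^-1))).
  by apply: Ccvg_cont cx; exact: Ccvg_bdry.
- by move=> n; apply: (bv_bound bA).2.
Qed.

Lemma absC_kern_p (t v : R) : absC (RtoC t + iC * RtoC v) ^+ 2 = t ^+ 2 + v ^+ 2.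
Proof. by rewrite absC_sqr ReD ImD ReM ImM /=; ring. Qed.

Lemma absC_kern_m (t v : R) : absC (RtoC t - iC * RtoC v) ^+ 2 = t ^+ 2 + v ^+ 2.
Proof. by rewrite absC_sqr ReB ImB ReM ImM /=; ring. Qed.

Lemma kern_p_neq0 t v : 0 < v -> RtoC t + iC * RtoC v != 0.
Proof. by move=> v0; rewrite -absC_eq0 -sqrf_eq0 absC_kern_p gt_eqF // cauchyG_gt0. Qed.

Lemma kern_m_neq0 t v : 0 < v -> RtoC t - iC * RtoC v != 0.
Proof. by move=> v0; rewrite -absC_eq0 -sqrf_eq0 absC_kern_m gt_eqF // cauchyG_gt0. Qed.

Lemma cmeas_RtoC : cmeas RtoC.
Proof. by split; [exact: mfun_id|exact: mfun_cst]. Qed.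

Lemma sqn_div (f g : R -> C) x : sqn (fun t => f t / g t) x = sqn f x / sqn g x.
Proof. by rewrite /sqn absCM absCV exprMn exprVn. Qed.

Lemma sqnM (f g : R -> C) x : sqn (fun t => f t * g t) x = sqn f x * sqn g x.
Proof. by rewrite /sqn absCM exprMn. Qed.

Lemma kern_m_cdom (f : R -> C) M v : cmeas f -> (nnint (sqn f) <= M%:E)%E ->
  cdom (cauchyG v) M (fun t => f t / (RtoC t - iC * RtoC v)).
Proof.
move=> mf fM; split.
  apply: cmeas_div => //; apply: cmeasB; [exact: cmeas_RtoC|exact: cmeas_cst].
exists (sqn f); split => //; [exact: mfun_sqn|by move=> x; exact: sqn_ge0|].
by move=> x; rewrite sqn_div /sqn absC_kern_m.
Qed.

Lemma kern_p_cdom (f : R -> C) M v : cmeas f -> (nnint (sqn f) <= M%:E)%E ->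
  cdom (cauchyG v) M (fun t => f t / (RtoC t + iC * RtoC v)).
Proof.
move=> mf fM; split.
  apply: cmeas_div => //; apply: cmeasD; [exact: cmeas_RtoC|exact: cmeas_cst].
exists (sqn f); split => //; [exact: mfun_sqn|by move=> x; exact: sqn_ge0|].
by move=> x; rewrite sqn_div /sqn absC_kern_p.
Qed.

Lemma kern_m_cintble (f : R -> C) M v : 0 < v -> cmeas f -> (nnint (sqn f) <= M%:E)%E ->
  cintble (fun t => f t / (RtoC t - iC * RtoC v)).
Proof.
move=> v0 mf fM; apply: cdom_cintble (kern_m_cdom v mf fM); first by move=> x; exact: cauchyG_ge0.
exact: integrable_cauchyG.
Qed.

Lemma cauchyG_mono (a b x : R) : 0 < a -> a <= b -> cauchyG b x <= cauchyG a x.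
Proof.
move=> a0 ab; rewrite /cauchyG lef_pV2 ?posrE ?cauchyG_gt0 //; last by apply: lt_le_trans ab.
by rewrite lerD2l; apply: lerXn2r; rewrite ?nnegrE //; lra.
Qed.

(** The integrals over the lines at height 1/(n + 1) vanish by [line_zero]. Their weights
    [cauchyG (y + v)] all lie below [cauchyG v], which serves as the fixed factor in
    [cdom_limit]. *)
Lemma bv_cauchy0 A M v : bvH2 A M -> 0 < v ->
  cint (fun t => A (RtoC t) / (RtoC t + iC * RtoC v)) = 0.
Proof.
move=> bA v0; have n0 n : (0 : R) < n.+1%:R^-1 by rewrite invr_gt0.
pose h z := A z / (z + iC * RtoC v).
have := @cdom_limit (cauchyG v) M (fun n => hor h n.+1%:R^-1) (fun t => h (RtoC t))
  (cauchyG_ge0 v) (mfun_cauchyG v) (integrable_cauchyG v0) _ (kern_p_cdom v (bv_meas bA) (bv_bdry bA)) _.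
move=> H; have {H} lim : Ccvg (fun n => cint (hor h n.+1%:R^-1)) (cint (fun t => h (RtoC t))).
  apply: H => [n|].
    have [mh [phi [p1 p2 p3 p4]]] := line_cdom (bv_bound bA) v0 (n0 n).
    split => //; exists phi; split => // x; apply: le_trans (p4 x) _.
    by apply: ler_wpM2l => //; apply: cauchyG_mono => //; rewrite lerDr ltW.
  apply: ae_imp (bv_cont bA) => x cx; apply: (@Ccvg_cont h); first exact: Ccvg_bdry.
  apply: ccont_div => //; first by apply: ccontD; [exact: ccont_id|exact: ccont_cst].
  exact: kern_p_neq0.
apply/eqP; rewrite -absC_eq0 eq_le absC_ge0 andbT; apply/ler_addgt0Pl => e e0; rewrite addr0.
have [N hN] := lim e e0; have := hN N (leqnn _).
by rewrite (line_zero (bv_bound bA) v0 (n0 N)) sub0r absCN => /ltW.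
Qed.

Lemma sqr_absD (x y : C) : absC (x + y) ^+ 2 <= 2 * absC x ^+ 2 + 2 * absC y ^+ 2.
Proof.
apply: (@le_trans _ _ ((absC x + absC y) ^+ 2)).
  by rewrite ler_pXn2r ?nnegrE ?absC_ge0 ?addr_ge0 ?absC_ge0 // absCD.
by have := sqr_ge0 (absC x - absC y); rewrite !expr2; lra.
Qed.

(** The extra term 1/(x^2 + 1) has the same finite integral on every horizontal line; it absorbs
    regions where q is bounded and x stays bounded. *)
Lemma H2bound_dom q N M c d : H2bound N M -> (forall z, 0 < complex.Im z -> holo_at q z) ->
  0 <= c -> 0 <= d ->
  (forall x y, 0 < y -> absC (q (Complex x y)) ^+ 2 <= c * absC (N (Complex x y)) ^+ 2 + d * cauchyG 1 x) ->
  H2bound q (c * M + d * pi).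
Proof.
move=> bN hq c0 d0 qN; split => // y y0.
have m (A : C -> C) : (forall z, 0 < complex.Im z -> holo_at A z) -> mfun (sqn (hor A y)).
  move=> hA; apply: mfun_sqn; apply: cmeas_cont => t.
  exact: hor_rccont.
have m1 : mfun (fun x => c * sqn (hor N y) x).
  by apply: mfunM; [exact: mfun_cst|exact: m bN.1].
have m2 : mfun (fun x => d * cauchyG 1 x).
  by apply: mfunM; [exact: mfun_cst|exact: mfun_cauchyG].
apply: (@le_trans _ _ (nnint (fun x => (c * sqn (hor N y) x + d * cauchyG 1 x)%R))).
  apply: nnint_le; [exact: m|exact: mfunD|by move=> x; exact: sqn_ge0|].
  by move=> x; exact: qN.
rewrite nnintD //; last 2 first.
- by move=> x; rewrite mulr_ge0 // sqn_ge0.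
- by move=> x; rewrite mulr_ge0 // cauchyG_ge0.
rewrite EFinD; apply: leeD.
  by apply: nnintZ_le => //; [exact: m bN.1|by move=> x; exact: sqn_ge0|exact: bN.2].
apply: nnintZ_le => //; [exact: mfun_cauchyG|by move=> x; exact: cauchyG_ge0|].
by rewrite nnint_cauchyG // divr1.
Qed.

Lemma H2boundD A B M M' : H2bound A M -> H2bound B M' ->
  H2bound (fun z => A z + B z) (2 * M + 2 * M').
Proof.
move=> bA bB; split; first by move=> z z0; apply: holoD; [exact: bA.1|exact: bB.1].
move=> y y0.
have m (A0 : C -> C) : (forall z, 0 < complex.Im z -> holo_at A0 z) -> mfun (sqn (hor A0 y)).
  move=> hA; apply: mfun_sqn; apply: cmeas_cont => t.
  exact: hor_rccont.
have m2 (A0 : C -> C) : (forall z, 0 < complex.Im z -> holo_at A0 z) -> mfun (fun x => 2 * sqn (hor A0 y) x).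
  by move=> hA; apply: mfunM; [exact: mfun_cst|exact: m].
apply: (@le_trans _ _ (nnint (fun x => (2 * sqn (hor A y) x + 2 * sqn (hor B y) x)%R))).
  apply: nnint_le.
  - by apply: m => z z0; apply: holoD; [exact: bA.1|exact: bB.1].
  - by apply: mfunD; apply: m2; [exact: bA.1|exact: bB.1].
  - by move=> x; exact: sqn_ge0.
  - by move=> x; exact: sqr_absD.
rewrite nnintD; [|exact: m2 bA.1|exact: m2 bB.1|by move=> x; rewrite mulr_ge0 // sqn_ge0
  |by move=> x; rewrite mulr_ge0 // sqn_ge0].
rewrite EFinD; apply: leeD; apply: nnintZ_le => //.
- exact: m bA.1.
- by move=> x; exact: sqn_ge0.
- exact: bA.2.
- exact: m bB.1.
- by move=> x; exact: sqn_ge0.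
- exact: bB.2.
Qed.

Lemma H2bound_mul q N M c : H2bound N M -> (forall z, 0 < complex.Im z -> holo_at q z) -> 0 <= c ->
  (forall z, 0 < complex.Im z -> absC (q z) <= c * absC (N z)) -> H2bound q (c ^+ 2 * M + 0 * pi).
Proof.
move=> bN hq c0 qN; apply: H2bound_dom bN hq _ _ _ => //; first exact: sqr_ge0.
move=> x y y0; rewrite mul0r addr0 -exprMn ler_pXn2r ?nnegrE ?absC_ge0 ?mulr_ge0 ?absC_ge0 //.
exact: qN.
Qed.

Lemma H2boundZ A M k : H2bound A M -> H2bound (fun z => k * A z) (absC k ^+ 2 * M + 0 * pi).
Proof.
move=> bA; apply: (H2bound_mul bA) => [z z0||z z0]; [|exact: absC_ge0|by rewrite absCM].
by apply: holoM; [exact: holo_cst|exact: bA.1].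
Qed.

Lemma H2bound0 : H2bound (fun=> 0) 0.
Proof.
split; first by move=> z _; exact: holo_cst.
move=> y _; rewrite (_ : sqn _ = fun=> 0); last by apply/funext => x; rewrite /sqn /hor absC0 expr0n.
by rewrite /nnint integral0.
Qed.

(** The constant comes from x^2 + 1 <= (1 + v^-2) (x^2 + (y + v)^2). The summand [0 * 0] is the
    contribution of the zero function in [H2bound_dom]. *)
Lemma H2bound_shift v : 0 < v -> H2bound (fun z => (z + iC * RtoC v)^-1) (0 * 0 + (1 + v ^- 2) * pi).
Proof.
move=> v0; apply: (H2bound_dom H2bound0) => //.
- move=> z z0; apply: (@holo_local _ (fun z => 1 / (z + iC * RtoC v)) z 1) => //.
    by move=> x _; rewrite mul1r.
  apply: holo_div; [exact: holo_cst|by apply: holoD; [exact: holo_id|exact: holo_cst]|].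
  by apply: shift_neq0 => //; exact: ltW.
- by rewrite addr_ge0 // invr_ge0 sqr_ge0.
- move=> x y y0; rewrite absC0 expr0n mulr0 add0r absCV exprVn absC_shift /cauchyG expr1n.
  have p1 : 0 < x ^+ 2 + 1 by rewrite ltr_wpDl ?sqr_ge0.
  have p2 : 0 < x ^+ 2 + (y + v) ^+ 2 by rewrite cauchyG_gt0 // addr_gt0.
  rewrite ler_pdivlMr // mulrC ler_pdivrMr // mulrDl mul1r mulrDr.
  have : v ^+ 2 <= (y + v) ^+ 2 by apply: lerXn2r; rewrite ?nnegrE //; lra.
  have v2 : 0 < v ^+ 2 by rewrite exprn_gt0.
  have i0 : 0 < v ^- 2 by rewrite invr_gt0.
  have e1 : v ^- 2 * v ^+ 2 = 1 by rewrite mulVf // gt_eqF.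
  move=> h; have : v ^- 2 * v ^+ 2 <= v ^- 2 * (y + v) ^+ 2 by rewrite ler_pM2l.
  have : 0 <= v ^- 2 * x ^+ 2 by rewrite mulr_ge0 ?sqr_ge0 // ltW.
  have := sqr_ge0 (y + v); rewrite e1; lra.
Qed.

(** At distance at least d from the zero w of the divisor, |q| <= |N| / d. In the disc of radius d
    around w, q is bounded by continuity and |x| <= d, so a multiple of 1/(x^2 + 1) dominates it. *)
Lemma H2bound_divide q N M v : 0 < v -> H2bound N M -> (forall z, 0 < complex.Im z -> holo_at q z) ->
  (forall z, 0 < complex.Im z -> q z * (z - iC * RtoC v) = N z) -> exists M', H2bound q M'.
Proof.
move=> v0 bN hq qN; set w := iC * RtoC v in qN *.
have w0 : 0 < complex.Im w by rewrite /w ImM /= mul0r mul1r add0r.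
have [d d0 hd] := holo_cont (hq w w0) ltr01.
pose b := (absC (q w) + 1) ^+ 2 * (d ^+ 2 + 1).
have b0 : 0 <= b by rewrite mulr_ge0 ?addr_ge0 ?sqr_ge0.
exists (d ^- 2 * M + b * pi); apply: (H2bound_dom bN) => //; first by rewrite invr_ge0 sqr_ge0.
move=> x y y0; set z := Complex x y.
have G0 : 0 <= b * cauchyG 1 x by rewrite mulr_ge0 // cauchyG_ge0.
have [zd|zd] := leP d (absC (z - w)).
  apply: (@le_trans _ _ (d ^- 2 * absC (N z) ^+ 2)); last by rewrite lerDl.
  rewrite -qN // absCM exprMn mulrCA -[leLHS]mulr1; apply: ler_wpM2l; first exact: sqr_ge0.
  by rewrite mulrC ler_pdivlMr ?exprn_gt0 // mul1r ler_pXn2r ?nnegrE ?absC_ge0 // ltW.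
apply: (@le_trans _ _ (b * cauchyG 1 x)); last first.
  by rewrite lerDr mulr_ge0 ?invr_ge0 ?sqr_ge0.
have xd : x ^+ 2 <= d ^+ 2.
  have := Re_abs (z - w); rewrite /z /w ReB ReM /= mul0r mul1r !subr0 => xz.
  rewrite -(real_normK (num_real x)) ler_pXn2r ?nnegrE ?normr_ge0 ?ltW //.
  exact: le_lt_trans xz zd.
have p1 : 0 < x ^+ 2 + 1 by rewrite ltr_wpDl ?sqr_ge0.
rewrite /cauchyG expr1n ler_pdivlMr // /b; apply: ler_pM; rewrite ?sqr_ge0 //; first exact: ltW.
  rewrite ler_pXn2r ?nnegrE ?absC_ge0 ?addr_ge0 ?absC_ge0 //.
  by have := hd z zd; have := absC_rtri (q z) (q w); lra.
by rewrite lerD2r.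
Qed.

Lemma bvD A B M M' : bvH2 A M -> bvH2 B M' -> bvH2 (fun z => A z + B z) (2 * M + 2 * M').
Proof.
move=> [a1 a2 a3] [b1 b2 b3]; split; [exact: H2boundD|exact: cmeasD|].
have [N1 [mN1 z1 s1]] := a3; have [N2 [mN2 z2 s2]] := b3.
exists (N1 `|` N2); split; [exact: measurableU|by rewrite null_set_setU|].
move=> x /= nx; apply: contrapT => /not_orP[n1 n2]; apply: nx.
by apply: ccontD; apply: contrapT => h; [apply: n1; apply: s1|apply: n2; apply: s2].
Qed.

Lemma cint_cauchyG v : 0 < v -> cint (fun t => RtoC (cauchyG v t)) = RtoC (pi / v).
Proof.
move=> v0; rewrite /cint /=; congr Complex; last first.
  by rewrite /Rintegral integral0.
have := nnint_cauchyG v0.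
by rewrite nnint_Rintegral ?(integrable_cauchyG v0) // => [[->]|x]; rewrite ?cauchyG_ge0.
Qed.

Lemma kern_mul t v : 0 < v -> (RtoC t + iC * RtoC v) * (RtoC t - iC * RtoC v) = RtoC (t ^+ 2 + v ^+ 2).
Proof. by move=> v0; apply: eqC; rewrite !(ReM, ImM, ReD, ImD, ReB, ImB, ReN, ImN) /=; ring. Qed.

(* [bv_cauchy0] applied to N + 2w (divided difference of N at w), where N is F minus a
   multiple of 1/(z + w) that makes it vanish at w. *)
Lemma bv_cauchy F M v : bvH2 F M -> 0 < v ->
  cint (fun t => F (RtoC t) / (RtoC t - iC * RtoC v)) = 2%:R * RtoC pi * iC * F (iC * RtoC v).
Proof.
move=> bF v0; set w := iC * RtoC v.
have w0 : 0 < complex.Im w by rewrite /w ImM /= mul0r mul1r add0r.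
have wn0 : w != 0 by apply/eqP => w00; rewrite w00 ltxx in w0.
have two : (2%:R : C) != 0 by rewrite pnatr_eq0.
(* Chosen so that F + k/(z + w) vanishes at w. *)
pose k := - (F w * (2%:R * w)).
have bS : bvH2 (fun z => k * (z + w)^-1) (absC k ^+ 2 * (0 * 0 + (1 + v ^- 2) * pi) + 0 * pi).
  split; first by apply: H2boundZ; exact: H2bound_shift.
    apply: cmeasM; first exact: cmeas_cst.
    by apply: cmeasV; apply: cmeasD; [exact: cmeas_RtoC|exact: cmeas_cst].
  apply: aeW => x; apply: ccontM; first exact: ccont_cst.
  by apply: ccontV; [apply: ccontD; [exact: ccont_id|exact: ccont_cst]|exact: kern_p_neq0].
have bN := bvD bF bS.
set N := (fun z => _) in bN; set M1 := _ + _ in bN.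
have Nw : N w = 0 by rewrite /N /k; field; rewrite -mulr2n -mulr_natl mulf_neq0.
pose q := divdiff w N.
have qE z : q z * (z - w) = N z by rewrite /q divdiffE Nw subr0.
have hq z : 0 < complex.Im z -> holo_at q z.
  move=> z0; have [->|zw] := eqVneq z w; last by apply: divdiff_holo_ne => //; exact: (bv_bound bN).1.
  by apply: (@divdiff_holo N w 0) => // ? ?; exact: (bv_bound bN).1.
have [M2 bq] := H2bound_divide v0 (bv_bound bN) hq (fun z _ => qE z).
have qR t : q (RtoC t) = N (RtoC t) / (RtoC t - w).
  by rewrite -qE mulfK // kern_m_neq0.
have bQ : bvH2 (fun z => 2%:R * w * q z) (absC (2%:R * w) ^+ 2 * M2 + 0 * pi).
  split; first exact: H2boundZ.
    apply: cmeasM; first exact: cmeas_cst.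
    rewrite (_ : (fun x => _) = fun t => N (RtoC t) / (RtoC t - w)); last by apply/funext => t; exact: qR.
    apply: cmeas_div; first exact: bv_meas bN.
    by apply: cmeasB; [exact: cmeas_RtoC|exact: cmeas_cst].
  apply: ae_imp (bv_cont bN) => x cx; apply: ccontM; first exact: ccont_cst.
  by apply: divdiff_cont_ne => //; rewrite -subr_eq0 kern_m_neq0.
(* On the line N + 2 w q = N (t + w)/(t - w). Dividing by t + w leaves N/(t - w), which is F/(t - w)
   + k/(t^2 + v^2). *)
have := bv_cauchy0 (bvD bN bQ) v0.
rewrite (@cint_eq _ (fun t => F (RtoC t) / (RtoC t - w) + k * RtoC (cauchyG v t))); last first.
  move=> t; rewrite qR /N.
  have n1 := kern_p_neq0 t v0; have n2 := kern_m_neq0 t v0; rewrite -/w in n1 n2 *.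
  rewrite /cauchyG RtoCV -(kern_mul t v0) -/w.
  by field; rewrite n1 n2.
have ik : cintble (fun t => RtoC (cauchyG v t)).
  apply: (cintble_le (g := cauchyG v)) => [|x|]; last exact: integrable_cauchyG.
    by split; [exact: mfun_cauchyG|exact: mfun_cst].
  by rewrite absC_R ger0_norm // cauchyG_ge0.
rewrite cintD; [|exact: (kern_m_cintble v0 (bv_meas bF) (bv_bdry bF))|exact: cintbleZ].
rewrite cintZ // cint_cauchyG // => /eqP; rewrite addr_eq0 => /eqP ->.
have vn0 : RtoC v != 0 by rewrite -absC_gt0 absC_R normr_gt0 gt_eqF.
rewrite /k RtoCM RtoCV /w; field; exact: vn0.
Qed.

(** Cauchy's formula for T/(z + w), a Hardy function since T is bounded: dividing once more by t - w
    produces the real weight 1/(t^2 + v^2). *)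
Lemma poisson T v : 0 < v -> (forall z, 0 < complex.Im z -> holo_at T z) ->
  (forall z, 0 < complex.Im z -> absC (T z) <= 1) -> cmeas (fun t => T (RtoC t)) ->
  {ae mu, forall x, ccont T (RtoC x)} ->
  cint (fun t => T (RtoC t) * RtoC (cauchyG v t)) = RtoC (pi / v) * T (iC * RtoC v).
Proof.
move=> v0 hT T1 mT cT; set w := iC * RtoC v.
have bF : exists M, bvH2 (fun z => T z / (z + w)) M.
  exists (1 ^+ 2 * (0 * 0 + (1 + v ^- 2) * pi) + 0 * pi); split.
  - apply: (H2bound_mul (H2bound_shift v0)) => // [z z0|z z0].
      apply: holo_div; [exact: hT|by apply: holoD; [exact: holo_id|exact: holo_cst]|].
      by apply: shift_neq0 => //; exact: ltW.
    by rewrite absCM mul1r; apply: ler_piMl; [exact: absC_ge0|exact: T1].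
  - apply: cmeas_div => //; apply: cmeasD; [exact: cmeas_RtoC|exact: cmeas_cst].
  - apply: ae_imp cT => x cx; apply: ccont_div => //; last exact: kern_p_neq0.
    by apply: ccontD; [exact: ccont_id|exact: ccont_cst].
have [M bM] := bF; have := bv_cauchy bM v0; rewrite -/w.
rewrite (@cint_eq _ (fun t => T (RtoC t) * RtoC (cauchyG v t))); last first.
  move=> t; have n1 := kern_p_neq0 t v0; have n2 := kern_m_neq0 t v0.
  rewrite /cauchyG RtoCV -(kern_mul t v0) -/w; rewrite -/w in n1 n2.
  by field; rewrite n1 n2.
move=> ->; have vn0 : RtoC v != 0 by rewrite -absC_gt0 absC_R normr_gt0 gt_eqF.
have i0 : iC != 0 by rewrite -absC_gt0 absC_i.
rewrite /w RtoCM RtoCV; field.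
rewrite vn0 /= -mulr2n -mulr_natl; apply: mulf_neq0; [by rewrite pnatr_eq0|exact: mulf_neq0].
Qed.

(** * De Branges spaces *)

(** Each point is coded by a rational q and an n such that q is within 1/(n + 1) of it and no other
    point of Z is within 2/(n + 1). Two points with the same code are closer than 2/(n + 1), hence
    equal. *)
Lemma isolated_countable (T : realType) (Z : set T) :
  (forall x, Z x -> exists2 d : T, 0 < d & forall y, Z y -> `|y - x| < d -> y = x) ->
  countable Z.
Proof.
move=> iso; apply/countable_injP.
have key (x : T) : exists qn : rat * nat, Z x -> `|x - ratr qn.1| < qn.2.+1%:R^-1 /\
    forall y, Z y -> `|y - x| < 2 * qn.2.+1%:R^-1 -> y = x.
  have [Zx|nZx] := pselect (Z x); last by exists (0, 0%N) => /nZx.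
  have [d d0 hd] := iso x Zx; have [n hn] := le_nat_eps 2 d0.
  have n0 : (0 : T) < n.+1%:R^-1 by rewrite invr_gt0.
  have [|q] := @rat_in_itvoo T (x - n.+1%:R^-1) (x + n.+1%:R^-1).
    by rewrite ltrD2l; apply: lt_trans n0; rewrite oppr_lt0.
  rewrite in_itv /= => /andP[q1 q2]; exists (q, n) => _; split => /=.
    by rewrite ltr_distlC q1 q2.
  by move=> y Zy yx; apply: hd => //; apply: lt_trans yx hn.
have [f hf] := choice key; exists (fun x => pickle (f x)) => x y.
rewrite !inE => Zx Zy /(pcan_inj pickleK) fxy.
have [x1 x2] := hf x Zx; have [y1 y2] := hf y Zy.
apply: y2 => //; rewrite -fxy in y1 *.
apply: (@le_lt_trans _ _ (`|x - ratr (f x).1| + `|ratr (f x).1 - y|)).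
  by apply: le_trans (ler_normD _ _); rewrite addrA subrK.
by rewrite (distrC _ y) mulr_natl mulr2n; exact: ltrD.
Qed.

Section de_branges.
Variable E : C -> C.
Hypothesis dE : deBranges E.

Lemma dB_neq0 z : 0 < complex.Im z -> E z != 0.
Proof.
by move=> z0; rewrite -absC_gt0; apply: le_lt_trans (dE.2 z z0); exact: absC_ge0.
Qed.

Lemma fstarR f t : fstar f (RtoC t) = cconj (f (RtoC t)).
Proof. by rewrite /fstar cconj_R. Qed.

Lemma dB_zeros_null : {ae mu, forall x, E (RtoC x) != 0}.
Proof.
pose Z := [set x : R | E (RtoC x) = 0].
have cZ : countable Z.
  apply: (@isolated_countable R) => x Zx.
  (* A point of the upper half-plane, where E is nonzero, within the distance that [zero_isolated]
     requires. *)
  pose w := RtoC x + iC * RtoC (1 / 2).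
  have wx : absC (w - RtoC x) <= 1 / 2.
    by rewrite /w addrAC subrr add0r absCM absC_i mul1r absC_R ger0_norm.
  have Ew : E w != 0 by apply: dB_neq0; rewrite /w ImD ImM /=; lra.
  have [d d0 hd] := zero_isolated dE.1 wx Ew.
  exists d => // y Zy yx; apply: contrapT => /eqP nyx.
  have yxC : RtoC y != RtoC x by apply: contra nyx => /eqP/RtoCI/eqP.
  have yd : absC (RtoC y - RtoC x) < d by rewrite -RtoCB absC_R.
  by have := hd _ yxC yd; rewrite Zy eqxx.
have cf : forall t, rccont (fun t => E (RtoC t)) t.
  by move=> t; apply: ccont_rccont; exact: holo_cont (dE.1 _).
exists Z; split.
- have -> : Z = setT `&` (sqn (fun t => E (RtoC t))) @^-1` [set 0].
    apply/seteqP; split => x; rewrite /= /sqn => h.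
      by split => //; rewrite h absC0 expr0n.
    by apply/eqP; rewrite -absC_eq0 -sqrf_eq0; apply/eqP; exact: h.2.
  by apply: (mfun_sqn (cmeas_cont cf)) => //; exact: measurable_set1.
- exact: (@countable_lebesgue_measure0 R).
- by move=> x /= /negP; rewrite negbK => /eqP.
Qed.

Lemma dB_cmeas f : entire f -> cmeas (fun t => f (RtoC t)).
Proof. by move=> ef; apply: cmeas_cont => t; apply: ccont_rccont; exact: holo_cont (ef _). Qed.

Lemma dB_quot_bv f M : entire f -> H2bound (fun z => f z / E z) M -> bvH2 (fun z => f z / E z) M.
Proof.
move=> ef bf; split => //.
  by apply: cmeas_div; apply: dB_cmeas => //; exact: dE.1.
apply: ae_imp dB_zeros_null => x Ex.
by apply: ccont_div => //; apply: holo_cont; [exact: ef|exact: dE.1].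
Qed.

Lemma in_HEP f : in_HE E f <-> entire f /\ exists M, H2bound (fun z => f z / E z) M /\
  H2bound (fun z => fstar f z / E z) M.
Proof.
split.
  move=> [ef [/H2U_bound[M h] /H2U_bound[M' h']]]; split => //.
  exists (Num.max M M'); split.
    split => [|y y0]; first exact: h.1.
    by apply: le_trans (h.2 y y0) _; rewrite lee_fin le_max lexx.
  split => [|y y0]; first exact: h'.1.
  by apply: le_trans (h'.2 y y0) _; rewrite lee_fin le_max lexx orbT.
by move=> [ef [M [h h']]]; split => //; split; apply: H2bound_H2U; [exact: h|exact: h'].
Qed.

Lemma H2bound_eq A B M : (forall z, 0 < complex.Im z -> A z = B z) -> H2bound B M -> H2bound A M.
Proof.
move=> AB [hB bB]; split.
  move=> z z0; apply: (holo_local z0 _ (hB z z0)) => x xz; apply: AB.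
  have := Im_abs (x - z); rewrite ImB ler_norml => /andP[+ _]; lra.
by move=> y y0; rewrite (_ : sqn (hor A y) = sqn (hor B y)) ?bB //; apply/funext => x; rewrite /sqn /hor AB.
Qed.

Lemma in_HE_intro f M M' : entire f -> H2bound (fun z => f z / E z) M ->
  H2bound (fun z => fstar f z / E z) M' -> in_HE E f.
Proof. by move=> ef h h'; split => //; split; [exact: H2bound_H2U h|exact: H2bound_H2U h']. Qed.

Lemma in_HE_D f g : in_HE E f -> in_HE E g -> in_HE E (fun z => f z + g z).
Proof.
move=> /in_HEP[ef [M [h1 h2]]] /in_HEP[eg [M' [k1 k2]]].
apply: (@in_HE_intro _ (2 * M + 2 * M') (2 * M + 2 * M')).
- by move=> z; apply: holoD.
- by apply: H2bound_eq (H2boundD h1 k1) => z _; rewrite mulrDl.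
- by apply: H2bound_eq (H2boundD h2 k2) => z _; rewrite /fstar cconjD mulrDl.
Qed.

Lemma in_HE_Z k f : in_HE E f -> in_HE E (fun z => k * f z).
Proof.
move=> /in_HEP[ef [M [h1 h2]]].
apply: (in_HE_intro (M := absC k ^+ 2 * M + 0 * pi) (M' := absC (cconj k) ^+ 2 * M + 0 * pi)).
- by move=> z; apply: holoM => //; exact: holo_cst.
- by apply: H2bound_eq (H2boundZ k h1) => z _; rewrite mulrA.
- by apply: H2bound_eq (H2boundZ (cconj k) h2) => z _; rewrite /fstar cconjM mulrA.
Qed.

Definition Theta z := fstar E z / E z.

Lemma Theta_holo z : 0 < complex.Im z -> holo_at Theta z.
Proof.
move=> z0; apply: holo_div; [exact: entire_fstar dE.1 z|exact: dE.1|exact: dB_neq0].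
Qed.

Lemma Theta_lt1 z : 0 < complex.Im z -> absC (Theta z) < 1.
Proof.
move=> z0; rewrite /Theta absCM absCV ltr_pdivrMr ?absC_gt0 ?dB_neq0 // mul1r.
by rewrite /fstar absC_conj; exact: dE.2.
Qed.

Lemma Theta_meas : cmeas (fun t => Theta (RtoC t)).
Proof. by apply: cmeas_div; apply: dB_cmeas; [exact: entire_fstar dE.1|exact: dE.1]. Qed.

Lemma Theta_cont : {ae mu, forall x, ccont Theta (RtoC x)}.
Proof.
apply: ae_imp dB_zeros_null => x Ex.
by apply: ccont_div => //; apply: holo_cont; [exact: entire_fstar dE.1 _|exact: dE.1].
Qed.

(** The modulus is 1 off the zeros of E, and 0 at a real zero because of division by 0. *)
Lemma Theta_le1 t : absC (Theta (RtoC t)) <= 1.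
Proof.
rewrite /Theta fstarR absCM absCV absC_conj.
have [->|Et] := eqVneq (absC (E (RtoC t))) 0; first by rewrite mul0r.
by rewrite mulfV.
Qed.

Definition Iy (y : R) : C := iC * RtoC y.

Lemma Im_Iy y : complex.Im (Iy y) = y.
Proof. by rewrite /Iy ImM /= mul0r mul1r add0r. Qed.

Lemma cconj_Iy y : cconj (Iy y) = - Iy y.
Proof. by apply: eqC; rewrite /Iy ?ReN ?ImN /= ?ReM ?ImM /=; ring. Qed.

(* Dividing out a zero in the upper half-plane stays in H(E), and the quotient
   is then in the domain because z q = (z - w) q + w q. *)
Lemma mulz_dom_divdiff N v : 0 < v -> in_HE E N -> N (Iy v) = 0 -> mulz_dom E (divdiff (Iy v) N).
Proof.
move=> v0 hN Nw; have /in_HEP[eN [M [b1 b2]]] := hN; set w := Iy v in Nw *.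
set q := divdiff w N; have eq : entire q by exact: divdiff_entire.
have qE z : q z * (z - w) = N z by rewrite /q divdiffE Nw subr0.
have w0 : 0 < complex.Im w by rewrite Im_Iy.
have [M1 c1] : exists M, H2bound (fun z => q z / E z) M.
  apply: (H2bound_divide v0 b1) => z z0; first by apply: holo_div; [exact: eq|exact: dE.1|exact: dB_neq0].
  by rewrite -/(Iy v) -/w mulrAC qE.
have qsE z : fstar q z * (z + w) = fstar N z.
  by rewrite /fstar -qE cconjM cconjB cconjK cconj_Iy opprK.
(* For the conjugate quotient the divisor is z + w, of modulus at least v on the upper half-plane,
   so no singularity has to be removed. *)
have c2 : H2bound (fun z => fstar q z / E z) (v^-1 ^+ 2 * M + 0 * pi).
  apply: (H2bound_mul b2) => [z z0||z z0]; last 1 first.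
  - rewrite -qsE mulrAC [leRHS]mulrC [absC (_ * (z + w))]absCM -mulrA -[leLHS]mulr1.
    apply: ler_wpM2l; first exact: absC_ge0.
    rewrite ler_pdivlMr // mul1r.
    have := Im_abs (z + w); rewrite ImD Im_Iy; apply: le_trans.
    by apply: le_trans (ler_norm _); lra.
  - apply: holo_div; [exact: entire_fstar eq z|exact: dE.1|exact: dB_neq0].
  - by rewrite invr_ge0 ltW.
have hq : in_HE E q by exact: in_HE_intro eq c1 c2.
split => //; have := in_HE_D hN (in_HE_Z w hq); congr (in_HE _ _).
by apply/funext => z; rewrite -qE; ring.
Qed.

End de_branges.

Lemma cconj_expC z : cconj (expC z) = expC (cconj z).
Proof. by rewrite /expC cconjM cconj_R /= cosN sinN. Qed.

(** * The quotient E^*/E on the imaginary axis *)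

Lemma cvgC_Ccvg u l : cvgC u l -> Ccvg u l.
Proof.
move=> /(proj1 (@seq_cvgP R _ _)) h e e0; have [N hN] := h e e0; exists N => n /hN.
by rewrite subr0 ger0_norm ?absC_ge0.
Qed.

Lemma Ccvg_le u v l m K N0 : Ccvg u l -> Ccvg v m ->
  (forall n, (N0 <= n)%N -> absC (u n - v n) <= K) -> absC (l - m) <= K.
Proof.
move=> ul vm h; apply/ler_addgt0Pl => e e0.
have e2 : 0 < e / 2 by rewrite divr_gt0.
have [N hN] := ul _ e2; have [N' hN'] := vm _ e2.
pose n := (N + N' + N0)%N.
have h1 : absC (u n - l) < e / 2 by apply: hN; rewrite /n -addnA leq_addr.
have h2 : absC (v n - m) < e / 2 by apply: hN'; rewrite /n addnAC leq_addl.
have h3 : absC (u n - v n) <= K by apply: h; rewrite /n leq_addl.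
have t1 := absC_tri (u n) l m; have t2 := absC_tri (v n) (u n) m.
by move: h1; rewrite absCC; lra.
Qed.

Lemma Ccvg_cst (c : C) : Ccvg (fun=> c) c.
Proof. by move=> e e0; exists 0%N => n _; rewrite subrr absC0. Qed.

(** Boundedness of b lets one divide by the limit P only: b - Q/P = (b (P - p) + (p b - Q))/P. *)
Lemma Ccvg_div (p b : nat -> C) (P Q : C) : Ccvg p P -> P != 0 ->
  Ccvg (fun n => p n * b n) Q -> (forall n, absC (b n) <= 1) -> Ccvg b (Q / P).
Proof.
move=> pP P0 pQ b1 e e0; have aP : 0 < absC P by rewrite absC_gt0.
have e2 : 0 < e * absC P / 2 by rewrite divr_gt0 // mulr_gt0.
have [N hN] := pP _ e2; have [N' hN'] := pQ _ e2.
exists (maxn N N') => n; rewrite geq_max => /andP[/hN A /hN' B].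
rewrite (_ : b n - Q / P = (b n * (P - p n) + (p n * b n - Q)) / P); last by field.
rewrite absCM absCV ltr_pdivrMr //.
apply: (le_lt_trans (absCD _ _)); rewrite absCM.
have : absC (b n) * absC (P - p n) <= 1 * absC (P - p n) by apply: ler_wpM2r; rewrite ?absC_ge0.
by move: A; rewrite absCC mul1r; move: (absC (b n) * _) => X; lra.
Qed.

Lemma limit_rate (T : realType) (a r : nat -> T) :
  (forall k l, a k - r k <= a l + r l) -> exists a0, forall k, a k - r k <= a0 <= a k + r k.
Proof.
move=> h; pose S := range (fun k => a k - r k).
have hs : has_sup S.
  by split; [exists (a 0%N - r 0%N), 0%N|exists (a 0%N + r 0%N) => _ [k _ <-]].
exists (sup S) => k; apply/andP; split; first by apply: sup_upper_bound => //; exists k.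
by apply: ge_sup; [exact: hs.1|move=> _ [l _ <-]].
Qed.

(* The real and imaginary parts of [h (k + 1)] are Cauchy sequences with rate 2D/(k + 1). *)
Lemma unimodular_limit (h : R -> C) (D : R) :
  (forall y y', 0 < y -> 0 < y' -> absC (h y - h y') <= D / y + D / y') ->
  (forall y, 0 < y -> 1 - D / y <= absC (h y) <= 1) ->
  exists2 u, absC u = 1 & forall y, 0 < y -> absC (h y - u) <= D / y.
Proof.
move=> hh h1; pose y (k : nat) : R := k.+1%:R; pose r k := D / y k.
have y0 k : 0 < y k by rewrite /y ltr0n.
have key (f : C -> R) : (forall z w, `|f z - f w| <= absC (z - w)) ->
    exists a0, forall k, `|f (h (y k)) - a0| <= r k.
  move=> hf; have [|a0 ha] := @limit_rate R (fun k => f (h (y k))) r.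
    move=> k l; have := le_trans (hf _ _) (hh _ _ (y0 k) (y0 l)).
    by rewrite ler_norml -/(r k) -/(r l) => /andP[_]; move: (r k) (r l) (f _) (f _) => a b c d; lra.
  by exists a0 => k; have /andP[] := ha k; rewrite ler_norml => *; apply/andP; split; lra.
have [a ha] := key (@complex.Re R) (fun z w => eq_ind _ (fun x => `|x| <= _) (Re_abs (z - w)) _ (ReB z w)).
have [b hb] := key (@complex.Im R) (fun z w => eq_ind _ (fun x => `|x| <= _) (Im_abs (z - w)) _ (ImB z w)).
pose u := Complex a b.
have hu k : absC (h (y k) - u) <= 2 * r k.
  apply: le_trans (absC_le _) _; rewrite ReB ImB /=.
  by have := ha k; have := hb k; lra.
have D0 : 0 <= D by have /andP[] := h1 1 ltr01; rewrite divr1; lra.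
have eps e : 0 < e -> exists k, r k < e by move=> e0; exact: le_nat_eps.
exists u.
  apply/eqP; rewrite eq_le; apply/andP; split; apply/ler_addgt0Pl => e e0.
    have e2 : 0 < e / 2 by rewrite divr_gt0.
    have [k hk] := eps _ e2; have /andP[_ k1] := h1 _ (y0 k).
    have := absC_rtri u (h (y k)); rewrite absCC; have := hu k; lra.
  have e3 : 0 < e / 3 by rewrite divr_gt0.
  have [k hk] := eps _ e3; have /andP[k1 _] := h1 _ (y0 k).
  have := absC_rtri (h (y k)) u; have := hu k; move: k1; rewrite -/(r k); lra.
move=> z z0; apply/ler_addgt0Pl => e e0.
have e3 : 0 < e / 3 by rewrite divr_gt0.
have [k hk] := eps _ e3.
have := absC_tri (h (y k)) (h z) u; have := hu k; have := hh _ _ z0 (y0 k); rewrite -/(r k); lra.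
Qed.

Lemma Re_Iy y : complex.Re (Iy y) = 0.
Proof. by rewrite /Iy ReM /= mul0r mulr0 subr0. Qed.

(** * Blaschke products on the imaginary axis *)

Section blaschke.
Variables (K : option nat) (zs : nat -> C).
Hypothesis zs0 : forall n, inZ K n -> 0 < complex.Im (zs n).

(** The Blaschke factor of [zs n], normalised to be 1 at z = 0; it is the quotient of fstar of the
    n-th factor of E by that factor. *)
Definition bfactor n z := (1 - z / zs n) / (1 - z / cconj (zs n)).

Definition bpartial N z := \prod_(1 <= n < N.+1 | inZ K n) bfactor n z.

Lemma zs_neq0 n : inZ K n -> zs n != 0.
Proof. by move=> /zs0; apply: contraTneq => ->; rewrite ltxx. Qed.

Lemma zsc_neq0 n : inZ K n -> cconj (zs n) != 0.
Proof. by move=> kn; rewrite cconj_eq0 zs_neq0. Qed.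

Lemma subzsc_neq0 n z : inZ K n -> 0 < complex.Im z -> cconj (zs n) - z != 0.
Proof.
move=> /zs0 b0 z0; apply/eqP => h; have := congr1 (@complex.Im R) h.
by rewrite ImB /=; lra.
Qed.

Lemma bden_neq0 n z : inZ K n -> 0 < complex.Im z -> 1 - z / cconj (zs n) != 0.
Proof.
move=> kn z0; rewrite -(divff (zsc_neq0 kn)) -mulrBl mulf_neq0 ?invr_eq0 ?zsc_neq0 //.
exact: subzsc_neq0.
Qed.

Lemma bfactorE n z : inZ K n -> 0 < complex.Im z ->
  bfactor n z = cconj (zs n) / zs n * ((zs n - z) / (cconj (zs n) - z)).
Proof.
move=> kn z0; rewrite /bfactor.
have h1 := zs_neq0 kn; have h2 := zsc_neq0 kn; have h3 := subzsc_neq0 kn z0.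
by field; rewrite h1 h2 h3.
Qed.

Lemma absC_bfactor n z : inZ K n -> 0 < complex.Im z ->
  absC (bfactor n z) = absC (zs n - z) / absC (cconj (zs n) - z).
Proof.
move=> kn z0; rewrite bfactorE // !absCM !absCV absC_conj mulfV ?mul1r //.
by rewrite absC_eq0 zs_neq0.
Qed.

Lemma absC_bfactor_le1 n z : inZ K n -> 0 < complex.Im z -> absC (bfactor n z) <= 1.
Proof.
move=> kn z0; rewrite absC_bfactor // ler_pdivrMr ?absC_gt0 ?subzsc_neq0 // mul1r.
rewrite -(@ler_pXn2r _ 2) ?nnegrE ?absC_ge0 // !absC_sqr !ReB !ImB /=.
rewrite lerD2l; have := zs0 kn; rewrite -subr_ge0 => b0.
rewrite (_ : _ - _ = 4 * (complex.Im (zs n) * complex.Im z)); last by ring.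
by rewrite mulr_ge0 // mulr_ge0 // ltW.
Qed.

Lemma bpartialS N z : bpartial N.+1 z =
  bpartial N z * (if inZ K N.+1 then bfactor N.+1 z else 1).
Proof. by rewrite /bpartial big_mkcond big_nat_recr //= -big_mkcond. Qed.

Lemma bpartial0 z : bpartial 0 z = 1.
Proof. by rewrite /bpartial big_geq. Qed.

Lemma bpartial_mono N M z : 0 < complex.Im z -> (N <= M)%N ->
  absC (bpartial M z) <= absC (bpartial N z).
Proof.
move=> z0 /subnK <-; elim: (M - N)%N => [|k IH] //.
rewrite addSn bpartialS absCM -[leRHS]mulr1; apply: ler_pM => //; try exact: absC_ge0.
by case: ifP => [kn|_]; [exact: absC_bfactor_le1|rewrite absC1].
Qed.

Lemma bpartial_le1 N z : 0 < complex.Im z -> absC (bpartial N z) <= 1.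
Proof. by move=> z0; have := bpartial_mono z0 (leq0n N); rewrite bpartial0 absC1. Qed.

(* The exponential convergence factors are symmetric, hence cancel in E^*/E. *)
Lemma fstar_dB_partial N z : 0 < complex.Im z ->
  fstar (dB_partial K zs N) z = dB_partial K zs N z * bpartial N z.
Proof.
move=> z0; rewrite /fstar /dB_partial /bpartial -big_split /=.
have c1 : cconj 1 = 1 by rewrite -[1]/(RtoC 1) cconj_R.
rewrite (big_morph cconj cconjM c1); apply: eq_bigr => n kn.
rewrite /dB_factor /bfactor cconjM cconj_expC cconjB cconj_div cconjK c1 cconjK.
set e1 := expC _; set e2 := expC _.
have -> : e1 = e2.
  congr expC; rewrite cconj_div cconjD cconjK [X in X / _]addrC.
  by congr (_ / _); rewrite -RtoC_nat cconj_R.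
have d0 := bden_neq0 kn z0; move: (1 - z / zs n) => a.
by move: (1 - z / cconj (zs n)) e2 d0 => d e2 d0; field.
Qed.

Definition Imsum N := \sum_(1 <= n < N.+1 | inZ K n) complex.Im (zs n).

Lemma ImsumS N : Imsum N.+1 = Imsum N + (if inZ K N.+1 then complex.Im (zs N.+1) else 0).
Proof. by rewrite /Imsum big_mkcond big_nat_recr //= -big_mkcond. Qed.

Lemma Imsum0 : Imsum 0 = 0.
Proof. by rewrite /Imsum big_geq. Qed.

Lemma Imsum_ge0 N : 0 <= Imsum N.
Proof. by apply: sumr_ge0 => n /zs0/ltW. Qed.

(** The squared distances from iy to z_n and to its conjugate differ by 4 y Im z_n, and the larger
    one is at most 4 y^2 when |z_n| <= y. *)
Lemma bfactor_sqr_le n M y : inZ K n -> 0 < y -> M <= y -> absC (zs n) <= M ->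
  absC (bfactor n (Iy y)) ^+ 2 <= 1 - complex.Im (zs n) / y.
Proof.
move=> kn y0 My zM; have b0 := zs0 kn.
have d0 := subzsc_neq0 kn (eq_ind_r (fun x => 0 < x) y0 (Im_Iy y)).
rewrite absC_bfactor ?Im_Iy // exprMn exprVn ler_pdivrMr ?exprn_gt0 ?absC_gt0 //.
have -> : absC (zs n - Iy y) ^+ 2 =
    absC (cconj (zs n) - Iy y) ^+ 2 - 4 * (complex.Im (zs n) * y).
  by rewrite !absC_sqr !ReB !ImB Re_Iy Im_Iy /=; ring.
have : absC (cconj (zs n) - Iy y) ^+ 2 <= 4 * y ^+ 2.
  rewrite (_ : 4 * y ^+ 2 = (2 * y) ^+ 2); last by ring.
  have y2 : 0 <= 2 * y by rewrite mulr_ge0 // ltW.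
  rewrite ler_pXn2r ?nnegrE ?absC_ge0 //.
  apply: le_trans (absCB _ _) _; rewrite absC_conj /Iy absCM absC_i mul1r absC_R gtr0_norm //.
  by lra.
move: (absC _ ^+ 2) => X hX.
rewrite mulrBl mul1r lerD2l lerN2 mulrAC ler_pdivrMr // mulrC.
rewrite (_ : 4 * _ * y = 4 * y ^+ 2 * complex.Im (zs n)); last by ring.
by apply: ler_wpM2r => //; exact: ltW.
Qed.

(** A product of factors 1 - t_n is at most 1/(1 + sum t_n); the induction step is (1 - t) (1 + S +
    t) <= 1 + S, with t_n = Im z_n / y. *)
Lemma bpartial_decay N M y : 0 < y -> M <= y ->
  (forall n, inZ K n -> (n <= N)%N -> absC (zs n) <= M) ->
  absC (bpartial N (Iy y)) ^+ 2 * (1 + Imsum N / y) <= 1.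
Proof.
move=> y0 My; elim: N => [|N IH] zM; first by rewrite bpartial0 Imsum0 absC1 expr1n mul0r addr0 mulr1.
have {}IH := IH (fun n kn nN => zM n kn (leqW nN)).
rewrite bpartialS ImsumS; case: ifP => [kn|_]; last by rewrite mulr1 addr0.
rewrite absCM exprMn; apply: le_trans IH; rewrite -mulrA ler_wpM2l ?sqr_ge0 //.
have h := bfactor_sqr_le kn y0 My (zM _ kn (leqnn _)).
have S0 : 0 <= Imsum N / y by rewrite divr_ge0 ?Imsum_ge0 // ltW.
have t0 : 0 <= complex.Im (zs N.+1) / y by rewrite divr_ge0 ?ltW // zs0.
apply: (@le_trans _ _ ((1 - complex.Im (zs N.+1) / y) * (1 + (Imsum N + complex.Im (zs N.+1)) / y))).
  apply: ler_wpM2r => //; rewrite mulrDl; lra.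
rewrite (mulrDl (Imsum N)); move: (_ / y) (_ / y) t0 S0 => t S t0 S0.
rewrite -subr_ge0 (_ : _ - _ = S * t + S * S); last by ring.
by rewrite addr_ge0 // mulr_ge0.
Qed.

(** The limit of [bpartial N] at infinity, a number of modulus 1. *)
Definition bconst N := \prod_(1 <= n < N.+1 | inZ K n) (cconj (zs n) / zs n).

Lemma absC_bconst N : absC (bconst N) = 1.
Proof.
rewrite /bconst (big_morph absC absCM absC1) big1 // => n kn.
by rewrite absCM absCV absC_conj mulfV // absC_eq0 zs_neq0.
Qed.

(** The difference is a unimodular number times 2i Im z_n / (conj z_n - iy), and the denominator has
    imaginary part of modulus at least y. *)
Lemma bfactor_close n y : inZ K n -> 0 < y ->
  absC (bfactor n (Iy y) - cconj (zs n) / zs n) <= 2 * complex.Im (zs n) / y.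
Proof.
move=> kn y0; have b0 := zs0 kn; have Iy0 : 0 < complex.Im (Iy y) by rewrite Im_Iy.
have d0 := subzsc_neq0 kn Iy0.
rewrite bfactorE // (_ : _ - _ = cconj (zs n) / zs n *
  ((zs n - cconj (zs n)) / (cconj (zs n) - Iy y))); last first.
  by field; rewrite d0 zs_neq0.
rewrite !absCM !absCV absC_conj mulfV ?absC_eq0 ?zs_neq0 // mul1r.
have -> : absC (zs n - cconj (zs n)) = 2 * complex.Im (zs n).
  rewrite (_ : _ - _ = iC * RtoC (2 * complex.Im (zs n))).
    by rewrite absCM absC_i mul1r absC_R gtr0_norm // mulr_gt0.
  by apply: eqC; rewrite ?ReB ?ImB ?ReM ?ImM /=; ring.
apply: ler_wpM2l; first by rewrite mulr_ge0 // ltW.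
rewrite lef_pV2 ?posrE ?absC_gt0 //; apply: le_trans (Im_abs _).
by rewrite ImB Im_Iy /= -normrN opprB opprK; apply: le_trans (ler_norm _); lra.
Qed.

Lemma bpartial_close N y : 0 < y ->
  absC (bpartial N (Iy y) - bconst N) <= 2 * Imsum N / y.
Proof.
move=> y0; have Iy0 : 0 < complex.Im (Iy y) by rewrite Im_Iy.
elim: N => [|N IH].
  by rewrite bpartial0 /bconst big_geq // subrr absC0 Imsum0 mulr0 mul0r.
have -> : bconst N.+1 = bconst N * (if inZ K N.+1 then cconj (zs N.+1) / zs N.+1 else 1).
  by rewrite /bconst big_mkcond big_nat_recr //= -big_mkcond.
rewrite bpartialS ImsumS; case: ifP => [kn|_]; last by rewrite !mulr1 addr0.
have h := bfactor_close kn y0.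
set b := bfactor _ _ in h *; set c := _ / zs _ in h *.
rewrite (_ : _ - _ = (bpartial N (Iy y) - bconst N) * b + bconst N * (b - c)); last by ring.
apply: le_trans (absCD _ _) _; rewrite (absCM _ (b - c)) (absCM _ b) absC_bconst mul1r.
rewrite mulrDr mulrDl; apply: lerD => //.
by apply: le_trans IH; rewrite -[leRHS]mulr1 ler_wpM2l ?absC_ge0 // absC_bfactor_le1.
Qed.

Lemma Imsum_unbounded : (\sum_(1 <= n <oo | inZ K n) (complex.Im (zs n))%:E = +oo)%E ->
  forall A : R, exists N, A <= Imsum N.
Proof.
move=> h A; apply: contrapT => nA.
suff : (\sum_(1 <= n <oo | inZ K n) (complex.Im (zs n))%:E <= A%:E)%E by rewrite h leNgt ltry.
apply: lime_le; first by apply: is_cvg_nneseries => n _ kn; rewrite lee_fin ltW ?zs0.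
apply: nearW => N; rewrite sumEFin lee_fin leNgt; apply/negP => hN; apply: nA; exists N.-1.
by case: N hN => [|N] hN; [rewrite Imsum0; move: hN; rewrite big_geq // => /ltW|exact: ltW].
Qed.

Lemma Imsum_bounded : (\sum_(1 <= n <oo | inZ K n) (complex.Im (zs n))%:E <> +oo)%E ->
  exists B : R, forall N, Imsum N <= B.
Proof.
have ge N : ((Imsum N)%:E <= \sum_(1 <= n <oo | inZ K n) (complex.Im (zs n))%:E)%E.
  rewrite /Imsum -sumEFin; apply: (@nneseries_lim_ge R _ (inZ K) 1 N.+1) => n _ kn.
  by rewrite lee_fin ltW ?zs0.
case: (limn _) ge => [B ge _| |ge] //; first by exists B => N; rewrite -lee_fin.
by have := ge 0%N.
Qed.

End blaschke.

Lemma expR_inv_le (x : R) : 0 <= x -> expR (- x) * (1 + x) <= 1.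
Proof.
move=> x0; rewrite expRN mulrC ler_pdivrMr ?expR_gt0 // mul1r; exact: expR_ge1Dx.
Qed.

Lemma Ccvg_fstar (f : nat -> C -> C) (g : C -> C) z :
  Ccvg (fun n => f n (cconj z)) (g (cconj z)) -> Ccvg (fun n => fstar (f n) z) (fstar g z).
Proof. by move=> h e e0; have [N hN] := h e e0; exists N => n /hN; rewrite /fstar -cconjB absC_conj. Qed.

Section factorization.
Variables (E G P : C -> C) (gamma : C) (sigma : R) (K : option nat) (zs : nat -> C).
Hypothesis dE : deBranges E.
Hypothesis zs0 : forall n, inZ K n -> 0 < complex.Im (zs n).
Hypothesis sigma0 : 0 <= sigma.
Hypothesis gamma1 : absC gamma = 1.
Hypothesis Gstar : forall z, G z = fstar G z.
Hypothesis cvgP : forall z, cvgC (fun N => dB_partial K zs N z) (P z).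
Hypothesis EE : forall z, E z = gamma * G z * expC (- (iC * RtoC sigma * z)) * P z.

Lemma fact_neq0 z : 0 < complex.Im z -> G z != 0 /\ P z != 0.
Proof.
by move=> /(dB_neq0 dE); rewrite EE !mulf_eq0 !negb_or => /andP[/andP[/andP[_ ->] _] ->].
Qed.

(** The partial products converge to P, and multiplied by the partial Blaschke products they become
    their own fstar, which converges to fstar P. *)
Lemma bpartial_cvg z : 0 < complex.Im z -> Ccvg (fun N => bpartial K zs N z) (Theta P z).
Proof.
move=> z0; have [_ P0] := fact_neq0 z0.
apply: (Ccvg_div (cvgC_Ccvg (cvgP z)) P0) => [|N]; last exact: bpartial_le1.
have := @Ccvg_fstar (dB_partial K zs) P z (cvgC_Ccvg (cvgP (cconj z))).
by move=> h e e0; have [N hN] := h e e0; exists N => n /hN; rewrite fstar_dB_partial.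
Qed.

(** G cancels because G = G^*. At iy the exponential is e^(sigma y), and its fstar is e^(-sigma
    y). *)
Lemma Theta_factor y : 0 < y ->
  Theta E (Iy y) = cconj gamma / gamma * RtoC (expR (- (2 * (sigma * y)))) * Theta P (Iy y).
Proof.
move=> y0; have z0 : 0 < complex.Im (Iy y) by rewrite Im_Iy.
have [G0 P0] := fact_neq0 z0.
have g0 : gamma != 0 by rewrite -absC_gt0 gamma1.
have es (s : R) : expC (RtoC s) = RtoC (expR s) by rewrite /expC /= cos0 sin0 -[Complex 1 0]/(1 : C) mulr1.
have h1 : - (iC * RtoC sigma * Iy y) = RtoC (sigma * y).
  by apply: eqC; rewrite ?ReN ?ImN ?ReM ?ImM ?Re_Iy ?Im_Iy /=; ring.
have h2 : cconj (- (iC * RtoC sigma * cconj (Iy y))) = RtoC (- (sigma * y)).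
  by rewrite cconj_Iy mulrN opprK; apply: eqC => /=; ring.
rewrite /Theta {1}/fstar !EE h1 (cconjM _ (P _)) (cconjM _ (expC _)) (cconjM gamma) cconj_expC h2.
rewrite -/(fstar G _) -Gstar -/(fstar P _) !es.
have -> : expR (- (2 * (sigma * y))) = expR (- (sigma * y)) / expR (sigma * y).
  by rewrite mulr_natl mulr2n opprD exp.expRD !expRN.
have e0 : RtoC (expR (sigma * y)) != 0 by rewrite -absC_gt0 absC_R normr_gt0 gt_eqF ?expR_gt0.
by rewrite RtoCM RtoCV; field; rewrite g0 e0 G0 P0.
Qed.

(** The moduli of partial Blaschke products decrease, so the limit lies below every one of them. *)
Lemma Theta_abs_le N y : 0 < y ->
  absC (Theta E (Iy y)) <= expR (- (2 * (sigma * y))) * absC (bpartial K zs N (Iy y)).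
Proof.
move=> y0; have z0 : 0 < complex.Im (Iy y) by rewrite Im_Iy.
have : absC (Theta P (Iy y) - 0) <= absC (bpartial K zs N (Iy y)).
  apply: (Ccvg_le (N0 := N) (bpartial_cvg z0) (@Ccvg_cst 0)) => n Nn.
  by rewrite subr0; exact: bpartial_mono.
rewrite Theta_factor // subr0; move: (Theta P _) => t ht.
rewrite !absCM absCV absC_conj gamma1 divr1 mul1r absC_R ger0_norm ?expR_ge0 //.
by apply: ler_wpM2l; first exact: expR_ge0.
Qed.

Lemma Theta_defect_unbounded :
  0 < sigma \/ (\sum_(1 <= n <oo | inZ K n) (complex.Im (zs n))%:E = +oo)%E ->
  forall A : R, exists N, forall n, (N <= n)%N ->
    A <= n.+1%:R * (1 - absC (Theta E (Iy n.+1%:R)) ^+ 2).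
Proof.
have nat_ge (A : R) : exists N, forall n, (N <= n)%N -> A <= n.+1%:R.
  exists (Num.bound `|A|) => n Nn; apply: le_trans (ler_norm _) _.
  apply: le_trans (ltW (archi_boundP (normr_ge0 A))) _.
  by rewrite ler_nat ltnW // ltnS.
(* Both cases bound t = |Theta|^2 by 1/(1 + s/y). Since 1/(1 + r) <= 1 - r/2 for r in [0, 1], this
   gives y (1 - t) >= s/2. *)
have step (y t s A : R) : 0 < y -> 0 <= t -> 0 < s -> t * (1 + s / y) <= 1 -> s <= y -> 2 * A <= s ->
    A <= y * (1 - t).
  move=> y0 t0 s0 h sy As.
  have t1 : t <= 1 - s / (2 * y).
    have sy1 : s / y <= 1 by rewrite ler_pdivrMr // mul1r.
    have sy0 : 0 < s / y by rewrite divr_gt0.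
    rewrite (_ : s / (2 * y) = (s / y) / 2); last by field; rewrite gt_eqF.
    move: (s / y) h sy1 sy0 => r h r1 r0.
    rewrite -(ler_pM2r (_ : 0 < 1 + r)); last by lra.
    apply: le_trans h _; rewrite -subr_ge0 (_ : _ - 1 = r * (1 - r) / 2); last by field.
    by rewrite divr_ge0 // mulr_ge0 ?subr_ge0 // (ltW r0).
  apply: (@le_trans _ _ (y * (s / (2 * y)))); last by apply: ler_wpM2l; [exact: ltW|lra].
  by rewrite (_ : y * _ = s / 2); [lra|field; rewrite gt_eqF].
move=> hyp A; pose s := 2 * `|A| + 1.
have As : 2 * A <= s by have := ler_norm A; rewrite /s; lra.
have s0 : 0 < s by rewrite /s; have := normr_ge0 A; lra.
case: hyp => [sp|inf].
  have [N1 h1] := nat_ge s; have [N2 h2] := nat_ge (1 / (4 * sigma)).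
  exists (maxn N1 N2) => n; rewrite geq_max => /andP[/h1 n1 /h2 n2].
  have y0 : (0 : R) < n.+1%:R by rewrite ltr0n.
  move: n.+1%:R y0 n1 n2 => y y0 n1 n2; apply: (step y _ s) => //; first exact: sqr_ge0.
  have := Theta_abs_le 0 y0; rewrite bpartial0 absC1 mulr1 => h.
  (* Here |Theta|^2 <= e^(-4 sigma y), and s <= y together with 1 <= 4 sigma y gives s/y <= 4 sigma
     y. *)
  apply: (@le_trans _ _ (expR (- (4 * sigma * y)) * (1 + 4 * sigma * y))).
    apply: ler_pM; [exact: sqr_ge0|by rewrite addr_ge0 // divr_ge0 // ltW| |].
      rewrite (_ : expR (- (4 * sigma * y)) = expR (- (2 * (sigma * y))) ^+ 2).
        by rewrite ler_pXn2r ?nnegrE ?absC_ge0 ?expR_ge0.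
      by rewrite -expRM_natl; congr expR; ring.
    rewrite lerD2l ler_pdivrMr //.
    have s4 : 0 < 4 * sigma by rewrite mulr_gt0.
    move: n2; rewrite ler_pdivrMr // mulrC => n2; apply: le_trans n1 _.
    by rewrite -[leLHS]mul1r; apply: ler_wpM2r => //; exact: ltW.
  by apply: expR_inv_le; rewrite !mulr_ge0 // ltW.
have [N hN] := Imsum_unbounded zs0 inf s.
(* N is fixed before y, so finitely many zeros are involved and one M bounds them all. *)
pose M := \sum_(n < N.+1) absC (zs n).
have hM n : inZ K n -> (n <= N)%N -> absC (zs n) <= M.
  move=> _ nN; rewrite /M (bigD1 (Ordinal (nN : (n < N.+1)%N))) //= lerDl.
  by apply: sumr_ge0 => i _; exact: absC_ge0.
have [N1 h1] := nat_ge s; have [N2 h2] := nat_ge M.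
exists (maxn N1 N2) => n; rewrite geq_max => /andP[/h1 n1 /h2 n2].
have y0 : (0 : R) < n.+1%:R by rewrite ltr0n.
move: n.+1%:R y0 n1 n2 => y y0 n1 n2; apply: (step y _ s) => //; first exact: sqr_ge0.
apply: le_trans (bpartial_decay zs0 y0 n2 hM).
apply: ler_pM; [exact: sqr_ge0|by rewrite addr_ge0 // divr_ge0 // ltW| |].
  rewrite ler_pXn2r ?nnegrE ?absC_ge0 //; apply: le_trans (Theta_abs_le N y0) _.
  rewrite -[leRHS]mul1r; apply: ler_wpM2r; first exact: absC_ge0.
  by rewrite expR_le1 oppr_le0 !mulr_ge0 // ltW.
by rewrite lerD2l ler_wpM2r // invr_ge0 ltW.
Qed.

(** Each partial product stays within 2B/y of a unimodular constant with B independent of N. So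
    values at y and y' differ by at most 2B/y + 2B/y', which survives the limit in N although the
    constants depend on N. *)
Lemma Theta_unimodular_limit : sigma = 0 ->
  (\sum_(1 <= n <oo | inZ K n) (complex.Im (zs n))%:E <> +oo)%E ->
  exists u, absC u = 1 /\ exists D, forall y, 0 < y -> absC (Theta E (Iy y) - u) <= D / y.
Proof.
move=> s0 fin; have [B hB] := Imsum_bounded zs0 fin.
have close N y : 0 < y -> absC (bpartial K zs N (Iy y) - bconst K zs N) <= 2 * B / y.
  move=> y0; apply: le_trans (bpartial_close zs0 N y0) _.
  by apply: ler_wpM2r; [rewrite invr_ge0 ltW|rewrite ler_wpM2l].
have Iy0 y : 0 < y -> 0 < complex.Im (Iy y) by rewrite Im_Iy.
have [y y' y0 y'0|y y0|u u1 hu] := @unimodular_limit (fun y => Theta P (Iy y)) (2 * B).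
- apply: (Ccvg_le (N0 := 0) (bpartial_cvg (Iy0 _ y0)) (bpartial_cvg (Iy0 _ y'0))) => N _.
  apply: le_trans (absC_tri (bconst K zs N) _ _) _.
  by apply: lerD; [exact: close|rewrite absCC; exact: close].
- apply/andP; split; last first.
    rewrite -(subr0 (Theta P _)).
    apply: (Ccvg_le (N0 := 0) (bpartial_cvg (Iy0 _ y0)) (@Ccvg_cst 0)) => n _.
    by rewrite subr0; apply: bpartial_le1 => //; exact: Iy0.
  apply/ler_addgt0Pl => e e0; have [N hN] := bpartial_cvg (Iy0 _ y0) e0.
  have := hN N (leqnn N); have := close N y y0.
  have := absC_rtri (bpartial K zs N (Iy y)) (Theta P (Iy y)).
  have := absC_rtri (bconst K zs N) (bpartial K zs N (Iy y)).
  rewrite (absC_bconst zs0) absCC; move: (_ / y) => r; lra.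
exists (cconj gamma / gamma * u); split.
  by rewrite !absCM absCV absC_conj gamma1 u1 divr1 mulr1.
exists (2 * B) => y y0; rewrite Theta_factor // s0 mul0r mulr0 oppr0 exp.expR0 -[RtoC 1]/(1 : C) mulr1.
have := hu y y0; move: (Theta P _) => t.
by rewrite -mulrBr !absCM absCV absC_conj gamma1 divr1 mul1r.
Qed.

End factorization.

(** * Failure of density *)

Lemma ReZ (k : R) z : complex.Re (RtoC k * z) = k * complex.Re z.
Proof. by rewrite ReM mul0r subr0. Qed.

(** Restates Poisson's formula as an exact value of an extended integral of a nonnegative function,
    the form in which norms are estimated. *)
Lemma poisson_affine T v (c d : R) : 0 < v ->
  (forall z, 0 < complex.Im z -> holo_at T z) ->
  (forall z, 0 < complex.Im z -> absC (T z) <= 1) -> cmeas (fun t => T (RtoC t)) ->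
  {ae mu, forall x, ccont T (RtoC x)} -> (forall t, absC (T (RtoC t)) <= 1) ->
  (forall t, 0 <= c - d * complex.Re (T (RtoC t))) ->
  nnint (fun t => (c - d * complex.Re (T (RtoC t))) * cauchyG v t) =
    (pi / v * (c - d * complex.Re (T (Iy v))))%:E.
Proof.
move=> v0 hT T1 mT cT bT T0; set g := cauchyG v.
have iG : mu.-integrable setT (EFin \o g) := integrable_cauchyG v0.
have iT : cintble (fun t => T (RtoC t) * RtoC (g t)).
  apply: (cintble_le (g := g)) => //.
    by apply: cmeasM => //; split; [exact: mfun_cauchyG|exact: mfun_cst].
  move=> t; rewrite absCM absC_R ger0_norm ?cauchyG_ge0 //.
  by rewrite -[leRHS]mul1r; apply: ler_wpM2r; [exact: cauchyG_ge0|exact: bT].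
have E1 t : (c - d * complex.Re (T (RtoC t))) * g t =
    c * g t - d * complex.Re (T (RtoC t) * RtoC (g t)).
  by rewrite ReM /=; ring.
have i1 := integrableZ_real c iG; have i2 := integrableZ_real d iT.1.
have i3 : mu.-integrable setT (EFin \o (fun t => (c - d * complex.Re (T (RtoC t))) * g t)).
  have := integrableB_real i1 i2; congr (integrable _ _ _); apply/funext => t /=.
  by rewrite -E1.
rewrite nnint_Rintegral //; last by move=> t; rewrite mulr_ge0 ?T0 ?cauchyG_ge0.
congr (_%:E); under eq_Rintegral => t _ do rewrite E1.
rewrite RintegralB // !RintegralZl //; last exact: iT.1.
have -> : \int[mu]_t g t = pi / v.
  by have := congr1 (@complex.Re R) (cint_cauchyG v0).
have := congr1 (@complex.Re R) (poisson v0 hT T1 mT cT); rewrite /cint /= => ->.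
by rewrite ReZ -/(Iy v); ring.
Qed.

Section orthogonality.
Variable E : C -> C.
Hypothesis dE : deBranges E.

Lemma HE_norm2E f : HE_norm2 E f = nnint (sqn (fun t => f (RtoC t) / E (RtoC t))).
Proof. by apply: eq_integral => x _; rewrite /sqn absCM absCV. Qed.

Lemma in_HE_bv f : in_HE E f -> exists M,
  bvH2 (fun z => f z / E z) M /\ bvH2 (fun z => fstar f z / E z) M.
Proof.
move=> /in_HEP[ef [M [h1 h2]]]; exists M; split; apply: dB_quot_bv => //.
exact: entire_fstar.
Qed.

Lemma cint_shift_mul f (A : C -> C) M : bvH2 A M -> (forall t, A (RtoC t) = (RtoC t + Iy 1) * f t) ->
  cintble f /\ cint f = 0.
Proof.
move=> bA Af.
have fE : f = fun t => A (RtoC t) / (RtoC t + Iy 1).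
  by apply/funext => t; rewrite Af mulrC mulKf // kern_p_neq0.
split; last by rewrite fE; exact: bv_cauchy0 bA ltr01.
rewrite fE; apply: cdom_cintble (kern_p_cdom 1 (bv_meas bA) (bv_bdry bA)).
  by move=> x; exact: cauchyG_ge0.
exact: integrable_cauchyG.
Qed.

Lemma mulz_dom_cint g : mulz_dom E g ->
  (cintble (fun t => g (RtoC t) / E (RtoC t)) /\
     cint (fun t => g (RtoC t) / E (RtoC t)) = 0) /\
  (cintble (fun t => fstar g (RtoC t) / E (RtoC t)) /\
     cint (fun t => fstar g (RtoC t) / E (RtoC t)) = 0).
Proof.
move=> [hg hzg]; split.
  have [M [bA _]] := in_HE_bv (in_HE_D hzg (in_HE_Z (Iy 1) hg)).
  by apply: (cint_shift_mul bA) => t; rewrite -mulrDl mulrA.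
(* The shift has the opposite sign because fstar of (z - i) g is (z + i) fstar g. *)
have [M [_ bA]] := in_HE_bv (in_HE_D hzg (in_HE_Z (- Iy 1) hg)).
apply: (cint_shift_mul bA) => t.
by rewrite /fstar cconjD !cconjM cconjK cconjN cconj_Iy opprK -mulrDl mulrA.
Qed.

Section defect.
Variables (u : C) (D : R).
Hypothesis u1 : absC u = 1.
Hypothesis uD : forall y, 0 < y -> absC (Theta E (Iy y) - u) <= D / y.

(** With u replaced by Theta(w) this is the numerator of the reproducing kernel at w. *)
Definition defect z := E z - cconj u * fstar E z.

Lemma mul_conj_u : u * cconj u = 1.
Proof. by rewrite mulC_conj u1 expr1n. Qed.

Lemma fstar_defect z : fstar defect z = - u * defect z.
Proof.
rewrite /defect {1}/fstar cconjB cconjM cconjK -[cconj (fstar E _)]/(fstar (fstar E) z) fstarK.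
rewrite [RHS](_ : _ = u * cconj u * fstar E z - u * E z); last by ring.
by rewrite mul_conj_u mul1r.
Qed.

Lemma entire_defect : entire defect.
Proof.
move=> z; apply: holoB; first exact: dE.1.
by apply: holoM; [exact: holo_cst|exact: entire_fstar dE.1 z].
Qed.

Lemma defect_quot z : 0 < complex.Im z -> defect z / E z = 1 - cconj u * Theta E z.
Proof. by move=> z0; rewrite /defect mulrBl divff ?dB_neq0 // /Theta mulrA. Qed.

Lemma defect_D_ge0 : 0 <= D.
Proof. by have := uD ltr01; rewrite divr1; apply: le_trans; exact: absC_ge0. Qed.

(** On a fixed line |1 - T|^2 <= 2 - 2 Re T. Integrated against v^2/(t^2 + v^2) the right side is 2
    pi v (1 - Re T(iv)) by Poisson's formula, at most 2 pi D by the rate hypothesis. As v grows the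
    weight tends to 1 and Fatou's lemma applies. *)
Lemma defect_H2bound : H2bound (fun z => defect z / E z) (2 * pi * D).
Proof.
split.
  by move=> z z0; apply: holo_div; [exact: entire_defect|exact: dE.1|exact: dB_neq0].
(* Shifting by i eta puts the line inside the half-plane, so T is continuous at every real point. *)
move=> eta eta0; pose T z := cconj u * Theta E (z + Iy eta).
have Im_sh z : complex.Im (z + Iy eta) = complex.Im z + eta by rewrite ImD Im_Iy.
have hT z : - eta < complex.Im z -> holo_at T z.
  move=> ze; apply: holoM; first exact: holo_cst.
  apply: (@holo_comp (Theta E) (fun z => z + Iy eta)).
    by apply: holoD; [exact: holo_id|exact: holo_cst].
  by apply: Theta_holo => //; rewrite Im_sh; lra.
have T1 z : - eta < complex.Im z -> absC (T z) <= 1.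
  move=> ze; rewrite /T absCM absC_conj u1 mul1r; apply: ltW; apply: Theta_lt1 => //.
  by rewrite Im_sh; lra.
have tR t : - eta < complex.Im (RtoC t) by rewrite /= oppr_lt0.
have hU z : 0 < complex.Im z -> - eta < complex.Im z by move=> z0; lra.
have mT : cmeas (fun t => T (RtoC t)).
  by apply: cmeas_cont => t; apply: ccont_rccont; apply: holo_cont; exact: hT (tR t).
have cT : {ae mu, forall x, ccont T (RtoC x)}.
  by apply: aeW => x; apply: holo_cont; exact: hT (tR x).
have horE t : hor (fun z => defect z / E z) eta t = 1 - T (RtoC t).
  have -> : hor (fun z => defect z / E z) eta t = defect (RtoC t + Iy eta) / E (RtoC t + Iy eta).
    by rewrite /hor (ComplexE t eta).
  by rewrite defect_quot // Im_sh /= add0r.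
have mh : cmeas (hor (fun z => defect z / E z) eta).
  rewrite (_ : hor _ _ = fun t => 1 - T (RtoC t)); last exact/funext.
  by apply: cmeasB => //; exact: cmeas_cst.
have sq t : sqn (hor (fun z => defect z / E z) eta) t <= 2 - 2 * complex.Re (T (RtoC t)).
  rewrite /sqn horE absC_sqr ReB ImB /=.
  have : absC (T (RtoC t)) ^+ 2 <= 1 by rewrite expr_le1 ?absC_ge0 // T1.
  rewrite absC_sqr; move: (complex.Re _) (complex.Im _) => X Y h.
  by rewrite -subr_ge0 (_ : _ - _ = 1 - (X ^+ 2 + Y ^+ 2)) ?subr_ge0 //; ring.
have v0 n : (0 : R) < n.+1%:R by rewrite ltr0n.
have mv n : mfun (fun t => sqn (hor (fun z => defect z / E z) eta) t * (n.+1%:R ^+ 2 * cauchyG n.+1%:R t)).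
  apply: mfunM; first exact: mfun_sqn.
  by apply: mfunM; [exact: mfun_cst|exact: mfun_cauchyG].
apply: (@fatou_real R (fun n t => sqn (hor (fun z => defect z / E z) eta) t *
    (n.+1%:R ^+ 2 * cauchyG n.+1%:R t))) => //.
- exact: mfun_sqn.
- by move=> n t; rewrite mulr_ge0 ?sqn_ge0 // mulr_ge0 ?sqr_ge0 ?cauchyG_ge0.
- by move=> t; exact: sqn_ge0.
- apply: aeW => t; move: (sqn _ t) (sqn_ge0 (hor (fun z => defect z / E z) eta) t) => a a0.
  apply: (proj2 (@seq_cvgP R _ _)) => e e0; have [N hN] := le_nat_eps (a * t ^+ 2) e0.
  exists N => n Nn; apply: le_lt_trans hN.
  have v1 : (1 : R) <= n.+1%:R by rewrite ler1n.
  have vN : (N.+1%:R : R) <= n.+1%:R by rewrite ler_nat ltnS.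
  have N1 : (0 : R) < N.+1%:R by rewrite ltr0n.
  have := v0 n; move: (n.+1%:R : R) (N.+1%:R : R) v1 vN N1 => v w v1 vw w0 v0'.
  have d0 : 0 < t ^+ 2 + v ^+ 2 by exact: cauchyG_gt0.
  rewrite (_ : _ - a = - (a * t ^+ 2 / (t ^+ 2 + v ^+ 2))); last by rewrite /cauchyG; field; rewrite gt_eqF.
  rewrite normrN ger0_norm; last by apply: divr_ge0; [exact: mulr_ge0 a0 (sqr_ge0 t)|exact: ltW].
  apply: ler_wpM2l; first exact: mulr_ge0 a0 (sqr_ge0 t).
  rewrite lef_pV2 ?posrE //.
  have : v * 1 <= v ^+ 2 by rewrite expr2 ler_wpM2l // ltW.
  have := sqr_ge0 t; move: (_ ^+ 2) (_ ^+ 2) => X Y; lra.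
move=> n; have := v0 n; have := mv n; move: (n.+1%:R : R) => v mv' v0'.
have Re0 t : 0 <= 2 - 2 * complex.Re (T (RtoC t)) by apply: le_trans (sq t); exact: sqn_ge0.
have P := poisson_affine v0' (fun z z0 => hT z (hU z z0)) (fun z z0 => T1 z (hU z z0)) mT cT
  (fun t => T1 _ (tR t)) Re0.
apply: (@le_trans _ _ (nnint (fun t => v ^+ 2 * ((2 - 2 * complex.Re (T (RtoC t))) * cauchyG v t))%R)).
  apply: nnint_le => //.
  - apply: mfunM; [exact: mfun_cst|apply: mfunM; last exact: mfun_cauchyG].
    by apply: mfunB; [exact: mfun_cst|apply: mfunM; [exact: mfun_cst|exact: mT.1]].
  - by move=> t; rewrite mulr_ge0 ?sqn_ge0 // mulr_ge0 ?sqr_ge0 ?cauchyG_ge0.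
  - by move=> t; rewrite mulrCA ler_wpM2l ?sqr_ge0 // ler_wpM2r ?cauchyG_ge0.
rewrite nnintZ ?sqr_ge0 //; last 2 first.
- apply: mfunM; last exact: mfun_cauchyG.
  by apply: mfunB; [exact: mfun_cst|apply: mfunM; [exact: mfun_cst|exact: mT.1]].
- by move=> t; rewrite mulr_ge0 ?cauchyG_ge0.
rewrite P -EFinM lee_fin.
have Tv : 1 - complex.Re (T (Iy v)) <= D / v.
  have -> : 1 - complex.Re (T (Iy v)) = complex.Re (cconj u * (u - Theta E (Iy (v + eta)))).
    rewrite mulrBr mulrC mul_conj_u ReB /= /T.
    by congr (1 - complex.Re (_ * Theta E _)); apply: eqC; rewrite ?ReD ?ImD ?Re_Iy ?Im_Iy ?addr0.
  apply: le_trans (ler_norm _) (le_trans (Re_abs _) _).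
  rewrite absCM absC_conj u1 mul1r absCC; apply: le_trans (uD _) _; first by rewrite addr_gt0.
  rewrite ler_wpM2l ?defect_D_ge0 // lef_pV2 ?posrE ?addr_gt0 //; lra.
move: Tv; move: (complex.Re _) => r Tv.
rewrite [leLHS](_ : _ = 2 * pi * v * (1 - r)); last by field; rewrite gt_eqF.
rewrite (_ : 2 * pi * D = 2 * pi * v * (D / v)); last by field; rewrite gt_eqF.
by apply: ler_wpM2l => //; rewrite !mulr_ge0 ?pi_ge0 // ltW.
Qed.

Lemma defect_in_HE : in_HE E defect.
Proof.
apply: (in_HE_intro entire_defect defect_H2bound (M' := absC (- u) ^+ 2 * (2 * pi * D) + 0 * pi)).
by apply: H2bound_eq (H2boundZ (- u) defect_H2bound) => z _; rewrite fstar_defect mulrA.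
Qed.

(** On the line the product is g/E - u conj(fstar g / E), and [mulz_dom_cint] makes both integrals
    vanish. At a real zero of E all terms are 0. *)
Lemma defect_orthogonal g : mulz_dom E g ->
  let p t := g (RtoC t) / E (RtoC t) * cconj (defect (RtoC t) / E (RtoC t)) in
  cintble p /\ cint p = 0.
Proof.
move=> hg; have [[i1 c1] [i2 c2]] := mulz_dom_cint hg => p.
have pE : p = fun t => g (RtoC t) / E (RtoC t) +
    (- u) * cconj (fstar g (RtoC t) / E (RtoC t)).
  apply/funext => t; rewrite /p cconj_div -fstarR fstar_defect /defect !fstarR cconj_div cconjK.
  have [->|E0] := eqVneq (E (RtoC t)) 0.
    by rewrite cconj_R invr0 !mulr0 addr0.
  have Ec0 : cconj (E (RtoC t)) != 0 by rewrite cconj_eq0.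
  rewrite [LHS](_ : _ = u * cconj u * (g (RtoC t) / E (RtoC t)) - u * (g (RtoC t) / cconj (E (RtoC t)))).
    by rewrite mul_conj_u mul1r mulNr.
  by field; rewrite E0 Ec0.
rewrite pE; have j2 := cintble_conj i2.
split; first by apply: cintbleD => //; exact: cintbleZ.
by rewrite cintD ?cintZ ?cint_conj ?c1 ?c2 //; [rewrite cconj_R mulr0 addr0|exact: cintbleZ].
Qed.

(** With norm 0, Cauchy's formula gives [defect] the value 0 at i, that is conj u * Theta(i) = 1,
    against |Theta(i)| < 1. *)
Lemma defect_norm_pos : (0 < nnint (sqn (fun t => (defect (RtoC t) / E (RtoC t))%R)))%E.
Proof.
rewrite ltNge; apply/negP => N0; set s := fun t => _ in N0.
have bS := dB_quot_bv dE entire_defect defect_H2bound.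
have Im1 : 0 < complex.Im (Iy 1) by rewrite Im_Iy.
suff s0 : defect (Iy 1) / E (Iy 1) = 0.
  have := Theta_lt1 dE Im1; rewrite ltNge => /negP; apply.
  move: s0; rewrite defect_quot // => /subr0_eq /(congr1 absC).
  by rewrite absC1 absCM absC_conj u1 mul1r => /esym ->.
have := bv_cauchy bS ltr01; rewrite -/(Iy 1) => cE.
have c0 : cint (fun t => s t / (RtoC t - Iy 1)) = 0.
  apply/eqP; rewrite -absC_eq0 eq_le absC_ge0 andbT; apply/ler_addgt0Pl => e e0; rewrite addr0.
  have en : e != 0 by rewrite gt_eqF.
  have pn : (pi : R) != 0 by rewrite gt_eqF ?pi_gt0.
  have pe : 0 < 2 * (pi : R) / e by rewrite divr_gt0 // mulr_gt0 // pi_gt0.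
  (* The weights are inverse to each other; as the norm of s is 0, the bound is 2 (0 + e / 2) =
     e. *)
  apply: le_trans (@cdom_abs_le (fun t => e / (2 * pi) * cauchyG 1 t)
    (fun t => 2 * pi / e * sqn s t) _ 0 (e / (2 * pi) * pi) _ _ _ _ _ _ _ _) _.
  - apply: cmeas_div; first exact: bv_meas bS.
    by apply: cmeasB; [exact: cmeas_RtoC|exact: cmeas_cst].
  - by apply: mfunM; [exact: mfun_cst|exact: mfun_cauchyG].
  - by apply: mfunM; [exact: mfun_cst|exact: mfun_sqn (bv_meas bS)].
  - by move=> x; rewrite mulr_ge0 ?cauchyG_ge0 // divr_ge0 ?ltW // mulr_gt0 // pi_gt0.
  - by move=> x; rewrite mulr_ge0 ?sqn_ge0 // ltW.
  - rewrite -(mulr0 (2 * pi / e)); apply: nnintZ_le => //; [exact: mfun_sqn (bv_meas bS)| |exact: ltW].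
    by move=> x; exact: sqn_ge0.
  - apply: nnintZ_le => //; [exact: mfun_cauchyG|by move=> x; exact: cauchyG_ge0| |].
      by rewrite divr_ge0 ?ltW // mulr_gt0 // pi_gt0.
    by rewrite nnint_cauchyG // divr1.
  - move=> x; rewrite sqn_div /sqn absC_kern_m -/(cauchyG 1 x).
    rewrite mulrACA (_ : 2 * pi / e * (e / (2 * pi)) = 1) ?mul1r //.
    by rewrite mulrA divfK // mulfV // mulf_neq0 // pnatr_eq0.
  - by rewrite add0r mulrC -(mulrA _ _ 2) (mulrC _ 2) divfK // mulf_neq0 // pnatr_eq0.
move: cE; rewrite c0 => /esym/eqP; rewrite mulf_eq0 => /orP[|/eqP //].
rewrite !mulf_eq0 pnatr_eq0 /= -!absC_eq0 absC_i absC_R.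
by rewrite gtr0_norm ?pi_gt0 // (gt_eqF (pi_gt0 _)) oner_eq0.
Qed.

(** By orthogonality the squared distance from [defect] to any g in the domain is at least its own
    squared norm, which is therefore taken as the tolerance e. *)
Lemma not_densely_defined : ~ mulz_densely_defined E.
Proof.
move=> dense; set s := fun t => defect (RtoC t) / E (RtoC t).
have bS := dB_quot_bv dE entire_defect defect_H2bound.
have ms : mfun (sqn s) := mfun_sqn (bv_meas bS).
have sM := bv_bdry bS; have is_ := nnint_integrable ms (sqn_ge0 s) sM.
have N0 := defect_norm_pos; rewrite -/s in N0.
have Ns := nnint_Rintegral (sqn_ge0 s) is_.
have [|g [hg]] := dense _ defect_in_HE (\int[mu]_x sqn s x); first by rewrite -lte_fin -Ns.
rewrite HE_norm2E -Ns ltNge => /negP; apply.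
have [M [bg _]] := in_HE_bv hg.1.
pose a t := g (RtoC t) / E (RtoC t).
have ma : cmeas a := bv_meas bg.
have [ip cp] := defect_orthogonal hg.
have ia := nnint_integrable (mfun_sqn ma) (sqn_ge0 a) (bv_bdry bg).
set r := fun t => _; have rE : r = fun t => s t - a t by apply/funext => t; rewrite /r mulrBl.
have mr : cmeas r by rewrite rE; apply: cmeasB => //; exact: bv_meas bS.
have ir : mu.-integrable setT (EFin \o sqn r).
  apply: (int_le_abs (g := fun t => 2 * sqn s t + 2 * sqn a t)); first exact: mfun_sqn.
    move=> t; rewrite ger0_norm ?sqn_ge0 // rE /sqn.
    by apply: le_trans (sqr_absD _ _) _; rewrite absCN.
  by apply: integrableD_real; exact: integrableZ_real.
rewrite Ns (nnint_Rintegral (sqn_ge0 r) ir) lee_fin.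
have i2 := integrableZ_real 2 ip.1.
have -> : \int[mu]_x sqn s x = \int[mu]_x (sqn s x - 2 * complex.Re (a x * cconj (s x))).
  rewrite RintegralB // RintegralZl; [|by []|exact: ip.1].
  by have := congr1 (@complex.Re R) cp; rewrite /cint /= => ->; rewrite mulr0 subr0.
apply: le_Rintegral => //; first exact: integrableB_real.
move=> t _; rewrite rE /sqn -subr_ge0 !absC_sqr ReM ReB ImB /=.
rewrite [leRHS](_ : _ = complex.Re (a t) ^+ 2 + complex.Im (a t) ^+ 2); last by ring.
by rewrite addr_ge0 ?sqr_ge0.
Qed.

End defect.
End orthogonality.

(** * Density *)

Section density.
Variable E : C -> C.
Hypothesis dE : deBranges E.

Section kernel.
Variable y : R.
Hypothesis y0 : 0 < y.
Let w := Iy y.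
Let th := Theta E w.
Let m := 1 - absC th ^+ 2.

Lemma Iy_gt0 : 0 < complex.Im w.
Proof. by rewrite Im_Iy. Qed.

Lemma Iy_neq0 : w != 0.
Proof. by apply/eqP => h; have := Iy_gt0; rewrite h ltxx. Qed.

Lemma defect_gt0 : 0 < m.
Proof. by rewrite subr_gt0 expr_lt1 ?absC_ge0 //; exact: Theta_lt1 Iy_gt0. Qed.

Lemma one_sub_sqr_le a : absC a <= 1 ->
  absC (1 - cconj th * a) ^+ 2 <= 1 + absC th ^+ 2 - 2 * complex.Re (cconj th * a).
Proof.
move=> a1; set b := cconj th * a.
have : absC b ^+ 2 <= absC th ^+ 2.
  rewrite /b absCM absC_conj exprMn -[leRHS]mulr1 ler_wpM2l ?sqr_ge0 //.
  by rewrite expr_le1 ?absC_ge0.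
move: (absC th ^+ 2) => r; rewrite !absC_sqr ReB ImB /=.
move: (complex.Re b) (complex.Im b) => X Y; rewrite -subr_ge0 => h; rewrite -subr_ge0.
by rewrite [leRHS](_ : _ = r - (X ^+ 2 + Y ^+ 2)) //; ring.
Qed.

(** Equal to |1 - conj(th) Theta|^2 times the weight wherever |Theta| = 1. Being affine in Re Theta,
    it has an integral that Poisson's formula computes exactly. *)
Definition poisson_majorant t := (1 + absC th ^+ 2 - 2 * complex.Re (cconj th * Theta E (RtoC t))) * cauchyG y t.

Lemma majorant_bound_ge0 t :
  0 <= 1 + absC th ^+ 2 - 2 * complex.Re (cconj th * Theta E (RtoC t)).
Proof. by apply: le_trans (one_sub_sqr_le (Theta_le1 E t)); exact: sqr_ge0. Qed.

Lemma majorant_ge0 t : 0 <= poisson_majorant t.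
Proof. by rewrite mulr_ge0 ?cauchyG_ge0 ?majorant_bound_ge0. Qed.

Lemma cmeas_th_Theta : cmeas (fun t => cconj th * Theta E (RtoC t)).
Proof. by apply: cmeasM; [exact: cmeas_cst|exact: Theta_meas]. Qed.

Lemma mfun_majorant : mfun poisson_majorant.
Proof.
apply: mfunM; last exact: mfun_cauchyG.
apply: mfunB; first exact: mfun_cst.
by apply: mfunM; [exact: mfun_cst|exact: cmeas_th_Theta.1].
Qed.

Lemma nnint_majorant : nnint poisson_majorant = (pi / y * m)%:E.
Proof.
have th1 : absC th <= 1 by apply: ltW; exact: Theta_lt1 Iy_gt0.
have aT a : absC a <= 1 -> absC (cconj th * a) <= 1.
  by move=> a1; rewrite absCM absC_conj mulr_ile1 ?absC_ge0.
rewrite (@poisson_affine (fun z => cconj th * Theta E z) y) //.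
- by rewrite -/w -/th (mulrC (cconj th)) mulC_conj /= /m; congr EFin; ring.
- by move=> z z0; apply: holoM; [exact: holo_cst|exact: Theta_holo].
- by move=> z z0; apply: aT; apply: ltW; exact: Theta_lt1.
- exact: cmeas_th_Theta.
- by apply: ae_imp (Theta_cont dE) => x cx; apply: ccontM => //; exact: ccont_cst.
- by move=> t; apply: aT; exact: Theta_le1.
- exact: majorant_bound_ge0.
Qed.

(** Off the real zeros of E this is the conjugate of [rkern] / E on the line. *)
Definition value_kern t := (1 - cconj (Theta E (RtoC t)) * th) / (RtoC t - w).

Lemma cmeas_value_kern : cmeas value_kern.
Proof.
apply: cmeas_div; apply: cmeasB; [exact: cmeas_cst| |exact: cmeas_RtoC|exact: cmeas_cst].
by apply: cmeasM; [apply: cmeas_conj; exact: Theta_meas|exact: cmeas_cst].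
Qed.

Lemma sqn_value_kern t : sqn value_kern t =
  absC (1 - cconj th * Theta E (RtoC t)) ^+ 2 * cauchyG y t.
Proof.
rewrite sqn_div /sqn absC_kern_m; congr (_ ^+ 2 / _).
by rewrite -absC_conj cconjB cconjM cconjK [cconj 1]cconj_R mulrC.
Qed.

Lemma sqn_value_kern_le t : sqn value_kern t <= poisson_majorant t.
Proof.
by rewrite sqn_value_kern ler_wpM2r ?cauchyG_ge0 //; apply: one_sub_sqr_le; exact: Theta_le1.
Qed.

Lemma sqn_value_kern_le4 t : sqn value_kern t <= 4 / y ^+ 2.
Proof.
have th1 : absC th <= 1 by apply: ltW; exact: Theta_lt1 Iy_gt0.
rewrite sqn_value_kern; apply: ler_pM; rewrite ?sqr_ge0 ?cauchyG_ge0 //.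
  rewrite (_ : 4 = 2 ^+ 2); last by ring.
  rewrite ler_pXn2r ?nnegrE ?absC_ge0 //; apply: le_trans (absCB _ _) _.
  rewrite absC1 absCM absC_conj.
  by have := mulr_ile1 (absC_ge0 _) (absC_ge0 _) th1 (Theta_le1 E t); move: (_ * _) => X; lra.
by rewrite lef_pV2 ?posrE ?cauchyG_gt0 ?exprn_gt0 // lerDr sqr_ge0.
Qed.

(** The reproducing property. The term f/(E (t - w)) gives the value at w by Cauchy's formula; the
    term with conj(Theta) is the conjugate of fstar f/(E (t + w)), whose integral is 0. *)
Lemma value_integral f : in_HE E f ->
  cint (fun t => f (RtoC t) / E (RtoC t) * value_kern t) =
    2%:R * RtoC pi * iC * (f w / E w).
Proof.
move=> hf; have [M [b1 b2]] := in_HE_bv dE hf.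
have i1 := kern_m_cintble y0 (bv_meas b1) (bv_bdry b1).
have i2 : cintble (fun t => fstar f (RtoC t) / E (RtoC t) / (RtoC t + w)).
  apply: cdom_cintble (kern_p_cdom y (bv_meas b2) (bv_bdry b2)).
    by move=> x; exact: cauchyG_ge0.
  exact: integrable_cauchyG.
rewrite -(bv_cauchy b1 y0) -/(Iy y) -/w.
have j2 := cintbleZ (- th) (cintble_conj i2).
rewrite (@cint_eq _ (fun t => f (RtoC t) / E (RtoC t) / (RtoC t - w) +
   - th * cconj (fstar f (RtoC t) / E (RtoC t) / (RtoC t + w)))).
  rewrite cintD // cintZ ?cint_conj //; last exact: cintble_conj.
  by rewrite (bv_cauchy0 b2 y0) [cconj 0]cconj_R mulr0 addr0.
move=> t; have n1 := kern_m_neq0 t y0; rewrite -/(Iy y) -/w in n1.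
rewrite /value_kern /Theta !fstarR !cconj_div cconjK cconjD cconj_R /w cconj_Iy -/w cconjK.
have [->|E0] := eqVneq (E (RtoC t)) 0; first by rewrite [cconj 0]cconj_R invr0 !mulr0 !mul0r mulr0 addr0.
have Ec0 : cconj (E (RtoC t)) != 0 by rewrite cconj_eq0.
by field; rewrite n1 Ec0 E0.
Qed.

Let N0 z := E z - cconj th * fstar E z.

(* Up to a constant factor, the reproducing kernel of H(E) at w. *)
Definition rkern := divdiff (cconj w) N0.

Lemma rkernE z : rkern z * (z + w) = N0 z.
Proof.
have -> : z + w = z - cconj w by rewrite /w cconj_Iy opprK.
rewrite /rkern divdiffE (_ : N0 (cconj w) = 0) ?subr0 //.
rewrite /N0 /fstar cconjK /th /Theta /fstar !cconj_div !cconjK.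
by rewrite divfK ?subrr // cconj_eq0 dB_neq0 //; exact: Iy_gt0.
Qed.

Lemma entire_rkern : entire rkern.
Proof.
apply: divdiff_entire => z; apply: holoB; first exact: dE.1.
by apply: holoM; [exact: holo_cst|exact: entire_fstar dE.1 z].
Qed.

Lemma rkern_quot z : E z != 0 -> z + w != 0 -> rkern z / E z = (1 - cconj th * Theta E z) / (z + w).
Proof.
move=> E0 zw; apply: (mulIf zw); rewrite mulrAC rkernE /N0 /Theta divfK //.
by rewrite mulrBl divff // mulrA.
Qed.

Lemma fstar_rkern z : fstar rkern z * (z - w) = fstar E z - th * E z.
Proof.
have -> : z - w = cconj (cconj z + w) by rewrite cconjD cconjK /w cconj_Iy.
by rewrite /fstar -cconjM rkernE /N0 cconjB cconjM !cconjK.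
Qed.

Lemma shift_w_neq0 z : 0 < complex.Im z -> z + w != 0.
Proof. by move=> z0; apply: shift_neq0 => //; exact: ltW. Qed.

(** [rkern] / E is at most 2/|z + w|. Its fstar over E is (Theta - th)/(z - w), singular in form at
    w; with q that quotient divided by z + w, [H2bound_divide] bounds q, and the quotient is
    recovered as q (z - w) + 2 w q. *)
Lemma rkern_in_HE : in_HE E rkern.
Proof.
have b0 := H2bound_shift y0.
have th1 : absC th <= 1 by apply: ltW; exact: Theta_lt1 Iy_gt0.
have hs z : holo_at (fun z => z + w) z by apply: holoD; [exact: holo_id|exact: holo_cst].
have b1 : exists M, H2bound (fun z => rkern z / E z) M.
  exists (2 ^+ 2 * (0 * 0 + (1 + y ^- 2) * pi) + 0 * pi); apply: (H2bound_mul b0) => // z z0.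
    by apply: holo_div; [exact: entire_rkern|exact: dE.1|exact: dB_neq0].
  rewrite (rkern_quot (dB_neq0 dE z0) (shift_w_neq0 z0)) absCM ler_wpM2r ?absC_ge0 //.
  apply: le_trans (absCB _ _) _; rewrite absC1 absCM absC_conj.
  have := mulr_ile1 (absC_ge0 _) (absC_ge0 _) th1 (ltW (Theta_lt1 dE z0)).
  by move: (_ * _) => X; lra.
pose N z := (Theta E z - th) / (z + w).
have [M2 b2] : exists M, H2bound N M.
  exists (2 ^+ 2 * (0 * 0 + (1 + y ^- 2) * pi) + 0 * pi); apply: (H2bound_mul b0) => // z z0.
    apply: holo_div; [|exact: hs|exact: shift_w_neq0].
    by apply: holoB; [exact: Theta_holo|exact: holo_cst].
  rewrite /N absCM ler_wpM2r ?absC_ge0 //.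
  apply: le_trans (absCB _ _) _; have := Theta_lt1 dE z0; lra.
pose q z := fstar rkern z / E z / (z + w).
have qN z : 0 < complex.Im z -> q z * (z - w) = N z.
  move=> z0; rewrite /q /N; have E0 := dB_neq0 dE z0.
  rewrite mulrAC; congr (_ / _); rewrite mulrAC fstar_rkern mulrBl /Theta.
  by rewrite -mulrA mulfV // mulr1.
have [M3 b3] : exists M, H2bound q M.
  apply: (H2bound_divide y0 b2 _ qN) => z z0; apply: holo_div; [|exact: hs|exact: shift_w_neq0].
  by apply: holo_div; [exact: entire_fstar entire_rkern z|exact: dE.1|exact: dB_neq0].
have [M1 b1'] := b1; apply: (in_HE_intro entire_rkern b1').
apply: H2bound_eq (H2boundD b2 (H2boundZ (2%:R * w) b3)) => z z0.
rewrite -qN // /q; have zw := shift_w_neq0 z0; have E0 := dB_neq0 dE z0.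
by field; rewrite zw E0.
Qed.

Lemma sqn_rkern_le t : sqn (fun t => rkern (RtoC t) / E (RtoC t)) t <= poisson_majorant t.
Proof.
rewrite /sqn; have [->|E0] := eqVneq (E (RtoC t)) 0.
  by rewrite invr0 mulr0 absC0 expr0n majorant_ge0.
have tw : RtoC t + w != 0 by exact: kern_p_neq0.
rewrite rkern_quot // absCM absCV exprMn exprVn absC_kern_p.
by rewrite ler_wpM2r ?cauchyG_ge0 //; apply: one_sub_sqr_le; exact: Theta_le1.
Qed.

Lemma rkern_value : rkern w / E w = RtoC m / (2%:R * w).
Proof.
have zw := shift_w_neq0 Iy_gt0; have E0 := dB_neq0 dE Iy_gt0.
rewrite rkern_quot // -/th [cconj th * _]mulrC mulC_conj /m RtoCB.
by congr (_ / _); rewrite mulr_natl mulr2n.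
Qed.

Lemma rkern_neq0 : rkern w != 0.
Proof.
apply/eqP => h; have := rkern_value; rewrite h mul0r => /esym/eqP.
rewrite mulf_eq0 invr_eq0 mulf_eq0 pnatr_eq0 (negPf Iy_neq0) /= orbF.
by rewrite -absC_eq0 absC_R normr_eq0 gt_eqF // defect_gt0.
Qed.

(* -w (f - c Q)/(z - w), with c removing the pole; it tends to f as w -> i oo. *)
Definition dB_approx f : C -> C :=
  let c := f w / rkern w in fun z => - w * divdiff w (fun z => f z - c * rkern z) z.

Lemma dB_approx_dom f : in_HE E f -> mulz_dom E (dB_approx f).
Proof.
move=> hf; set c := f w / rkern w.
have hN : in_HE E (fun z => f z - c * rkern z).
  have := in_HE_D hf (in_HE_Z (- c) rkern_in_HE); congr (in_HE _ _).
  by apply/funext => z; rewrite mulNr.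
have [d1 d2] : mulz_dom E (divdiff w (fun z => f z - c * rkern z)).
  by apply: mulz_dom_divdiff => //; rewrite -/w /c divfK ?subrr // rkern_neq0.
split; first exact: in_HE_Z.
have := in_HE_Z (- w) d2; congr (in_HE _ _); apply/funext => z.
by rewrite /dB_approx mulrCA.
Qed.

Lemma dB_approx_sqn f t :
  sqn (fun t => (f (RtoC t) - dB_approx f (RtoC t)) / E (RtoC t)) t <=
  2 * (sqn (fun t => f (RtoC t) / E (RtoC t)) t * (t ^+ 2 * cauchyG y t)) +
  2 * absC (f w / rkern w) ^+ 2 * poisson_majorant t.
Proof.
set c := f w / rkern w; have tw : RtoC t - w != 0 by exact: kern_m_neq0.
have h : divdiff w (fun z => f z - c * rkern z) (RtoC t) = (f (RtoC t) - c * rkern (RtoC t)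
    - (f w - c * rkern w)) / (RtoC t - w).
  by apply: (mulIf tw); rewrite divfK // divdiffE.
have Nw : f w - c * rkern w = 0 by rewrite /c divfK ?subrr // rkern_neq0.
rewrite {1}/sqn /dB_approx -/c h Nw subr0.
rewrite (_ : _ / E (RtoC t) = f (RtoC t) / E (RtoC t) * (RtoC t / (RtoC t - w)) +
    - c * (rkern (RtoC t) / E (RtoC t)) * (w / (RtoC t - w))); last first.
  move: (E _)^-1 => e; by field.
have hb : absC (RtoC t / (RtoC t - w)) ^+ 2 = t ^+ 2 * cauchyG y t.
  by rewrite absCM absCV exprMn exprVn absC_kern_m absC_R -normrX ger0_norm ?sqr_ge0.
have hd : absC (w / (RtoC t - w)) ^+ 2 <= 1.
  rewrite absCM absCV exprMn exprVn absC_kern_m ler_pdivrMr ?cauchyG_gt0 // mul1r.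
  by rewrite absCM absC_i mul1r absC_R -normrX ger0_norm ?sqr_ge0 // lerDr sqr_ge0.
clear h Nw; clearbody c; move: (sqn_rkern_le t) hb hd; rewrite /sqn.
move: (RtoC t / (RtoC t - w)) (w / (RtoC t - w)) (f (RtoC t) / E (RtoC t)) (rkern (RtoC t) / E (RtoC t)).
move=> b d a q hq hb hd; apply: le_trans (sqr_absD _ _) _; rewrite !absCM absCN !exprMn hb.
apply: lerD => //; rewrite -[leRHS]mulrA ler_wpM2l // -[leLHS]mulrA ler_wpM2l ?sqr_ge0 //.
by rewrite -[leRHS]mulr1; apply: ler_pM => //; exact: sqr_ge0.
Qed.

End kernel.
End density.

Section density_limit.
Variable E : C -> C.
Hypothesis dE : deBranges E.
Let d n := 1 - absC (Theta E (Iy n.+1%:R)) ^+ 2.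
Hypothesis dinf : forall A : R, exists N, forall n, (N <= n)%N -> A <= n.+1%:R * d n.

Let y0 n : (0 : R) < n.+1%:R. Proof. by rewrite ltr0n. Qed.

Let d0 n : 0 < d n. Proof. exact: defect_gt0. Qed.

Lemma Ccvg_absC0 (u : nat -> C) (a : nat -> R) : (forall n, absC (u n) ^+ 2 <= a n) ->
  (forall e : R, 0 < e -> exists N, forall n, (N <= n)%N -> a n < e) -> Ccvg u 0.
Proof.
move=> ua h e e0; have [N hN] := h _ (exprn_gt0 2 e0); exists N => n /hN an.
rewrite subr0 -(@ltr_pXn2r _ 2) ?nnegrE ?absC_ge0 ?(ltW e0) //.
exact: le_lt_trans (ua n) an.
Qed.

(** The factor c n normalises the kernels to squared norm at most pi. They tend to 0 pointwise since
    c n^2 * 4 / y^2 = 4 / (y d n), so their pairings with the fixed f/E tend to 0, with |f/E|^2 as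
    the fixed factor of the domination. *)
Lemma value_decay f : in_HE E f -> forall e : R, 0 < e -> exists N, forall n, (N <= n)%N ->
  absC (f (Iy n.+1%:R) / E (Iy n.+1%:R)) ^+ 2 * (n.+1%:R / d n) < e.
Proof.
move=> hf e e0; have [M [bf _]] := in_HE_bv dE hf.
pose F t := f (RtoC t) / E (RtoC t); pose c n : R := Num.sqrt (n.+1%:R / d n).
have c2 n : c n ^+ 2 = n.+1%:R / d n by rewrite sqr_sqrtr // divr_ge0 ?ltW.
have mF : cmeas F := bv_meas bf; have FM := bv_bdry bf.
pose g n t := F t * (RtoC (c n) * value_kern E n.+1%:R t).
have mk n : cmeas (fun t => RtoC (c n) * value_kern E n.+1%:R t).
  by apply: cmeasM; [exact: cmeas_cst|exact: cmeas_value_kern].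
have sg n t : sqn (g n) t = c n ^+ 2 * sqn (value_kern E n.+1%:R) t * sqn F t.
  by rewrite /g sqnM /sqn absCM absC_R exprMn real_normK ?num_real // mulrC.
have hg n : cdom (sqn F) pi (g n).
  split; first exact: cmeasM.
  exists (fun t => c n ^+ 2 * poisson_majorant E n.+1%:R t); split.
  - by apply: mfunM; [exact: mfun_cst|exact: mfun_majorant].
  - by move=> t; rewrite mulr_ge0 ?sqr_ge0 ?majorant_ge0.
  - have -> : (pi : R) = c n ^+ 2 * (pi / n.+1%:R * d n).
      by rewrite c2; field; rewrite !gt_eqF.
    apply: nnintZ_le; [exact: mfun_majorant|by move=> t; exact: majorant_ge0|exact: sqr_ge0|].
    by rewrite nnint_majorant.
  - move=> t; rewrite sg ler_wpM2r ?sqn_ge0 // ler_wpM2l ?sqr_ge0 //.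
    exact: sqn_value_kern_le.
have h0 : cdom (sqn F) pi (fun=> 0).
  split; first exact: cmeas_cst.
  exists (fun=> 0); split => //; first exact: mfun_cst.
    by rewrite /nnint integral0 lee_fin pi_ge0.
  by move=> t; rewrite /sqn absC0 expr0n mul0r.
have cv : {ae mu, forall t, Ccvg (fun n => g n t) 0}.
  apply: aeW => t; apply: (@Ccvg_absC0 _ (fun n => 4 * sqn F t / (n.+1%:R * d n))).
    move=> n; rewrite -[leLHS]/(sqn (g n) t) sg.
    have -> : 4 * sqn F t / (n.+1%:R * d n) = c n ^+ 2 * (4 / n.+1%:R ^+ 2) * sqn F t.
      by rewrite c2; field; rewrite !gt_eqF.
    by rewrite ler_wpM2r ?sqn_ge0 // ler_wpM2l ?sqr_ge0 // sqn_value_kern_le4.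
  move=> r r0; have [N hN] := dinf (4 * sqn F t / r + 1); exists N => n /hN h.
  rewrite ltr_pdivrMr ?mulr_gt0 // (mulrC r) -ltr_pdivrMr //.
  by apply: lt_le_trans h; rewrite ltrDl.
have iF := nnint_integrable (mfun_sqn mF) (sqn_ge0 F) FM.
have lim := cdom_limit (sqn_ge0 F) (mfun_sqn mF) iF hg h0 cv.
have cint0 : cint (fun=> 0) = 0 by rewrite /cint /= Rintegral_cst // mul0r.
have cg n : cint (g n) = RtoC (c n) * (2%:R * RtoC pi * iC * (f (Iy n.+1%:R) / E (Iy n.+1%:R))).
  rewrite -(value_integral dE (y0 n) hf) -cintZ.
    by apply: cint_eq => t; rewrite /g mulrCA.
  have := cintbleZ (RtoC (c n))^-1 (cdom_cintble (sqn_ge0 F) iF (hg n)).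
  congr cintble; apply/funext => t; rewrite /g mulrCA mulKf // -absC_gt0 absC_R.
  by rewrite normr_gt0 gt_eqF // sqrtr_gt0 divr_gt0.
have p1 : (1 : R) <= pi by apply: le_trans (pi_ge2 R); lra.
have se : 0 < Num.sqrt e by rewrite sqrtr_gt0.
have [N hN] := lim _ se; exists N => n /hN; rewrite cint0 subr0 cg => h.
have {}h : absC (RtoC (c n) * (2%:R * RtoC pi * iC * (f (Iy n.+1%:R) / E (Iy n.+1%:R)))) ^+ 2 < e.
  rewrite -[ltRHS](sqr_sqrtr (ltW e0)) ltr_pXn2r ?nnegrE ?absC_ge0 //; exact: ltW se.
apply: le_lt_trans h; move: (f _ / _) => v.
rewrite !absCM absC_i mulr1 !absC_R -RtoC_nat absC_R !exprMn !real_normK ?num_real // c2.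
rewrite [leLHS]mulrC ler_wpM2l ?divr_ge0 ?(ltW (d0 n)) //.
rewrite -[leLHS]mul1r ler_wpM2r ?sqr_ge0 // -exprMn; apply: exprn_ege1; lra.
Qed.

Lemma densely_defined : mulz_densely_defined E.
Proof.
move=> f hf e e0; have [M [bf _]] := in_HE_bv dE hf.
pose F t := f (RtoC t) / E (RtoC t).
have mF : mfun (sqn F) := mfun_sqn (bv_meas bf); have FM := bv_bdry bf.
have iF := nnint_integrable mF (sqn_ge0 F) FM.
pose p n t := 2 * (sqn F t * (t ^+ 2 * cauchyG n.+1%:R t)).
have mp n : mfun (p n).
  apply: mfunM; first exact: mfun_cst.
  apply: mfunM => //; apply: mfunM; last exact: mfun_cauchyG.
  by apply: mfun_sqr; exact: mfun_id.
have tG n t : 0 <= t ^+ 2 * cauchyG n.+1%:R t <= 1.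
  rewrite mulr_ge0 ?sqr_ge0 ?cauchyG_ge0 //=.
  by rewrite ler_pdivrMr ?cauchyG_gt0 // mul1r lerDl sqr_ge0.
have p0 n t : 0 <= p n t.
  by have /andP[h _] := tG n t; apply: mulr_ge0 => //; apply: mulr_ge0 => //; exact: sqn_ge0.
have pF n t : p n t <= 2 * sqn F t.
  have /andP[_ h] := tG n t; rewrite ler_wpM2l // -[leRHS]mulr1 ler_wpM2l ?sqn_ge0 //.
have i2F := integrableZ_real 2 iF.
have ip n : mu.-integrable setT (EFin \o p n).
  by apply: (int_le_abs (g := fun t => 2 * sqn F t)) => // t; rewrite ger0_norm.
have cvp : {ae mu, forall t, p n t @[n --> \oo] --> (0 : R)}.
  apply: aeW => t; apply: (proj2 (@seq_cvgP R _ _)) => r r0.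
  have [N hN] := le_nat_eps (2 * sqn F t * t ^+ 2) r0; exists N => n Nn.
  rewrite subr0 ger0_norm //; apply: le_lt_trans hN.
  have v1 : (1 : R) <= n.+1%:R by rewrite ler1n.
  have vN : (N.+1%:R : R) <= n.+1%:R by rewrite ler_nat ltnS.
  rewrite (_ : p n t = 2 * sqn F t * t ^+ 2 * cauchyG n.+1%:R t); last by rewrite /p; ring.
  apply: ler_wpM2l; first by apply: mulr_ge0; [rewrite mulr_ge0 ?sqn_ge0|exact: sqr_ge0].
  rewrite lef_pV2 ?posrE ?cauchyG_gt0 //.
  have : n.+1%:R * 1 <= (n.+1%:R : R) ^+ 2 by rewrite expr2 ler_wpM2l // ltW.
  have := sqr_ge0 t; move: (n.+1%:R : R) (N.+1%:R : R) vN => v w vN.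
  by move: (t ^+ 2) (v ^+ 2) => X Y; lra.
have pabs n t : `|p n t| <= 2 * sqn F t by rewrite ger0_norm.
have [_ lim] := @dct_real R p (fun=> 0) _ mp (@mfun_cst _ _) cvp i2F pabs.
have e2 : 0 < e / 2 by rewrite divr_gt0.
(* The kernel part of the error is 2 c (pi / y) d with c = |f/E|^2 * 4 y^2 / d^2, that is 8 pi times
   the quantity of [value_decay]. *)
have e3 : 0 < e / (2 * (8 * pi)) by rewrite divr_gt0 // !mulr_gt0 // pi_gt0.
have [N1 h1] := (proj1 (@seq_cvgP R _ _) lim) _ e2.
have [N2 h2] := value_decay hf e3.
pose n := maxn N1 N2.
have {}h1 := h1 n (leq_maxl _ _); have {}h2 := h2 n (leq_maxr _ _).
exists (dB_approx E n.+1%:R f); split; first exact: dB_approx_dom.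
set w := Iy n.+1%:R in h2.
pose c := absC (f w / rkern E n.+1%:R w) ^+ 2.
have cE : c = absC (f w / E w) ^+ 2 * (4 * n.+1%:R ^+ 2 / d n ^+ 2).
  have := congr1 (fun z => absC z ^+ 2) (rkern_value dE (y0 n)); rewrite -/w -/(d n).
  have -> : absC (RtoC (d n) / (2%:R * w)) ^+ 2 = d n ^+ 2 / (4 * n.+1%:R ^+ 2).
    rewrite !absCM absCV !absCM absC_i mul1r -RtoC_nat !absC_R exprMn exprVn exprMn.
    by rewrite !real_normK ?num_real //; congr (_ / (_ * _)); ring.
  have E0 : absC (E w) != 0 by rewrite absC_eq0 dB_neq0 // Im_Iy.
  have Q0 : absC (rkern E n.+1%:R w) != 0 by rewrite absC_eq0 rkern_neq0.
  rewrite /c !absCM !absCV !exprMn !exprVn => h.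
  have {h} -> : absC (rkern E n.+1%:R w) ^+ 2 = absC (E w) ^+ 2 * (d n ^+ 2 / (4 * n.+1%:R ^+ 2)).
    by rewrite -h mulrC divfK // expf_neq0.
  by field; rewrite E0 !gt_eqF.
rewrite HE_norm2E //.
apply: (@le_lt_trans _ _ (nnint (fun t => (p n t + 2 * c * poisson_majorant E n.+1%:R t)%R))).
  apply: nnint_le => //.
  - apply: mfun_sqn; have [Ma [ba _]] := in_HE_bv dE (dB_approx_dom dE (y0 n) hf).1.
    rewrite (_ : (fun t => _) = fun t => F t - dB_approx E n.+1%:R f (RtoC t) / E (RtoC t)).
      by apply: cmeasB; [exact: bv_meas bf|exact: bv_meas ba].
    by apply/funext => t; rewrite mulrBl.
  - by apply: mfunD => //; apply: mfunM; [exact: mfun_cst|exact: mfun_majorant].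
  - by move=> t; exact: sqn_ge0.
  - by move=> t; exact: dB_approx_sqn.
have c0 : 0 <= 2 * c by rewrite mulr_ge0 // sqr_ge0.
have mk : mfun (poisson_majorant E n.+1%:R) by exact: mfun_majorant.
have k0 t : 0 <= poisson_majorant E n.+1%:R t by exact: majorant_ge0.
have m2 : mfun (fun t => 2 * c * poisson_majorant E n.+1%:R t) by apply: mfunM => //; exact: mfun_cst.
rewrite nnintD //; last by move=> t; exact: mulr_ge0.
rewrite (nnintZ mk k0 c0) nnint_majorant // (nnint_Rintegral (p0 n) (ip n)) -EFinM -EFinD lte_fin.
move: h1; rewrite Rintegral_cst // mul0r subr0 => /(le_lt_trans (ler_norm _)) h1.
rewrite -/(d n); have : 2 * c * (pi / n.+1%:R * d n) < e / 2;
  last by move=> h3; rewrite [ltRHS]splitr; exact: ltrD.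
rewrite cE [ltLHS](_ : _ = 8 * pi * (absC (f w / E w) ^+ 2 * (n.+1%:R / d n))); last first.
  by field; rewrite !gt_eqF.
have p8 : (0 : R) < 8 * pi by rewrite mulr_gt0 // pi_gt0.
apply: (@lt_le_trans _ _ (8 * pi * (e / (2 * (8 * pi))))); first by rewrite ltr_pM2l.
move: (8 * pi) p8 => a a0; rewrite (_ : a * _ = e / 2) //.
by field; rewrite gt_eqF.
Qed.

End density_limit.

Theorem theorem11 (E G P : C -> C) (gamma : C) (sigma : R)
    (K : option nat) (zs : nat -> C) :
  deBranges E ->
  (* zeros z_n lie in the open upper half-plane, ordered by modulus *)
  (forall n, inZ K n -> 0 < complex.Im (zs n)) ->
  (forall n, inZ K n -> inZ K n.+1 -> absC (zs n) <= absC (zs n.+1)) ->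
  (* the conj z_n are the zeros of E in the open lower half-plane *)
  (forall w, complex.Im w < 0 -> (E w = 0 <-> exists2 n, inZ K n & w = cconj (zs n))) ->
  (\sum_(1 <= n <oo | inZ K n) (`|complex.Im ((zs n)^-1)|)%:E < +oo)%E ->
  0 <= sigma ->
  absC gamma = 1 ->
  entire G ->
  (forall z, G z = fstar G z) ->
  (forall z, G z = 0 -> complex.Im z = 0) ->
  (forall z, cvgC (fun N => dB_partial K zs N z) (P z)) ->
  (forall z, E z = gamma * G z * expC (- (iC * RtoC sigma * z)) * P z) ->
  mulz_densely_defined E <->
    (0 < sigma \/ (\sum_(1 <= n <oo | inZ K n) (complex.Im (zs n))%:E = +oo)%E).
Proof.
move=> dE zs0 _ _ _ sigma0 gamma1 _ Gstar _ cvgP EE; split => [dense|h].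
  apply: contrapT => /not_orP[nsigma fin].
  have s0 : sigma = 0 by apply/eqP; rewrite eq_le sigma0 andbT leNgt; apply/negP.
  have [u [u1 [D uD]]] := Theta_unimodular_limit dE zs0 gamma1 Gstar cvgP EE s0 fin.
  by apply: (@not_densely_defined E dE u D u1 uD).
apply: densely_defined => //.
exact: Theta_defect_unbounded dE zs0 sigma0 gamma1 Gstar cvgP EE h.
Qed.
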